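(* Suppose that $a=q^{\alpha+l/2}$, $b=-q^{\beta+t/2}$, $c=-q^{t/2}$, $d=q^{l/2}$, where $\alpha,\beta,l,t\in\mathbb{N}$. Let $k_1,k_2\in\mathbb{N}$ be such that $k_1\le\alpha$, $k_2\le\beta$ and set $k=k_1+k_2$. (I) For each $j=1,\dots,k_1$ pick $\delta_j=a$ and $$\phi^{(j)}(\lambda_\gamma)\in\mathrm{span}\{u^{1,m^1_j}(\lambda_\gamma),u^{2,m^1_j}(\lambda_\gamma)\}\qquad(\ast)$$ with $m^1_j\in\{0,1,\dots,\alpha-1\}$ and $m^1_j\neq m^1_i$ for $j\ne i$, and for each $j=k_1+1,\dots,k$ pick $\delta_j=b$ and $$\phi^{(j)}(\lambda_\gamma)\in\mathrm{span}\{v^{1,m^2_{j-k_1}}(\lambda_\gamma),v^{2,m^2_{j-k_1}}(\lambda_\gamma)\}\qquad(\ast\ast)$$ with $m^2_1,\dots,m^2_{k_2}\in\{0,1,\dots,\beta-1\}$ and $m^2_j\ne m^2_i$ for $j\neq i$. Then for generic $\{\phi^{(j)}(\lambda_\gamma)\}$ as in $(\ast)$-$(\ast\ast)$, the polynomials $\hat p_n(x)=\chi_n\mathrm{Wr}_n(\psi^{(1)}_n,\dots,\psi^{(k)}_n,p_n(x))$, with $\psi^{(j)}_n=\phi^{(j)}(\lambda_n)/\xi^{\delta_j}_n$, are orthogonal with respect to a complex measure of the form $$d\hat\mu=\frac{d\mu_{q^{\alpha+l/2},-q^{\beta+t/2},-q^{t/2},q^{l/2}}}{\prod_{j=1}^{k_1}(x-x^+_{m^1_j})\prod_{j=1}^{k_2}(x-x^-_{m^2_j})}+\sum_{j=1}^{k_1}\nu^1_j\,\delta(x-x^+_{m^1_j})+\sum_{j=1}^{k_2}\nu^2_j\,\delta(x-x^-_{m^2_j}),\qquad(\ast\ast\ast)$$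 for some complex numbers $\nu^1_j,\nu^2_j$, where $$x^+_{m^1_j}=\tfrac12\left(q^{m^1_j+l/2}+q^{-m^1_j-l/2}\right),\qquad x^-_{m^2_j}=-\tfrac12\left(q^{m^2_j+t/2}+q^{-m^2_j-t/2}\right).$$ (II) Conversely, suppose that $m^1_j\in\{0,1,\dots,\alpha-1\}$ ($1\le j\le k_1$), $m^2_j\in\{0,1,\dots,\beta-1\}$ ($1\le j\le k_2$) and $m^r_j\ne m^r_i$ for $j\ne i$, $r=1,2$. Then for generic complex numbers $\nu^1_1,\dots,\nu^1_{k_1},\nu^2_1,\dots,\nu^2_{k_2}$ one can construct polynomials $\{\hat p_n(x)\}_{n=0}^\infty$ by the formula in (I), orthogonal with respect to the complex measure in $(\ast\ast\ast)$, by picking $\delta_j=a$ and an appropriate $\phi^{(j)}(\lambda_\gamma)$ as in $(\ast)$ for every $j=1,\dots,k_1$, and $\delta_j=b$ and an appropriate $\phi^{(j)}(\lambda_\gamma)$ as in $(\ast\ast)$ for every $j=k_1+1,\dots,k$.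
   Context: $q\in(0,1)$; $(u;q)_n=\prod_{l=0}^{n-1}(1-uq^l)$, $(u;q)_\infty=\prod_{l\ge0}(1-uq^l)$, $(u_1,\dots,u_j;q)_n=\prod_i(u_i;q)_n$ (similarly for $n=\infty$); ${}_4\phi_3\left[{a_1,a_2,a_3,a_4\atop b_1,b_2,b_3};q,q\right]=\sum_{l\ge0}\frac{(a_1,a_2,a_3,a_4;q)_l}{(b_1,b_2,b_3,q;q)_l}q^l$. Askey-Wilson polynomials: $p_n(x)=p_n(x;a,b,c,d)=\frac{(ab,ac,ad;q)_n}{a^n}\,{}_4\phi_3\left[{q^{-n},\,abcdq^{n-1},\,az,\,az^{-1}\atop ab,\,ac,\,ad};q,q\right]$, $x=\frac12(z+\frac1z)$. The Askey-Wilson measure $\mu_{a,b,c,d}$ on $[-1,1]$ is $d\mu_{a,b,c,d}=\frac{w(x;a,b,c,d)}{2\pi\sqrt{1-x^2}}dx$, $w(x;a,b,c,d)=\frac{(z^2,z^{-2};q)_\infty}{(az,a/z,bz,b/z,cz,c/z,dz,d/z;q)_\infty}$. $\delta(x-x_0)$ denotes the unit point mass at $x_0$. $\lambda_\gamma=(q^{-\gamma}-1)(1-abcdq^{\gamma-1})$. For $m=0,\dots,\alpha-1$: $$u^{1,m}(\lambda_\gamma)={}_4\phi_3\left[{q^{m-\alpha+1},\ q^{-m+\alpha+1}/a^2,\ q^{\gamma+1},\ 1/(abcdq^{\gamma-2})\atop q^2/(ab),\ q^2/(ac),\ q^2/(ad)};q,q\right],$$ $$u^{2,m}(\lambda_\gamma)=\frac{(bcq^\gamma,q^{\gamma+1};q)_{\alpha+l-1}}{(q^\gamma)^{\alpha+l-1}}\,{}_4\phi_3\left[{q^{-\gamma},\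 abcdq^{\gamma-1},\ q^{m+l},\ q^{-m}\atop ad,\ bd,\ cd};q,q\right].$$ For $m=0,\dots,\beta-1$ (replace $(a,b,c,d)$ by $(b,a,d,c)$, $\alpha$ by $\beta$, $l$ by $t$): $$v^{1,m}(\lambda_\gamma)={}_4\phi_3\left[{q^{m-\beta+1},\ q^{-m+\beta+1}/b^2,\ q^{\gamma+1},\ 1/(abcdq^{\gamma-2})\atop q^2/(ab),\ q^2/(bd),\ q^2/(bc)};q,q\right],$$ $$v^{2,m}(\lambda_\gamma)=\frac{(adq^\gamma,q^{\gamma+1};q)_{\beta+t-1}}{(q^\gamma)^{\beta+t-1}}\,{}_4\phi_3\left[{q^{-\gamma},\ abcdq^{\gamma-1},\ q^{m+t},\ q^{-m}\atop bc,\ ac,\ cd};q,q\right].$$ All of these are polynomials in $\lambda_\gamma$. $\xi^a_n=\frac{q^n(abcd/q;q)_n}{a^n(bc,bd,cd,q;q)_n}$, $\xi^b_n=\frac{q^n(abcd/q;q)_n}{b^n(cd,ac,ad,q;q)_n}$, extended meromorphically in $n$ via $(u;q)_n=(u;q)_\infty/(uq^n;q)_\infty$. $\mathrm{Wr}_n(h^{(1)}_n,\dots,h^{(m)}_n)=\det(h^{(i)}_{n-j+1})_{1\le i,j\le m}$. $\eta^{b,j}_n=q^{-n(k-1)}(bcq^{n-j+1},bdq^{n-j+1};q)_{j-1}(acq^{n-k+1},adq^{n-k+1};q)_{k-j}$. With $\delta_{k+1}:=a$, $\chi_n=\prod_{j=1}^{k+1}\xi^{\delta_j}_{n-j+1}\prod_{1\le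 j\le k,\ \delta_j=b}\eta^{b,j}_n$. $\tau_n=\chi_n\prod_{j=1}^{k+1}\frac1{\xi^a_{n-j+1}}\,\mathrm{Wr}_n(\xi^a_n\psi^{(1)}_n,\dots,\xi^a_n\psi^{(k)}_n)$, which after cancellation is a Laurent polynomial in $q^n$ (and is evaluated as such). Expanding the determinant, $\hat p_n(x)=\sum_{l=0}^kQ^{(-l)}_np_{n-l}(x)$, where the coefficients $Q^{(-l)}_n$ and the quotient $\chi_n\xi^a_{n-k-1}/\chi_{n-1}$ are understood via the meromorphic extension in $n$; terms with $l>n$ vanish. Standing assumptions: $\tau_n\ne0$ for $n=-1,0,1,\dots$ and $\chi_n\xi^a_{n-k-1}/\chi_{n-1}$ is well defined and nonzero for $n=0,1,\dots$. ''Generic $\phi^{(j)}$'' means generic so that these hold. ''Generic'' complex numbers $\nu^r_j$ is understood as outside a countable union of proper algebraic subsets of $\mathbb{C}^{k}$. Orthogonal with respect to a complex measure is meant in the bilinear sense: $\int\hat p_n\hat p_m\,d\hat\mu=0$ for $n\neq m$ and $\ne0$ for $n=m$, with $\deg\hat p_n=n$.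
   Formalization: Part (II) is stated under the assumption that at least one choice of φ^(j) as in (∗)-(∗∗) satisfies the standing assumptions; this can fail, e.g. α=2, β=1, l=2, t=1, k1=2, k2=1, where τ_{-1}=0 and p̂_0=0 for every φ. Also l,t≥1. *)

(* Defs.v *)
From HB Require Import structures.
From mathcomp Require Import all_boot all_order all_algebra.
From mathcomp Require Import complex.
From mathcomp Require Import all_classical all_reals all_analysis.
From mathcomp Require Import ring.
From mathcomp Require mpoly.
Import numFieldNormedType.Exports.

Set Implicit Arguments.
Unset Strict Implicit.
Unset Printing Implicit Defensive.

Import Order.TTheory GRing.Theory Num.Theory.
Local Open Scope classical_set_scope.
Local Open Scope ring_scope.
Local Open Scope complex_scope.

(* The complex numbers R[i], packed as a numClosedFieldType: this is the form
   under which MathComp-Analysis equips them with their usual topology. *)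
Definition cplx (R : realType) : numClosedFieldType := R[i].

Definition qpoch (K : numFieldType) (q u : K) (n : nat) : K :=
  \prod_(0 <= i < n) (1 - u * q ^+ i).

Definition qpinf (K : numFieldType) (q u : K) : K :=
  limn (fun n => qpoch q u n).

Section AskeyWilson.
Variable R : realType.
Local Notation C := (cplx R).
Variables q a b c d : R.

(* (u;q)_s for a real index s. *)
Definition qpochr (u s : R) : R := qpinf q u / qpinf q (u * q `^ s).

(* In a terminating series, every term after the last nonzero one is 0 here,
   also when a denominator vanishes there, since 0 / 0 = 0. *)
Definition phi43 (a1 a2 a3 a4 b1 b2 b3 : R) : R :=
  limn (fun N : nat => \sum_(0 <= j < N)
    (qpoch q a1 j * qpoch q a2 j * qpoch q a3 j * qpoch q a4 j)
    / (qpoch q b1 j * qpoch q b2 j * qpoch q b3 j * qpoch q q j) * q ^+ j).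

(* (a z, a / z; q)_j as a polynomial in x = (z + 1 / z) / 2. *)
Definition azpoch (j : nat) : {poly R} :=
  \prod_(0 <= i < j)
    ((1 + (a * q ^+ i) ^+ 2)%:P - (2 * (a * q ^+ i)) *: 'X).

(* The Askey-Wilson polynomials; the sum stops at n because of the factor
   (q^-n; q)_j.  See aw_polyE for the 4phi3 form. *)
Definition aw_poly (n : nat) : {poly R} :=
  (qpoch q (a * b) n * qpoch q (a * c) n * qpoch q (a * d) n / a ^+ n) *:
  \sum_(0 <= j < n.+1)
    ((qpoch q (q ^- n) j * qpoch q (a * b * c * d * q ^+ n / q) j)
     / (qpoch q (a * b) j * qpoch q (a * c) j * qpoch q (a * d) j
        * qpoch q q j) * q ^+ j) *: azpoch j.

(* w(x;a,b,c,d), where x = (z + 1 / z) / 2 with |z| = 1. *)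
Definition aw_weight (x : R) : C :=
  let z : C := x +i* Num.sqrt (1 - x ^+ 2) in
  let Q : C := q%:C in
  qpinf Q (z ^+ 2) * qpinf Q (z ^- 2)
  / (qpinf Q (a%:C * z) * qpinf Q (a%:C / z)
     * (qpinf Q (b%:C * z) * qpinf Q (b%:C / z))
     * (qpinf Q (c%:C * z) * qpinf Q (c%:C / z))
     * (qpinf Q (d%:C * z) * qpinf Q (d%:C / z))).

Definition aw_density (x : R) : C :=
  aw_weight x / (2 * pi * Num.sqrt (1 - x ^+ 2))%:C.

Definition cintegral (f : R -> C) : C :=
  (\int[lebesgue_measure]_(x in `[(-1)%R, 1%R]) complex.Re (f x))%R
  +i* (\int[lebesgue_measure]_(x in `[(-1)%R, 1%R]) complex.Im (f x))%R.

(* Integration against the complex measure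
     dmu_{a,b,c,d} / prod_j (x - y_j) + sum_j nu_j delta(x - y_j). *)
Definition krall_integral (k : nat) (y : 'I_k -> R) (nu : 'I_k -> C)
    (f : R -> C) : C :=
  cintegral (fun x => f x * aw_density x / (\prod_j (x - y j))%:C)
  + \sum_j nu j * f (y j).

Definition lambda (g : R) : R := (q `^ (- g) - 1) * (1 - a * b * c * d * q `^ (g - 1)).

(* Real powers of a real number, on the principal branch when it is negative. *)
Definition rcpow (x s : R) : C :=
  if 0 <= x then (x `^ s)%:C
  else (`|x| `^ s)%:C * (cos (pi * s) +i* sin (pi * s)).

Definition xi_a (s : R) : C :=
  (q `^ s * qpochr (a * b * c * d / q) s)%:C
  / (rcpow a s * (qpochr (b * c) s * qpochr (b * d) s * qpochr (c * d) s
                  * qpochr q s)%:C).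

Definition xi_b (s : R) : C :=
  (q `^ s * qpochr (a * b * c * d / q) s)%:C
  / (rcpow b s * (qpochr (c * d) s * qpochr (a * c) s * qpochr (a * d) s
                  * qpochr q s)%:C).

(* The choices delta_j, j = 1, ..., k, are encoded by a boolean function of
   the 0-based index j - 1: true stands for b and false for a. *)
Definition xi (isb : bool) : R -> C := if isb then xi_b else xi_a.

Section Darboux.
Variables (k : nat) (isb : 'I_k -> bool) (phi : 'I_k -> {poly C}).

(* eta^{b,j+1}_s *)
Definition eta (j : nat) (s : R) : R :=
  q `^ (- (s * k.-1%:R))
  * qpoch q (b * c * q `^ (s - j%:R)) j
  * qpoch q (b * d * q `^ (s - j%:R)) j
  * qpoch q (a * c * q `^ (s - k%:R + 1)) (k - j.+1)
  * qpoch q (a * d * q `^ (s - k%:R + 1)) (k - j.+1).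

Definition chi (s : R) : C :=
  (\prod_(j < k) xi (isb j) (s - j%:R)) * xi_a (s - k%:R)
  * \prod_(j < k | isb j) (eta j s)%:C.

Definition psi (j : 'I_k) (s : R) : C :=
  (phi j).[(lambda s)%:C] / xi (isb j) s.

Definition wr_mx (m : nat) (h : 'I_m -> R -> C) (s : R) : 'M[C]_m :=
  \matrix_(i, j) h i (s - j%:R).

(* The value at n of the meromorphic extension of f is its limit along the
   real line; a pole at n makes the limit fail to exist. *)
Definition extval (f : R -> C) (n : int) : C := lim (f s @[s --> (n%:~R : R)^']).

Definition tau (n : int) : C :=
  extval (fun s => chi s * (\prod_(j < k.+1) (xi_a (s - j%:R))^-1)
                   * \det (wr_mx (fun i s' => xi_a s' * psi i s') s)) n.

Definition ratio (s : R) : C := chi s * xi_a (s - k.+1%:R) / chi (s - 1).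

Definition standing : Prop :=
  (forall n : int, -1 <= n -> tau n != 0) /\
  (forall n : nat, exists2 v : C, v != 0 & ratio s @[s --> (n%:R : R)^'] --> v).

(* Q^{(-l)}_n is the coefficient of p_{n-l} in chi_n Wr_n(psi_1, ..., psi_k, p):
   a cofactor along the last row, on whose content it does not depend. *)
Definition Qcoef (l : 'I_k.+1) (n : nat) : C :=
  extval (fun s => chi s * cofactor
    (wr_mx (fun i => oapp psi (fun=> 0) (unlift ord_max i)) s) ord_max l) n.

Definition phat (n : nat) : {poly C} :=
  \sum_(l < k.+1 | (l <= n)%N)
    Qcoef l n *: map_poly (real_complex R) (aw_poly (n - l)).

End Darboux.
End AskeyWilson.

Section Seeds.
Variable R : realType.
Local Notation C := (cplx R).
Variables q a b c d : R.

(* The functions g |-> u^{1,m}(lambda_g) and g |-> u^{2,m}(lambda_g).  Those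
   denoted v are obtained for (b,a,d,c) in place of (a,b,c,d). *)
Definition u1 (alpha m : nat) (g : R) : R :=
  phi43 q (q `^ (m%:R - alpha%:R + 1)) (q `^ (- m%:R + alpha%:R + 1) / a ^+ 2)
    (q `^ (g + 1)) (a * b * c * d * q `^ (g - 2))^-1
    (q ^+ 2 / (a * b)) (q ^+ 2 / (a * c)) (q ^+ 2 / (a * d)).

Definition u2 (alpha l m : nat) (g : R) : R :=
  qpoch q (b * c * q `^ g) (alpha + l - 1) * qpoch q (q `^ (g + 1)) (alpha + l - 1)
  / (q `^ g) ^+ (alpha + l - 1)
  * phi43 q (q `^ (- g)) (a * b * c * d * q `^ (g - 1)) (q ^+ (m + l)) (q ^- m)
      (a * d) (b * d) (c * d).

Definition in_span (f1 f2 : R -> R) (p : {poly C}) : Prop :=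
  exists c1 c2 : C, forall g : R,
    p.[(lambda q a b c d g)%:C] = c1 * (f1 g)%:C + c2 * (f2 g)%:C.

End Seeds.

Definition admissible (R : realType) (q a b c d : R) (alpha beta l t k1 k2 : nat)
    (m1 : 'I_k1 -> 'I_alpha) (m2 : 'I_k2 -> 'I_beta)
    (phi : 'I_(k1 + k2) -> {poly cplx R}) : Prop :=
  (forall j : 'I_k1,
     in_span q a b c d (u1 q a b c d alpha (m1 j)) (u2 q a b c d alpha l (m1 j))
       (phi (lshift k2 j))) /\
  (forall j : 'I_k2,
     in_span q a b c d (u1 q b a d c beta (m2 j)) (u2 q b a d c beta t (m2 j))
       (phi (rshift k1 j))).

Definition xplus (R : realType) (q : R) (l m : nat) : R :=
  (q `^ (m%:R + l%:R / 2) + q `^ (- m%:R - l%:R / 2)) / 2.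

Definition xminus (R : realType) (q : R) (t m : nat) : R :=
  - ((q `^ (m%:R + t%:R / 2) + q `^ (- m%:R - t%:R / 2)) / 2).

Definition node (R : realType) (q : R) (alpha beta l t k1 k2 : nat)
    (m1 : 'I_k1 -> 'I_alpha) (m2 : 'I_k2 -> 'I_beta) (j : 'I_(k1 + k2)) : R :=
  match fintype.split j with
  | inl i => xplus q l (m1 i)
  | inr i => xminus q t (m2 i)
  end.

Definition orthogonal_polys (R : realType) (p : nat -> {poly cplx R})
    (I : (R -> cplx R) -> cplx R) : Prop :=
  [/\ forall n, size (p n) = n.+1,
      forall n m, n <> m -> I (fun x => (p n).[x%:C] * (p m).[x%:C]) = 0
    & forall n, I (fun x => (p n).[x%:C] * (p n).[x%:C]) <> 0].

Definition algebraic_set (K : numFieldType) (k : nat) (V : set ('I_k -> K)) :=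
  exists S : set (mpoly.mpoly k K),
    V = [set x | forall P, S P -> mpoly.meval x P = 0].

Definition generically (K : numFieldType) (k : nat) (P : ('I_k -> K) -> Prop) :=
  exists2 V : nat -> set ('I_k -> K),
    forall i, algebraic_set (V i) /\ V i <> setT
    & forall x, ~ (\bigcup_i V i) x -> P x.

Lemma azpochE (R : realType) (q a z : R) (j : nat) : z != 0 ->
  (azpoch q a j).[(z + z^-1) / 2] = qpoch q (a * z) j * qpoch q (a / z) j.
Proof.
move=> z0; rewrite /azpoch /qpoch horner_prod -big_split /=.
apply: eq_bigr => i _; rewrite !hornerE /=.
by field.
Qed.

Lemma aw_polyE (R : realType) (q a b c d z : R) (n : nat) : z != 0 -> q != 0 ->
  (aw_poly q a b c d n).[(z + z^-1) / 2] =
  qpoch q (a * b) n * qpoch q (a * c) n * qpoch q (a * d) n / a ^+ n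
  * phi43 q (q ^- n) (a * b * c * d * q ^+ n / q) (a * z) (a / z)
      (a * b) (a * c) (a * d).
Proof.
move=> z0 q0; rewrite /aw_poly hornerZ horner_sum; congr (_ * _).
rewrite /phi43; apply/esym/cvg_lim => //.
apply: cvg_near_cst; near=> N.
have nN : (n.+1 <= N)%N by near: N; exact: nbhs_infty_ge.
rewrite (big_cat_nat _ nN) //= [X in _ + X]big1_seq ?addr0.
  by apply: eq_bigr => j _; rewrite hornerZ azpochE //; ring.
move=> j; rewrite mem_index_iota => /= /andP[nj _].
suff -> : qpoch q (q ^- n) j = 0 by rewrite !mul0r.
rewrite /qpoch (big_cat_nat _ nj) //= big_nat_recr //= mulVf ?expf_neq0 //.
by rewrite subrr mulr0 mul0r.
Unshelve. all: by end_near. Qed.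

(* Main.v *)
From HB Require Import structures.
From mathcomp Require Import all_boot all_order all_algebra perm.
From mathcomp Require Import complex.
From mathcomp Require Import all_classical all_reals all_analysis.
From mathcomp Require Import measurable_realfun.
From mathcomp Require Import ring lra zify.
From mathcomp Require mpoly.
Require Import Defs.
Import numFieldNormedType.Exports.
Import (canonicals) mpoly.

Set Implicit Arguments.
Unset Strict Implicit.
Unset Printing Implicit Defensive.

Import Order.TTheory GRing.Theory Num.Theory.
Import Normc.
Local Open Scope classical_set_scope.
Local Open Scope ring_scope.
Local Open Scope complex_scope.

(* Write N = q^n. In the gauge xi^a the recurrence of the Askey-Wilson polynomials
   reads 2 x D(N) P_n = A(N) P_{n+1} + B(N) P_n + C(N) P_{n-1}. The functions u^1, u^2
   (and omega v^1, omega v^2, with omega = xi^a / xi^b) solve it at x = y_j, because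
   they too are truncated Askey-Wilson sums cut where (a z, a / z; q)_l vanishes.
   As A vanishes at n = -1, a solution Phi_j is determined for n < 0 by Phi_j(-1), and
   for n >= 0 it is K_j (S_j(n) + theta_j P_n(y_j)), where S_j(n) is the integral of
   P_n / (x - y_j) against the Askey-Wilson measure. Hence the measure with masses
   theta_j / prod_{i <> j} (y_j - y_i) at the y_j, tested on hat p_n times a
   polynomial f, sees only the combinations sum_l Q_l Phi_j(n - l), which vanish
   because the Q_l are cofactors. The indices n - l < 0 contribute polynomials in y_j,
   and Lagrange interpolation at the y_j shows that they are harmless for deg f < n and
   give tau_n, up to a nonzero factor, for deg f = n.

   The seed u^2 vanishes at n = -1, so adding c_j u^2 to u^1 keeps K_j and moves
   theta_j affinely in c_j: every choice of masses is reached, and each tau_n becomes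
   a polynomial in the masses, not identically zero since one admissible choice exists.

   The standing assumptions force k < alpha + l and 2 k < alpha + beta + l + t, which
   is what makes the coefficients C and D nonzero for n > -k. *)

(** * The recurrence of truncated Askey-Wilson sums *)

(** The gauge [xi_a] is what opens the range n < 0. The factor 1 - q^n in the coefficient of p_{n-1}
    cuts the p_n off at n = 0; multiplication by xi^a_n removes it there and puts 1 - q^{n+1} into
    the coefficient of p_{n+1}. The value at n = -1 then enters the recurrence at n = 0 as the
    inhomogeneity that functions of the second kind need. The obstacle is that xi^a and xi^b vanish
    at negative integers, so psi^(j) may have poles there. Every quantity is therefore cancelled at
    non-integer arguments into a form continuous at the integers, which yields its meromorphic
    value. As a, d > 0 > b, c, the products ab, ac, bd, cd are negative, and the only resonances
    come from ad = q^(alpha+l) and bc = q^(beta+t). Orthogonality of the p_n themselves does not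
    require the value of the Askey-Wilson integral: one linear relation between the first two
    moments, for each a q^j in place of a, and positivity of the total mass suffice. *)

Section Qpoch.
Variables (K : numFieldType) (q : K).

Lemma qpoch0 u : qpoch q u 0 = 1.
Proof. by rewrite /qpoch big_geq. Qed.

Lemma qpochS u n : qpoch q u n.+1 = qpoch q u n * (1 - u * q ^+ n).
Proof. by rewrite /qpoch big_nat_recr. Qed.

Lemma qpochSl u n : qpoch q u n.+1 = (1 - u) * qpoch q (u * q) n.
Proof.
rewrite /qpoch big_nat_recl //= expr0 mulr1; congr (_ * _).
by apply: eq_bigr => i _; rewrite exprS mulrA.
Qed.

Lemma qpoch_neq0 u n :
  (forall i, (i < n)%N -> 1 - u * q ^+ i != 0) -> qpoch q u n != 0.
Proof.
move=> h; rewrite /qpoch prodf_seq_neq0; apply/allP => i.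
by rewrite mem_index_iota /= => /h.
Qed.

End Qpoch.

Section Recurrence.
Variables (R : realType) (q a b c d x : R).
Local Notation e := (a * b * c * d).

(* [N] stands for q^n and is kept free: the seed functions are such sums with
   other parameters, cut before the series terminates in [N]. *)
Definition aw_term (N : R) (j : nat) : R :=
  qpoch q N^-1 j * qpoch q (e * N / q) j
  / (qpoch q (a * b) j * qpoch q (a * c) j * qpoch q (a * d) j * qpoch q q j)
  * q ^+ j * (azpoch q a j).[x].

Definition aw_sum (J : nat) (N : R) : R := \sum_(0 <= j < J) aw_term N j.

(** The recurrence is multiplied by its common denominator, so that it keeps a meaning at those
    negative n where the denominator vanishes; such n are what bounds 2 k. *)
Definition recD (N : R) : R :=
  (1 - e * N ^+ 2 / q ^+ 2) * (1 - e * N ^+ 2 / q) * (1 - e * N ^+ 2).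

Definition recA (N : R) : R :=
  (1 - a * b * N) * (1 - a * c * N) * (1 - a * d * N) * (1 - e * N / q)
  * (1 - e * N ^+ 2 / q ^+ 2) / a.

Definition recC (N : R) : R :=
  a * (1 - N) * (1 - b * c * N / q) * (1 - b * d * N / q) * (1 - c * d * N / q)
  * (1 - e * N ^+ 2).

Lemma azpochS j : (azpoch q a j.+1).[x]
  = (azpoch q a j).[x] * (1 + (a * q ^+ j) ^+ 2 - 2 * (a * q ^+ j) * x).
Proof. by rewrite /azpoch big_nat_recr //= hornerM !hornerE. Qed.

Lemma azpoch0 : (azpoch q a 0).[x] = 1.
Proof. by rewrite /azpoch big_geq // hornerE. Qed.

(* The last summand is the boundary term of the truncation; it vanishes for the
   polynomials and for the seeds. *)
Lemma aw_sum_rec n N : q != 0 -> a != 0 -> N != 0 ->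
  (forall j, (j < n)%N -> [/\ 1 - a * b * q ^+ j != 0, 1 - a * c * q ^+ j != 0,
     1 - a * d * q ^+ j != 0 & 1 - q * q ^+ j != 0]) ->
  2 * x * recD N * aw_sum n.+1 N =
    recA N * aw_sum n.+1 (q * N)
    + ((a + a^-1) * recD N - recA N - recC N) * aw_sum n.+1 N
    + recC N * aw_sum n.+1 (N / q)
    - recD N / a * (azpoch q a n.+1).[x]
      * (qpoch q N^-1 n * qpoch q (e * N / q) n)
      / (qpoch q (a * b) n * qpoch q (a * c) n * qpoch q (a * d) n * qpoch q q n).
Proof.
move=> q0 a0 N0; elim: n => [_|n IH H].
  rewrite /aw_sum !big_nat1 /aw_term azpochS azpoch0 !qpoch0 /recD /recA /recC.
  by rewrite expr0; field; rewrite ?q0 ?a0.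
have /IH{}IH : forall j, (j < n)%N -> [/\ 1 - a * b * q ^+ j != 0, 1 - a * c * q ^+ j != 0,
     1 - a * d * q ^+ j != 0 & 1 - q * q ^+ j != 0] by move=> j jn; apply: H; rewrite ltnS ltnW.
rewrite /aw_sum; rewrite !(big_nat_recr n.+1) //= -!/(aw_sum _ _).
(* The identity for the shorter cut eliminates the sum at q N; what remains compares the three new
   terms with the two boundary terms. *)
have {IH}E : recA N * aw_sum n.+1 (q * N) = 2 * x * recD N * aw_sum n.+1 N
    - ((a + a^-1) * recD N - recA N - recC N) * aw_sum n.+1 N
    - recC N * aw_sum n.+1 (N / q)
    + recD N / a * (azpoch q a n.+1).[x]
      * (qpoch q N^-1 n * qpoch q (e * N / q) n)
      / (qpoch q (a * b) n * qpoch q (a * c) n * qpoch q (a * d) n * qpoch q q n).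
  by rewrite IH; ring.
rewrite [recA N * (_ + _)]mulrDr E {E}.
have [h1 h2 h3 h4] := H n (ltnSn n).
have P0 u : (forall i, (i < n)%N -> 1 - u * q ^+ i != 0) -> qpoch q u n != 0 by exact: qpoch_neq0.
have p1 : qpoch q (a * b) n != 0 by apply: P0 => i i_n; have [] := H i (ltnW i_n).
have p2 : qpoch q (a * c) n != 0 by apply: P0 => i i_n; have [] := H i (ltnW i_n).
have p3 : qpoch q (a * d) n != 0 by apply: P0 => i i_n; have [] := H i (ltnW i_n).
have p4 : qpoch q q n != 0 by apply: P0 => i i_n; have [] := H i (ltnW i_n).
set SN := aw_sum n.+1 N; set SM := aw_sum n.+1 (N / q).
rewrite (azpochS n.+1); set F := (azpoch q a n.+1).[x].
(* The factor [1 - e * N / q] of [recA], and below the factor [1 - N] of [recC], are absorbed in the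
   q-factorials. This brings the terms at q N and N / q to those at N without dividing by a
   q-factorial in N. *)
have tq : recA N * aw_term (q * N) n.+1 =
  (1 - a * b * N) * (1 - a * c * N) * (1 - a * d * N)
  * (1 - e * N ^+ 2 / q ^+ 2) / a * (1 - (q * N)^-1)
  * (qpoch q N^-1 n * qpoch q (e * N / q) n) * (1 - e * N * q ^+ n / q)
  * (1 - e * N * q ^+ n)
  / (qpoch q (a * b) n.+1 * qpoch q (a * c) n.+1 * qpoch q (a * d) n.+1 * qpoch q q n.+1)
  * q ^+ n.+1 * F.
  rewrite /aw_term /recA -/F.
  have -> : qpoch q (q * N)^-1 n.+1 = (1 - (q * N)^-1) * qpoch q N^-1 n.
    by rewrite qpochSl invfM mulrAC mulVf ?mul1r.
  have -> : e * (q * N) / q = e * N by field.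
  have -> : (1 - a * b * N) * (1 - a * c * N) * (1 - a * d * N) * (1 - e * N / q)
  * (1 - e * N ^+ 2 / q ^+ 2) / a = (1 - a * b * N) * (1 - a * c * N) * (1 - a * d * N)
  * (1 - e * N ^+ 2 / q ^+ 2) / a * (1 - e * N / q) by rewrite -[LHS]mulrA [_ * a^-1]mulrC; ring.
  have E : (1 - e * N / q) * qpoch q (e * N) n.+1 = qpoch q (e * N / q) n * (1 - e * N * q ^+ n / q)
  * (1 - e * N * q ^+ n).
    have -> : qpoch q (e * N) n.+1 = qpoch q (e * N / q * q) n.+1 by rewrite divfK.
    rewrite -qpochSl !qpochS exprS; congr (_ * (1 - _) * (1 - _)); by field.
  transitivity ((1 - a * b * N) * (1 - a * c * N) * (1 - a * d * N)
  * (1 - e * N ^+ 2 / q ^+ 2) / a * (1 - (q * N)^-1) * qpoch q N^-1 n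
  * ((1 - e * N / q) * qpoch q (e * N) n.+1) / (qpoch q (a * b) n.+1 * qpoch q (a * c) n.+1 * qpoch q (a * d) n.+1 * qpoch q q n.+1)
  * q ^+ n.+1 * F); last by rewrite E; ring.
  ring.
have tp : recC N * aw_term (N / q) n.+1 =
  - a * N * (1 - b * c * N / q) * (1 - b * d * N / q) * (1 - c * d * N / q)
  * (1 - e * N ^+ 2)
  * (1 - e * N / q ^+ 2)
  * (qpoch q N^-1 n * qpoch q (e * N / q) n) * (1 - N^-1 * q ^+ n)
  * (1 - N^-1 * q ^+ n.+1)
  / (qpoch q (a * b) n.+1 * qpoch q (a * c) n.+1 * qpoch q (a * d) n.+1 * qpoch q q n.+1)
  * q ^+ n.+1 * F.
  rewrite /aw_term /recC -/F.
  have -> : qpoch q (e * (N / q) / q) n.+1 = (1 - e * N / q ^+ 2) * qpoch q (e * N / q) n.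
    by rewrite qpochSl; congr ((1 - _) * qpoch _ _ _); field.
  have E : (1 - N) * qpoch q (N / q)^-1 n.+1 = - N * (qpoch q N^-1 n * (1 - N^-1 * q ^+ n)
  * (1 - N^-1 * q ^+ n.+1)).
    have -> : (N / q)^-1 = N^-1 * q by rewrite invf_div mulrC.
    rewrite -!qpochS (qpochSl _ N^-1) mulrA; congr (_ * _); by field.
  transitivity (a * (1 - b * c * N / q) * (1 - b * d * N / q) * (1 - c * d * N / q)
  * (1 - e * N ^+ 2) * ((1 - N) * qpoch q (N / q)^-1 n.+1) * (1 - e * N / q ^+ 2) * qpoch q (e * N / q) n
  / (qpoch q (a * b) n.+1 * qpoch q (a * c) n.+1 * qpoch q (a * d) n.+1 * qpoch q q n.+1)
  * q ^+ n.+1 * F); last by rewrite E; ring.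
  ring.
rewrite tq [recC N * (_ + _)]mulrDr tp {tq tp}.
rewrite /aw_term -/F !qpochS !exprS /recD /recA /recC.
move: (q ^+ n) h1 h2 h3 h4 => Q h1 h2 h3 h4.
move: (qpoch q (a * b) n) (qpoch q (a * c) n) (qpoch q (a * d) n) (qpoch q q n)
  p1 p2 p3 p4 => A1 A2 A3 A4 p1 p2 p3 p4.
move: (qpoch q N^-1 n) (qpoch q (e * N / q) n) => X Y.
have {}h4 : 1 - q * Q != 0 by [].
field.
by rewrite h1 h2 h3 h4 q0 a0 N0 p1 p2 p3 p4.
Qed.

End Recurrence.

(** * Limits and infinite products *)

Section CplxLim.
Variable R : realType.
Local Notation C := (cplx R).

Lemma normcE' (z : C) : `|z| = (normc z)%:C.
Proof. by case: z => u v; rewrite normc_def /normc. Qed.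

Lemma normc_nneg (z : C) : 0 <= normc z.
Proof. by case: z => u v; exact: sqrtr_ge0. Qed.

Lemma normc_le_sum (x y : R) : normc (x +i* y) <= `|x| + `|y|.
Proof.
rewrite -[leRHS]ger0_norm ?addr_ge0 // -sqrtr_sqr ler_wsqrtr //.
rewrite sqrrD !real_normK ?num_real //.
by rewrite addrAC lerDl mulrn_wge0 // mulr_ge0.
Qed.

Lemma normRe_le (z : C) : `|complex.Re z| <= normc z.
Proof. by have := normc_ge_Re z; rewrite normcE' lecR. Qed.

Lemma normIm_le (z : C) : `|complex.Im z| <= normc z.
Proof.
case: z => x y /=; rewrite -[leLHS]ger0_norm // -sqrtr_sqr ler_wsqrtr //.
by rewrite real_normK ?num_real // lerDr sqr_ge0.
Qed.

Lemma cvg_cplx T (F : set_system T) {FF : Filter F} (f : T -> C) (l : C) :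
  complex.Re (f x) @[x --> F] --> complex.Re l ->
  complex.Im (f x) @[x --> F] --> complex.Im l -> f x @[x --> F] --> l.
Proof.
move=> fr fi; apply/cvgrPdist_le => e e0.
have [er e0r er0] : exists2 r : R, e = r%:C & 0 < r.
  by move: e0; case: e => r i; rewrite ltcE /= => /andP[/eqP-> ?]; exists r.
rewrite e0r; have e2 : 0 < er / 2 by rewrite divr_gt0.
move/cvgrPdist_le : fr => /(_ _ e2) fr; move/cvgrPdist_le : fi => /(_ _ e2) fi.
near=> x; rewrite normcE' lecR.
have h1 : `|complex.Re l - complex.Re (f x)| <= er / 2 by near: x.
have h2 : `|complex.Im l - complex.Im (f x)| <= er / 2 by near: x.
move: h1 h2; case: (l) (f x) => [a b] [c d] /= h1 h2.
have /le_trans := normc_le_sum (a - c) (b - d).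
by apply; rewrite [leRHS]splitr lerD.
Unshelve. all: by end_near. Qed.

Lemma cvg_Im T (F : set_system T) {FF : Filter F} (f : T -> C) (l : C) :
  f x @[x --> F] --> l -> complex.Im (f x) @[x --> F] --> complex.Im l.
Proof.
move=> /cvgrPdist_le fl; apply/cvgrPdist_le => e e0.
have e1 : 0 < e%:C :> C by rewrite ltcR.
apply: filterS (fl _ e1) => x; rewrite normcE' lecR.
by case: l (f x) {fl} => [a b] [c d]; have /le_trans := normIm_le ((a - c) +i* (b - d)); exact.
Qed.

Lemma cvg_real_complex T (F : set_system T) {FF : Filter F} (f : T -> R) (l : R) :
  f x @[x --> F] --> l -> (f x)%:C @[x --> F] --> (l%:C : C).
Proof. by move=> fl; apply: cvg_cplx => //=; exact: cvg_cst. Qed.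

End CplxLim.

Section InfiniteProduct.
Variables (R : realType) (q : R).
Hypotheses (q_gt0 : 0 < q) (q_lt1 : q < 1).
Local Notation C := (cplx R).

Let omq : 0 < 1 - q. Proof. by rewrite subr_gt0. Qed.

Lemma sum_geom_le (m n : nat) : \sum_(m <= i < n) q ^+ i <= q ^+ m / (1 - q).
Proof.
have [mn|/ltnW nm] := leqP m n; last first.
  by rewrite big_geq // divr_ge0 ?exprn_ge0 ?ltW.
rewrite ler_pdivlMr //.
have -> : (\sum_(m <= i < n) q ^+ i) * (1 - q) = q ^+ m - q ^+ n.
  elim: n mn => [|n IH]; first by rewrite leqn0 => /eqP->; rewrite big_geq // mul0r subrr.
  rewrite leq_eqVlt => /orP[/eqP<-|]; first by rewrite big_geq // mul0r subrr.
  by rewrite ltnS => mn; rewrite big_nat_recr //= mulrDl IH // exprSr; ring.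
by rewrite gerBl exprn_ge0 // ltW.
Qed.

Variable (M : R).
Hypothesis M_ge0 : 0 <= M.
Let B := expR (M / (1 - q)).

Section Complex.
Variable f : nat -> C.
Hypothesis fM : forall i, normc (f i - 1) <= M * q ^+ i.

(** |f_i| <= 1 + M q^i <= exp (M q^i), and the exponents sum to at most M / (1 - q). *)
Lemma normc_prod_le n : normc (\prod_(0 <= i < n) f i) <= B.
Proof.
apply: (@le_trans _ _ (expR (\sum_(0 <= i < n) M * q ^+ i))); last first.
  rewrite ler_expR -mulr_sumr ler_wpM2l //.
  by have := sum_geom_le 0 n; rewrite expr0 mul1r.
elim: n => [|n IH]; first by rewrite !big_geq // normc1 expR0.
rewrite !big_nat_recr //= normcM expRD ler_pM ?normc_nneg //.
apply: le_trans (expR_ge1Dx _).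
have := le_normcD (f n - 1) 1; rewrite subrK normc1 => /le_trans; apply.
by rewrite addrC lerD2l.
Qed.

(** Telescoping: passing from i to i + 1 changes the product by at most B M q^i. *)
Lemma normc_prodB m n : (m <= n)%N ->
  normc (\prod_(0 <= i < n) f i - \prod_(0 <= i < m) f i)
  <= B * M / (1 - q) * q ^+ m.
Proof.
move=> mn; apply: (@le_trans _ _ (\sum_(m <= i < n) B * M * q ^+ i)); last first.
  rewrite -mulr_sumr -[leRHS]mulrA ler_wpM2l ?mulr_ge0 ?expR_ge0 //.
  by rewrite [_^-1 * _]mulrC sum_geom_le.
elim: n mn => [|n IH]; first by rewrite leqn0 => /eqP->; rewrite !big_geq // subrr normc0.
rewrite leq_eqVlt => /orP[/eqP<-|]; first by rewrite subrr normc0 big_geq.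
rewrite ltnS => mn; rewrite [leRHS]big_nat_recr //= (@big_nat_recr _ _ _ n) //=.
set P := \prod_(0 <= i < n) f i; set Q := \prod_(0 <= i < m) f i.
have -> : P * f n - Q = (P - Q) + P * (f n - 1) by ring.
apply: le_trans (le_normcD _ _) _; apply: lerD; first exact: IH.
by rewrite normcM -mulrA ler_pM ?normc_prod_le // normc_nneg.
Qed.

End Complex.

Lemma cvg_geom_step (u : R^nat) K :
  (forall m n, (m <= n)%N -> `|u n - u m| <= K * q ^+ m) -> cvgn u.
Proof.
move=> h; have gc : K * q ^+ n @[n --> \oo] --> 0.
  rewrite -[X in _ --> X](mulr0 K); apply: cvgMl_tmp.
  by apply: cvg_expr; rewrite ger0_norm // ltW.
apply/cauchy_cvgP/cauchyP => e e0.
move/cvgrPdist_lt : gc => /(_ _ e0)[m _ hm].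
exists (u m); exists m => // n /= mn; rewrite /ball /= distrC.
apply: le_lt_trans (h _ _ mn) _.
by have := hm m (leqnn m); rewrite sub0r normrN; apply: le_lt_trans; rewrite ler_norm.
Qed.

Lemma cvg_geom_step_dist (u : R^nat) K :
  (forall m n, (m <= n)%N -> `|u n - u m| <= K * q ^+ m) ->
  forall m, `|limn u - u m| <= K * q ^+ m.
Proof.
move=> h m; have cu := cvg_geom_step h.
have : `|u n - u m| @[n --> \oo] --> `|limn u - u m|.
  by apply: cvg_norm; apply: cvgB => //; exact: cvg_cst.
move/cvgr_to_le; apply; exists m => // n /= mn; exact: h.
Qed.

Lemma cvg_cprod (f : nat -> C) : (forall i, normc (f i - 1) <= M * q ^+ i) ->
  cvgn (fun n => \prod_(0 <= i < n) f i).
Proof.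
move=> fM; set P := (fun n => _); pose K := B * M / (1 - q).
have cr : cvgn (fun n => complex.Re (P n)).
  apply: (@cvg_geom_step _ K) => m n mn; apply: le_trans (normc_prodB fM mn).
  by rewrite -/(P n) -/(P m); case: (P n) (P m) => [u v] [w x]; exact: (normRe_le ((u - w) +i* (v - x))).
have ci : cvgn (fun n => complex.Im (P n)).
  apply: (@cvg_geom_step _ K) => m n mn; apply: le_trans (normc_prodB fM mn).
  by rewrite -/(P n) -/(P m); case: (P n) (P m) => [u v] [w x]; exact: (normIm_le ((u - w) +i* (v - x))).
apply/cvg_ex; exists ((limn (fun n => complex.Re (P n))) +i* (limn (fun n => complex.Im (P n)))).
by apply: cvg_cplx.
Qed.

Section Real.
Variable f : nat -> R.
Hypothesis fM : forall i, `|f i - 1| <= M * q ^+ i.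
Let P n := \prod_(0 <= i < n) f i.

Let fMC i : normc ((f i)%:C - 1 : C) <= M * q ^+ i.
Proof.
have -> : (f i)%:C - 1 = (f i - 1)%:C :> C by rewrite rmorphB rmorph1.
by rewrite /= expr0n /= addr0 sqrtr_sqr.
Qed.

Let normc_real (x : R) : normc (x%:C : C) = `|x|.
Proof. by rewrite /= expr0n addr0 sqrtr_sqr. Qed.

Lemma iprodB m n : (m <= n)%N -> `|P n - P m| <= B * M / (1 - q) * q ^+ m.
Proof.
move=> mn; have := normc_prodB fMC mn.
by rewrite -!rmorph_prod -rmorphB normc_real.
Qed.

Lemma iprod_cvg : cvgn P. Proof. exact: cvg_geom_step iprodB. Qed.

Lemma iprod_dist m : `|limn P - P m| <= B * M / (1 - q) * q ^+ m.
Proof. exact: cvg_geom_step_dist iprodB _. Qed.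

End Real.

End InfiniteProduct.

(** Beyond some m the tail product stays within 1/2 of 1, so the partial products are bounded below
    by half of the nonzero product up to m. *)
Lemma iprod_neq0 (R : realType) (q M : R) (f : nat -> R) :
  0 < q -> q < 1 -> 0 <= M -> (forall i, `|f i - 1| <= M * q ^+ i) ->
  (forall i, f i != 0) -> limn (fun n => \prod_(0 <= i < n) f i) != 0.
Proof.
move=> q0 q1 M0 fM f0; pose P n := \prod_(0 <= i < n) f i.
have oq : 0 < 1 - q by rewrite subr_gt0.
pose K := expR (M / (1 - q)) * M / (1 - q).
have gc : K * q ^+ n @[n --> \oo] --> 0.
  rewrite -[X in _ --> X](mulr0 K); apply: cvgMl_tmp.
  by apply: cvg_expr; rewrite ger0_norm // ltW.
have h2 : (0 : R) < 1 / 2 by rewrite divr_gt0.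
move/cvgrPdist_lt : gc => /(_ _ h2)[m _ /(_ m (leqnn m))].
rewrite sub0r normrN => hm.
have P0 : P m != 0 by rewrite /P prodf_seq_neq0; apply/allP => i _; rewrite f0.
have qm : 0 <= q ^+ m by rewrite exprn_ge0 // ltW.
have lb n : (m <= n)%N -> `|P m| / 2 <= `|P n|.
  move=> mn; have -> : P n = P m * \prod_(0 <= i < n - m) f (i + m)%N.
    rewrite /P (big_cat_nat _ mn) //=; congr (_ * _).
    by rewrite -{1}[m]add0n big_addn.
  rewrite normrM ler_wpM2l //.
  have gM i : `|f (i + m)%N - 1| <= (M * q ^+ m) * q ^+ i.
    by apply: le_trans (fM _) _; rewrite -mulrA -exprD addnC.
  have := iprodB q0 q1 (mulr_ge0 M0 qm) gM (leq0n (n - m)).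
  rewrite [X in _ - X]big_geq // expr0 mulr1.
  set g := \prod_(0 <= i < n - m) _ => gl.
  have {}gl : `|g - 1| <= 1 / 2.
    apply: le_trans gl _; apply: le_trans (ltW hm); apply: le_trans (ler_norm _).
    have -> : K * q ^+ m = expR (M / (1 - q)) * (M * q ^+ m) / (1 - q) by rewrite /K; ring.
    rewrite ler_wpM2r ?invr_ge0 ?(ltW oq) // ler_wpM2r ?mulr_ge0 //.
    rewrite ler_expR ler_wpM2r ?invr_ge0 ?(ltW oq) //.
    by rewrite ler_piMr // exprn_ile1 // ltW.
  have : 1 <= `|g| + `|g - 1|.
    by have := ler_normB g (g - 1); rewrite subKr normr1.
  by move: gl; lra.
have cP : cvgn P := iprod_cvg q0 q1 M0 fM.
rewrite -normr_gt0; apply: (@lt_le_trans _ _ (`|P m| / 2)).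
  by rewrite divr_gt0 // normr_gt0.
move/cvg_norm : cP => /cvgr_to_ge; apply; exists m => // n /= mn; exact: lb.
Qed.

(** The tail bound of [iprod_dist] has constants independent of x, so convergence is uniform for |x|
    < r. *)
Lemma iprod_continuous (R : realType) (q M r : R) (f : nat -> R -> R) :
  0 < q -> q < 1 -> 0 <= M ->
  (forall i x, `|x| < r -> `|f i x - 1| <= M * q ^+ i) ->
  (forall i, continuous (f i)) -> forall x, `|x| < r ->
  {for x, continuous (fun x => limn (fun n => \prod_(0 <= i < n) f i x))}.
Proof.
move=> q0 q1 M0 fM fc x xr.
have oq : 0 < 1 - q by rewrite subr_gt0.
pose K := expR (M / (1 - q)) * M / (1 - q).
have gc : K * q ^+ n @[n --> \oo] --> 0.
  rewrite -[X in _ --> X](mulr0 K); apply: cvgMl_tmp.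
  by apply: cvg_expr; rewrite ger0_norm // ltW.
apply/cvgrPdist_lt => e e0.
have e3 : 0 < e / 3 by rewrite divr_gt0.
move/cvgrPdist_lt : gc => /(_ _ e3)[m _ /(_ m (leqnn m))].
rewrite sub0r normrN => hm.
have hd y : `|y| < r -> `|limn (fun n => \prod_(0 <= i < n) f i y) - \prod_(0 <= i < m) f i y| < e / 3.
  move=> yr; apply: le_lt_trans (iprod_dist q0 q1 M0 (fun i => fM i y yr) m) _.
  by apply: le_lt_trans hm; exact: ler_norm.
have cm : {for x, continuous (fun x => \prod_(0 <= i < m) f i x)}.
  elim: m {hm hd} => [|m IH].
    rewrite (_ : (fun _ => _) = cst 1); first exact: cvg_cst.
    by apply/funext => y; rewrite big_geq.
  rewrite (_ : (fun _ => _) = (fun x => \prod_(0 <= i < m) f i x) \* f m); last first.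
    by apply/funext => y; rewrite big_nat_recr.
  by apply: continuousM => //; exact: fc.
move/cvgrPdist_lt : cm => /(_ _ e3) cm.
near=> y.
have yr : `|y| < r.
  near: y; apply: (cvgr_lt `|x|) => //; exact: (cvg_norm (cvg_id)).
have c1 : `|\prod_(0 <= i < m) f i x - \prod_(0 <= i < m) f i y| < e / 3 by near: y.
have := hd _ yr; have := hd _ xr; move: c1.
set a := \prod_(0 <= i < m) f i x; set b := \prod_(0 <= i < m) f i y.
set A := limn _; set B := limn _ => h1 h2 h3.
have -> : A - B = (A - a) + (a - b) - (B - b) by ring.
apply: le_lt_trans (ler_normB _ _) _; apply: le_lt_trans (lerD (ler_normD _ _) (lexx _)) _.
by move: h1 h2 h3; set u := `|_|; set v := `|_|; set w := `|_|; lra.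
Unshelve. all: by end_near. Qed.

Section QInf.
Variables (R : realType) (q : R).
Hypotheses (q_gt0 : 0 < q) (q_lt1 : q < 1).
Local Notation C := (cplx R).
Local Notation Q := (q%:C : C).

Let qfM (u : R) i : `|1 - u * q ^+ i - 1| <= `|u| * q ^+ i.
Proof. by rewrite addrAC subrr add0r normrN normrM (ger0_norm (exprn_ge0 _ (ltW q_gt0))). Qed.

Lemma qpinf_cvg (u : R) : qpoch q u n @[n --> \oo] --> qpinf q u.
Proof. exact: (iprod_cvg q_gt0 q_lt1 (normr_ge0 u) (qfM u)). Qed.

Lemma qpinfSl (u : R) : qpinf q u = (1 - u) * qpinf q (u * q).
Proof.
apply/cvg_lim => //; rewrite -(cvg_shiftS).
rewrite /= (_ : (fun _ => _) = (fun n => (1 - u) * qpoch q (u * q) n)); last first.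
  by apply/funext => n /=; rewrite qpochSl.
apply: cvgMl_tmp; exact: qpinf_cvg.
Qed.

Lemma qpinf_neq0 (u : R) : (forall i, 1 - u * q ^+ i != 0) -> qpinf q u != 0.
Proof. exact: (iprod_neq0 q_gt0 q_lt1 (normr_ge0 u) (qfM u)). Qed.

Lemma qpinf_continuous : continuous (qpinf q : R -> R).
Proof.
move=> u; apply: (@iprod_continuous R q (`|u| + 1) (`|u| + 1) (fun i u => 1 - u * q ^+ i)) => //.
- move=> i x xr; apply: le_trans (qfM _ _) _; rewrite ler_wpM2r ?exprn_ge0 ?(ltW q_gt0) //.
  exact: ltW.
- move=> i x; apply: cvgB; first exact: cvg_cst.
  by apply: cvgMr_tmp; exact: cvg_id.
- by rewrite ltrDl.
Qed.

Let cqfM (u : C) i : normc (1 - u * Q ^+ i - 1) <= normc u * q ^+ i.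
Proof.
have -> : 1 - u * Q ^+ i - 1 = - (u * Q ^+ i) by ring.
rewrite normcN normcM -rmorphXn /= expr0n /= addr0 sqrtr_sqr.
by rewrite (ger0_norm (exprn_ge0 _ (ltW q_gt0))).
Qed.

Lemma cqpinf_cvg (u : C) : qpoch Q u n @[n --> \oo] --> qpinf Q u.
Proof. exact: (cvg_cprod q_gt0 q_lt1 (normc_nneg u) (cqfM u)). Qed.

Lemma cqpinfSl (u : C) : qpinf Q u = (1 - u) * qpinf Q (u * Q).
Proof.
apply/cvg_lim => //; rewrite -(cvg_shiftS).
rewrite /= (_ : (fun _ => _) = (fun n => (1 - u) * qpoch Q (u * Q) n)); last first.
  by apply/funext => n /=; rewrite qpochSl.
apply: cvgMl_tmp; exact: cqpinf_cvg.
Qed.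

(** (e z, e / z; q)_oo in the variable x = (z + 1 / z) / 2: real products in which the whole density
    can be expressed. *)
Definition azinf (e x : R) : R := limn (fun n => (azpoch q e n).[x]).

Lemma azpoch_prod e x n :
  (azpoch q e n).[x] = \prod_(0 <= i < n) (1 + (e * q ^+ i) ^+ 2 - 2 * (e * q ^+ i) * x).
Proof.
by elim: n => [|n IH]; [rewrite azpoch0 big_geq | rewrite azpochS big_nat_recr //= IH].
Qed.

Let azM (e x r : R) i : `|e| <= 1 -> `|x| <= r ->
  `|1 + (e * q ^+ i) ^+ 2 - 2 * (e * q ^+ i) * x - 1| <= (1 + 2 * r) * q ^+ i.
Proof.
move=> e1 xr.
have -> : 1 + (e * q ^+ i) ^+ 2 - 2 * (e * q ^+ i) * x - 1
  = (e * (e * q ^+ i) - 2 * e * x) * q ^+ i by ring.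
rewrite normrM [X in _ * X]ger0_norm ?exprn_ge0 ?(ltW q_gt0) //.
rewrite ler_wpM2r ?exprn_ge0 ?(ltW q_gt0) //.
apply: le_trans (ler_normB _ _) _; apply: lerD.
  rewrite !normrM mulr_ile1 ?mulr_ge0 // mulr_ile1 //.
  by rewrite ger0_norm ?exprn_ge0 ?(ltW q_gt0) // exprn_ile1 // ltW.
rewrite !normrM normr_nat -mulrA ler_wpM2l //.
by rewrite -[leRHS]mul1r ler_pM.
Qed.

Let azM0 (r x : R) : `|x| <= r -> 0 <= 1 + 2 * r.
Proof. by move=> /(le_trans (normr_ge0 _)) r0; rewrite addr_ge0 // mulr_ge0. Qed.

Lemma azinf_cvg e x : `|e| <= 1 -> (azpoch q e n).[x] @[n --> \oo] --> azinf e x.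
Proof.
move=> e1; have := iprod_cvg q_gt0 q_lt1 (azM0 (lexx `|x|)) (fun i => azM i e1 (lexx `|x|)).
rewrite /azinf; under [X in _ -> X @ _ --> _]eq_fun do rewrite azpoch_prod.
by under [X in _ -> _ --> lim (X @ _)]eq_fun do rewrite azpoch_prod.
Qed.

Lemma azinf_continuous e : `|e| <= 1 -> continuous (azinf e).
Proof.
move=> e1 x; rewrite /azinf.
under eq_fun do under eq_fun do rewrite azpoch_prod.
apply: (@iprod_continuous R q (1 + 2 * (`|x| + 1)) (`|x| + 1)
  (fun i x => 1 + (e * q ^+ i) ^+ 2 - 2 * (e * q ^+ i) * x)) => //.
- by move=> i y yr; apply: azM => //; exact: ltW.
- move=> i y; apply: cvgB; first exact: cvg_cst.
  by apply: cvgMl_tmp; exact: cvg_id.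
- by rewrite ltrDl.
Qed.

(** With v = e q^i each factor is at least (1 - |v|)^2. The limit is thus nonnegative, and it is
    nonzero by [iprod_neq0]. *)
Lemma azinf_gt0 e x : `|e| < 1 -> `|x| <= 1 -> 0 < azinf e x.
Proof.
move=> e1 x1.
have P i : 0 < 1 + (e * q ^+ i) ^+ 2 - 2 * (e * q ^+ i) * x.
  set v := e * q ^+ i.
  have v1 : `|v| < 1.
    rewrite normrM (le_lt_trans _ e1) // ler_piMr // ger0_norm ?exprn_ge0 ?(ltW q_gt0) //.
    by rewrite exprn_ile1 // ltW.
  have h : v * x <= `|v|.
    by apply: le_trans (ler_norm _) _; rewrite normrM ler_piMr.
  have : 0 < (1 - `|v|) ^+ 2 by rewrite exprn_gt0 // subr_gt0.
  have : v ^+ 2 = `|v| ^+ 2 by rewrite real_normK // num_real.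
  rewrite -mulrA; nra.
rewrite lt_neqAle eq_sym; apply/andP; split.
  rewrite /azinf; under eq_fun do rewrite azpoch_prod.
  apply: (iprod_neq0 q_gt0 q_lt1 (azM0 x1) (fun i => azM i (ltW e1) x1)) => i.
  by rewrite gt_eqF.
apply: (cvgr_to_ge (azinf_cvg (x := x) (ltW e1))); apply: nearW => n.
by rewrite azpoch_prod prodr_ge0 // => i _; exact: ltW.
Qed.

Definition circ (x : R) : C := x +i* Num.sqrt (1 - x ^+ 2).

Lemma circMV x : `|x| <= 1 -> circ x * (circ x)^*%C = 1.
Proof.
move=> x1; have h : 0 <= 1 - x ^+ 2.
  by rewrite subr_ge0 -real_normK ?num_real // exprn_ile1.
rewrite /circ; apply/eqP; rewrite eq_complex /=; apply/andP; split; apply/eqP.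
  by rewrite mulrN opprK -[X in _ + X]expr2 sqr_sqrtr //; ring.
by ring.
Qed.

Lemma circ_neq0 x : `|x| <= 1 -> circ x != 0.
Proof.
move=> /circMV h; apply/eqP => z0; move: h; rewrite z0 mul0r => /eqP.
by rewrite eq_sym oner_eq0.
Qed.

Lemma circV x : `|x| <= 1 -> (circ x)^-1 = (circ x)^*%C.
Proof. by move=> x1; apply: (mulfI (circ_neq0 x1)); rewrite circMV // mulfV ?circ_neq0. Qed.

Lemma circDV x : `|x| <= 1 -> circ x + (circ x)^-1 = (2 * x)%:C.
Proof.
move=> x1; rewrite circV // /circ; apply/eqP; rewrite eq_complex /=.
by apply/andP; split; apply/eqP; ring.
Qed.

Lemma normc_circ x : `|x| <= 1 -> normc (circ x) = 1.
Proof.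
move=> x1; have h : 0 <= 1 - x ^+ 2.
  by rewrite subr_ge0 -real_normK ?num_real // exprn_ile1.
by rewrite /circ /= sqr_sqrtr // addrC subrK sqrtr1.
Qed.

Lemma cqpinf_pair (e x : R) (w : C) : `|e| <= 1 -> w != 0 -> w + w^-1 = (2 * x)%:C ->
  qpinf Q (e%:C * w) * qpinf Q (e%:C / w) = (azinf e x)%:C.
Proof.
move=> e1 w0 wx; apply: (@cvg_unique _ _ (qpoch Q (e%:C * w) n * qpoch Q (e%:C / w) n @[n --> \oo])).
- exact: norm_hausdorff.
- apply: cvgM; exact: cqpinf_cvg.
- rewrite (_ : (fun _ => _) = (fun n => ((azpoch q e n).[x])%:C)).
    by apply: cvg_real_complex; exact: azinf_cvg.
  apply/funext => n; rewrite azpoch_prod /qpoch -big_split rmorph_prod /=.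
  apply: eq_bigr => i _.
  have -> : (1 + (e * q ^+ i) ^+ 2 - 2 * (e * q ^+ i) * x)%:C
    = 1 + (e%:C * Q ^+ i) ^+ 2 - (e%:C * Q ^+ i) * (w + w^-1) :> C.
    by rewrite wx !(rmorphB, rmorphD, rmorphM, rmorphXn, rmorph1) /=; ring.
  by field.
Qed.

End QInf.

(** * Orthogonality of the Askey-Wilson polynomials *)

Section CircleIntegral.
Variable R : realType.
Local Notation C := (cplx R).
Local Notation mu := (@lebesgue_measure R).
Local Notation I := ([set` `[(-1)%R, 1%R]]).

(** With x = cos t these are cos (r t) and sin (r t), that is T_r(x) and sqrt (1 - x^2) U_(r-1)(x).
    Integrals stay in dx, so that of [sinn r] is the integral of sin (r t) sin t in t. *)
Definition cosn (r : nat) (x : R) : R := complex.Re (circ x ^+ r : C).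
Definition sinn (r : nat) (x : R) : R := complex.Im (circ x ^+ r : C).

Lemma cosnS r x : cosn r.+1 x = x * cosn r x - Num.sqrt (1 - x ^+ 2) * sinn r x.
Proof. by rewrite /cosn /sinn exprS; case: (circ x ^+ r). Qed.

Lemma sinnS r x : sinn r.+1 x = x * sinn r x + Num.sqrt (1 - x ^+ 2) * cosn r x.
Proof. by rewrite /cosn /sinn exprS; case: (circ x ^+ r). Qed.

Lemma continuous_circ_im : continuous (fun x : R => Num.sqrt (1 - x ^+ 2)).
Proof.
move=> x; apply: (continuous_comp (f := fun x : R => 1 - x ^+ 2)); last exact: sqrt_continuous.
by apply: cvgB; [exact: cvg_cst|exact: exprn_continuous].
Qed.

Lemma continuous_csn r : continuous (cosn r) /\ continuous (sinn r).
Proof.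
elim: r => [|r [IHc IHs]].
  split; [rewrite (_ : cosn 0 = cst 1)|rewrite (_ : sinn 0 = cst 0)] => //;
    by move=> x; exact: cvg_cst.
split=> x.
  rewrite (_ : cosn r.+1 = (fun x => x * cosn r x - Num.sqrt (1 - x ^+ 2) * sinn r x)).
    2: by apply/funext => ?; exact: cosnS.
  apply: cvgB; apply: cvgM; [exact: cvg_id|exact: IHc|exact: continuous_circ_im|exact: IHs].
rewrite (_ : sinn r.+1 = (fun x => x * sinn r x + Num.sqrt (1 - x ^+ 2) * cosn r x)).
  2: by apply/funext => ?; exact: sinnS.
apply: cvgD; apply: cvgM; [exact: cvg_id|exact: IHs|exact: continuous_circ_im|exact: IHc].
Qed.

Local Notation yy := (Num.sqrt \o (cst 1 - id ^+ 2) : R -> R).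

Lemma omxx_gt0 (x : R) : -1 < x < 1 -> 0 < 1 - x ^+ 2.
Proof. by move=> /andP[? ?]; nra. Qed.

Lemma is_derive_circ_im (x : R) : -1 < x < 1 -> is_derive x 1 yy (- x / yy x).
Proof.
move=> x1; have h := omxx_gt0 x1.
have D1 : is_derive x 1 (cst 1 - id ^+ 2 : R -> R) (- (2 * x)).
  apply: is_derive_eq; rewrite sub0r /= expr1 scaler1.
  by [].
have D2 := is_derive1_sqrt h.
apply: (is_derive_eq (@is_derive1_comp R Num.sqrt (cst 1 - id ^+ 2) x _ _ D2 D1)).
have : Num.sqrt (1 - x ^+ 2) != 0 by rewrite sqrtr_eq0 -ltNge.
by move=> s0 /=; field.
Qed.

Lemma is_derive_csn r (x : R) : -1 < x < 1 ->
  is_derive x 1 (cosn r) (r%:R * sinn r x / yy x)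
  /\ is_derive x 1 (sinn r) (- (r%:R * cosn r x) / yy x).
Proof.
move=> x1; have h := omxx_gt0 x1.
have s0 : Num.sqrt (1 - x ^+ 2) != 0 by rewrite sqrtr_eq0 -ltNge.
have D := is_derive_circ_im x1.
elim: r => [|r [IHc IHs]].
  rewrite (_ : cosn 0 = cst 1) // (_ : sinn 0 = cst 0) // !mul0r !oppr0 ?mul0r.
  by split; exact: is_derive_cst.
split.
  rewrite (_ : cosn r.+1 = id * cosn r - yy * sinn r); last first.
    by apply/funext => ?; exact: cosnS.
  apply: is_derive_eq; rewrite sinnS /=.
  rewrite -![_ *: _]/(_ * _) /= -natr1.
  by move: (Num.sqrt _) s0 => y y0; field.
rewrite (_ : sinn r.+1 = id * sinn r + yy * cosn r); last first.
  by apply/funext => ?; exact: sinnS.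
apply: is_derive_eq; rewrite cosnS /=.
rewrite -![_ *: _]/(_ * _) /= -natr1.
by move: (Num.sqrt _) s0 => y y0; field.
Qed.

Lemma sinn_pm1 r (x : R) : 1 - x ^+ 2 = 0 -> sinn r x = 0.
Proof.
move=> h; elim: r => [//|r IH].
by rewrite sinnS IH h sqrtr0 mulr0 mul0r addr0.
Qed.

Lemma integral_sinn r : (2 <= r)%N -> (\int[mu]_(x in I) sinn r x = 0)%R.
Proof.
case: r => [//|r] r1; have {r1} r0 : (0 < r)%N by [].
(* From 2 sin t sin ((r + 1) t) = cos (r t) - cos ((r + 2) t) and d sin (s t) / dx = - s cos (s t) /
   sin t. This antiderivative vanishes at both end points. *)
pose F : R -> R := (2^-1 / (r.+2)%:R) \*: sinn r.+2 - (2^-1 / r%:R) \*: sinn r.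
have cF : continuous F.
  by move=> x; apply: cvgB; apply: cvgZl_tmp; exact: (continuous_csn _).2.
have dF (x : R) : -1 < x < 1 -> is_derive x 1 F (sinn r.+1 x).
  move=> x1; have h := omxx_gt0 x1.
  have s0 : Num.sqrt (1 - x ^+ 2) != 0 by rewrite sqrtr_eq0 -ltNge.
  have [_ D1] := is_derive_csn r.+2 x1.
  have [_ D2] := is_derive_csn r x1.
  apply: is_derive_eq.
  rewrite -![_ *: _]/(_ * _) /=.
  have E : Num.sqrt (1 - x ^+ 2) ^+ 2 = 1 - x ^+ 2 by rewrite sqr_sqrtr // ltW.
  have H : cosn r x - cosn r.+2 x = 2 * Num.sqrt (1 - x ^+ 2) * sinn r.+1 x.
    rewrite cosnS !cosnS !sinnS.
    move: (Num.sqrt _) s0 E => y y0 /= E.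
    by have := congr1 (fun t => t * cosn r x) E; lra.
  have -> : sinn r.+1 x = (cosn r x - cosn r.+2 x) / (2 * Num.sqrt (1 - x ^+ 2)).
    by rewrite H mulrAC mulfV ?mul1r // mulf_neq0.
  move: (Num.sqrt _) s0 => y y0.
  have r2 : (r.+2)%:R != 0 :> R by rewrite pnatr_eq0.
  have r3 : r%:R != 0 :> R by rewrite pnatr_eq0 -lt0n.
  by move: (r.+2%:R) (r%:R) r2 r3 => A B A0 B0; field; rewrite A0 B0 y0.
have := @continuous_FTC2 R (sinn r.+1) F (-1) 1.
rewrite /Rintegral => ->.
- have FE x : F x = 2^-1 / (r.+2)%:R * sinn r.+2 x - 2^-1 / r%:R * sinn r x by [].
  by rewrite -EFinB !FE !sinn_pm1 ?mulr0 ?subr0 ?subrr // ?expr1n ?sqrrN ?expr1n subrr.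
- lra.
- by apply: continuous_subspaceT; exact: (continuous_csn _).2.
- split.
  + by move=> x; rewrite in_itv /= => /dF [].
  + by apply: cvg_at_right_filter; exact: cF.
  + by apply: cvg_at_left_filter; exact: cF.
- move=> x; rewrite in_itv /= => /dF h.
  by rewrite derive1E derive_val.
Qed.

End CircleIntegral.

Section Integration.
Variable R : realType.
Local Notation mu := (@lebesgue_measure R).
Local Notation I := ([set` `[(-1)%R, 1%R]] : set R).

Lemma integrable_I (f : R -> R) : {within I, continuous f} -> mu.-integrable I (EFin \o f).
Proof. by move=> cf; apply: continuous_compact_integrable => //; exact: segment_compact. Qed.

Lemma withinD (f g : R -> R) : {within I, continuous f} -> {within I, continuous g} ->
  {within I, continuous (fun x => f x + g x)}.
Proof. by move=> cf cg x; apply: cvgD; [exact: cf|exact: cg]. Qed.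

Lemma withinM (f g : R -> R) : {within I, continuous f} -> {within I, continuous g} ->
  {within I, continuous (fun x => f x * g x)}.
Proof. by move=> cf cg x; apply: cvgM; [exact: cf|exact: cg]. Qed.

Lemma within_cst (k : R) : {within I, continuous (fun=> k)}.
Proof. by move=> x; exact: cvg_cst. Qed.

Lemma intI_lin (h : R) (f g : R -> R) :
  {within I, continuous f} -> {within I, continuous g} ->
  (\int[mu]_(x in I) (h * f x + g x) = h * \int[mu]_(x in I) f x + \int[mu]_(x in I) g x)%R.
Proof.
move=> cf cg; rewrite RintegralD //; last 2 first.
- by apply: integrable_I; apply: withinM => //; exact: within_cst.
- exact: integrable_I.
by rewrite RintegralZl //; exact: integrable_I.
Qed.

Lemma within_sum n (f : nat -> R -> R) : (forall i, {within I, continuous (f i)}) ->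
  {within I, continuous (fun x => \sum_(0 <= i < n) f i x)}.
Proof.
move=> cf; elim: n => [|n IH].
  by rewrite (_ : (fun _ => _) = cst 0); [exact: within_cst|apply/funext=> x; rewrite big_geq].
rewrite (_ : (fun _ => _) = (fun x => \sum_(0 <= i < n) f i x + f n x)).
  by apply: withinD.
by apply/funext => x; rewrite big_nat_recr.
Qed.

Lemma intI_sum n (k : nat -> R) (f : nat -> R -> R) : (forall i, {within I, continuous (f i)}) ->
  (\int[mu]_(x in I) (\sum_(0 <= i < n) k i * f i x) =
  \sum_(0 <= i < n) k i * \int[mu]_(x in I) f i x)%R.
Proof.
move=> cf; elim: n => [|n IH].
  rewrite big_geq // (_ : (fun _ => _) = cst 0) ?Rintegral_cst ?mul0r //.
  by apply/funext=> x; rewrite big_geq.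
rewrite big_nat_recr //= -IH addrC -intI_lin //.
  by congr Rintegral; apply/funext => x; rewrite big_nat_recr //= addrC.
by apply: within_sum => i; apply: withinM => //; exact: within_cst.
Qed.

End Integration.

(** * An antisymmetric quadratic form on the unit circle *)

Section FiniteIdentity.
Variables (R : realType) (q : R).
Local Notation C := (cplx R).
Local Notation mu := (@lebesgue_measure R).
Local Notation I := ([set` `[(-1)%R, 1%R]] : set R).

(** This is sin ((m - n) t) at z = exp (i t). *)
Definition mono (m n : nat) (x : R) : R := complex.Im (circ x ^+ m * (circ x)^*%C ^+ n : C).

Lemma monoE m n x : mono m n x = sinn m x * cosn n x - cosn m x * sinn n x.
Proof.
rewrite /mono /sinn /cosn -rmorphXn /=.
by case: (circ x ^+ m) (circ x ^+ n) => [u v] [w t] /=; ring.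
Qed.

Lemma continuous_mono m n : continuous (mono m n).
Proof.
rewrite (_ : mono m n = (fun x => sinn m x * cosn n x - cosn m x * sinn n x)).
  move=> x; have [cm sm] := continuous_csn R m; have [cn sn] := continuous_csn R n.
  by apply: cvgB; apply: cvgM; [exact: sm|exact: cn|exact: cm|exact: sn].
by apply/funext => x; exact: monoE.
Qed.

Lemma int_mono m n : (\int[mu]_(x in I) mono m n x =
  \int[mu]_(x in I) sinn 1 x * ((m == n.+1)%:R - (n == m.+1)%:R))%R.
Proof.
have S r : (\int[mu]_(x in I) sinn r x = \int[mu]_(x in I) sinn 1 x * (r == 1)%:R)%R.
  case: r => [|[|r]]; last by rewrite mulr0 integral_sinn.
    by rewrite mulr0 (_ : sinn 0 = cst 0) // Rintegral_cst // mul0r.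
  by rewrite mulr1.
have E x : x \in I -> `|x| <= 1.
  by rewrite inE /= in_itv /= => /andP[? ?]; rewrite ler_norml; apply/andP.
have [nm|mn] := leqP n m.
  have -> : (\int[mu]_(x in I) mono m n x = \int[mu]_(x in I) sinn (m - n) x)%R.
    apply: eq_Rintegral => x /E x1; rewrite /mono /sinn.
    by rewrite -{1}(subnK nm) exprD -mulrA -exprMn circMV // expr1n mulr1.
  rewrite S; congr (_ * _).
  have -> : (n == m.+1) = false by apply/eqP; lia.
  by rewrite subr0; congr (_%:R); congr nat_of_bool; apply/eqP/eqP; lia.
have -> : (\int[mu]_(x in I) mono m n x = \int[mu]_(x in I) (-1 * sinn (n - m) x))%R.
  apply: eq_Rintegral => x /E x1; rewrite /mono /sinn.
  rewrite -{1}(subnK (ltnW mn)) exprD mulrCA -exprMn circMV // expr1n mulr1.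
  by rewrite -rmorphXn; case: (_ ^+ _) => u v /=; rewrite mulN1r.
rewrite RintegralZl //; last first.
  by apply: integrable_I; apply: continuous_subspaceT; exact: (continuous_csn R _).2.
rewrite S mulN1r -mulrN; congr (_ * _).
have -> : (m == n.+1) = false by apply/eqP; lia.
by rewrite sub0r; congr (- _%:R); congr nat_of_bool; apply/eqP/eqP; lia.
Qed.

Definition kpoly (D : nat) (k : nat -> R) (u : C) : C := \sum_(0 <= m < D) (k m)%:C * u ^+ m.

(** The imaginary part of (z^2 - q) (1 - q^2 / z^2) z^m z^(-n) on the unit circle, expanded. *)
Definition quad (m n : nat) (x : R) : R :=
  mono m.+2 n x - q * mono m n x - q ^+ 2 * mono m.+2 n.+2 x + q ^+ 3 * mono m n.+2 x.

(* After integration only the entries with |m - n| = 1 or 3 survive, and these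
   cancel once symmetrised with the weights q^n, q^m. *)
Lemma quad_antisym m n :
  (q ^+ n * \int[mu]_(x in I) quad m n x + q ^+ m * \int[mu]_(x in I) quad n m x = 0)%R.
Proof.
have Q i j : (\int[mu]_(x in I) quad i j x = \int[mu]_(x in I) sinn 1 x *
  (((i.+2 == j.+1)%:R - (j == i.+3)%:R) - (q + q ^+ 2) * ((i == j.+1)%:R - (j == i.+1)%:R)
   + q ^+ 3 * ((i == j.+3)%:R - (j.+2 == i.+1)%:R))) %R.
  have H m' n' : {within I, continuous (mono m' n')}.
    by apply: continuous_subspaceT; exact: continuous_mono.
  have HM h m' n' : {within I, continuous (fun x => h * mono m' n' x)}.
    by apply: withinM => //; exact: within_cst.
  transitivity (\int[mu]_(x in I) (q ^+ 3 * mono i j.+2 x + (- q ^+ 2 * mono i.+2 j.+2 x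
     + (- q * mono i j x + mono i.+2 j x))))%R.
    by apply: eq_Rintegral => x _; rewrite /quad; ring.
  rewrite !intI_lin //; do ?[apply: withinD => //].
  rewrite !int_mono !eqSS; ring.
rewrite !Q !eqSS (eq_sym m.+1 n) (eq_sym n.+1 m).
have h i j r : q ^+ i * (i == j + r)%N%:R = q ^+ r * q ^+ j * (i == j + r)%N%:R.
  by case: eqP => [->|_]; rewrite ?mulr0 // exprD mulrC [q ^+ j * _]mulrC mulrC.
have h1 := h n m 1; have h2 := h m n 1; have h3 := h n m 3; have h4 := h m n 3.
rewrite !addn1 !addn3 in h1 h2 h3 h4.
move: ((n == m.+1)%:R : R) ((m == n.+1)%:R : R) ((n == m.+3)%:R : R) ((m == n.+3)%:R : R) h1 h2 h3 h4 => b1 b2 b3 b4 h1 h2 h3 h4.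
set J := Rintegral _ _ _.
transitivity (J * ((1 + q + q ^+ 2) * (q ^+ n * b1 - q ^+ 1 * q ^+ m * b1)
  + (1 + q + q ^+ 2) * (q ^+ m * b2 - q ^+ 1 * q ^+ n * b2)
  - (q ^+ n * b3 - q ^+ 3 * q ^+ m * b3) - (q ^+ m * b4 - q ^+ 3 * q ^+ n * b4))); first by ring.
by rewrite h1 h2 h3 h4; ring.
Qed.

Lemma ImD (u v : C) : complex.Im (u + v) = complex.Im u + complex.Im v.
Proof. by case: u v => [? ?] []. Qed.

Lemma ImZ (r : R) (u : C) : complex.Im (r%:C * u) = r * complex.Im u.
Proof. by case: u => [? ?] /=; rewrite mul0r addr0. Qed.

Lemma Im_sum n (f : nat -> C) :
  complex.Im (\sum_(0 <= i < n) f i) = \sum_(0 <= i < n) complex.Im (f i).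
Proof. by apply: (big_morph _ ImD). Qed.

Let cq i j : {within I, continuous (quad i j)}.
Proof.
have H m' n' : {within I, continuous (mono m' n')}.
  by apply: continuous_subspaceT; exact: continuous_mono.
have HM h m' n' : {within I, continuous (fun x => h * mono m' n' x)}.
  by apply: withinM => //; exact: within_cst.
rewrite (_ : quad i j = (fun x => q ^+ 3 * mono i j.+2 x + (- q ^+ 2 * mono i.+2 j.+2 x
   + (- q * mono i j x + mono i.+2 j x)))).
  by do ?[apply: withinD => //].
by apply/funext => x; rewrite /quad; ring.
Qed.

Definition kform D k (x : R) : R := complex.Im
  ((circ x ^+ 2 - q%:C) * (1 - q%:C ^+ 2 * (circ x)^*%C ^+ 2)
   * kpoly D k (circ x) * kpoly D k (q%:C * (circ x)^*%C) : C).

Let kformE D k : kform D k =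
  (fun x => \sum_(0 <= m < D) k m * \sum_(0 <= n < D) (k n * q ^+ n) * quad m n x).
Proof.
apply/funext => x; rewrite /kform /kpoly /quad /mono; move: (circ x) => z.
rewrite -mulrA big_distrlr /= mulr_sumr Im_sum; apply: eq_bigr => m _.
rewrite !mulr_sumr Im_sum; apply: eq_bigr => n _.
have -> : (z ^+ 2 - q%:C) * (1 - q%:C ^+ 2 * z^*%C ^+ 2) *
   ((k m)%:C * z ^+ m * ((k n)%:C * (q%:C * z^*%C) ^+ n))
  = (k m * (k n * q ^+ n))%:C * (z ^+ m.+2 * z^*%C ^+ n + (- q)%:C * (z ^+ m * z^*%C ^+ n)
  + (- q ^+ 2)%:C * (z ^+ m.+2 * z^*%C ^+ n.+2) + (q ^+ 3)%:C * (z ^+ m * z^*%C ^+ n.+2)) :> C.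
  by rewrite !(rmorphM, rmorphN, rmorphXn) /= !exprMn !exprS; ring.
by rewrite ImZ !ImD !ImZ; ring.
Qed.

Lemma kform_continuous D k : {within I, continuous (kform D k)}.
Proof.
rewrite kformE; apply: within_sum => m; apply: withinM; first exact: within_cst.
by apply: within_sum => n; apply: withinM => //; exact: within_cst.
Qed.

(** In K(z) K(q / z) the pair (m, n) has the weight k_m k_n q^n. Exchanging m and n changes the sign
    of the sum by [quad_antisym], so the sum equals its opposite. *)
Lemma int_kform D k : (\int[mu]_(x in I) kform D k x = 0)%R.
Proof.
transitivity (\sum_(0 <= m < D) k m * \sum_(0 <= n < D) (k n * q ^+ n) * \int[mu]_(x in I) quad m n x)%R.
  rewrite kformE intI_sum; last first.
    by move=> i; apply: within_sum => j; apply: withinM => //; exact: within_cst.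
  by apply: eq_bigr => m _; rewrite intI_sum.
set S := (X in X = 0).
suff : S = - S by lra.
rewrite {2}/S.
under [in RHS]eq_bigr do rewrite mulr_sumr.
rewrite exchange_big /= -sumrN; apply: eq_bigr => m _.
rewrite mulr_sumr -sumrN; apply: eq_bigr => n _.
have := quad_antisym m n.
by move=> /(congr1 (fun t => k m * k n * t)); rewrite mulr0; lra.
Qed.

End FiniteIdentity.

(** * Polynomial approximation of the kernel and the first moment of the weight *)

Section Kernel.
Variables (R : realType) (q : R).
Hypotheses (q_gt0 : 0 < q) (q_lt1 : q < 1).
Local Notation C := (cplx R).
Local Notation Q := (q%:C : C).

(** An approximation of 1 / (v; q)_oo: N factors, each a geometric series cut after N terms. It has
    to be a polynomial in v, since the integral is only known to vanish for polynomials. *)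
Definition gN (N : nat) (v : C) : C :=
  \prod_(0 <= i < N) \sum_(0 <= r < N) (v * Q ^+ i) ^+ r.

Let nQ i : normc (Q ^+ i) = q ^+ i.
Proof. by rewrite -rmorphXn /= expr0n /= addr0 sqrtr_sqr ger0_norm // exprn_ge0 // ltW. Qed.

Lemma normcX (v : C) n : normc (v ^+ n) = normc v ^+ n.
Proof. by elim: n => [|n IH]; rewrite ?expr0 ?normc1 // !exprS normcM IH. Qed.

Lemma normc_qpoch_le (u : C) n : normc (qpoch Q u n) <= expR (normc u / (1 - q)).
Proof.
apply: (normc_prod_le q_gt0 q_lt1) => [|i]; first exact: normc_nneg.
have -> : 1 - u * Q ^+ i - 1 = - (u * Q ^+ i) by ring.
by rewrite normcN normcM nQ.
Qed.

Lemma sum_geomM (w : C) N : (\sum_(0 <= r < N) w ^+ r) * (1 - w) = 1 - w ^+ N.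
Proof.
elim: N => [|N IH]; first by rewrite big_geq // expr0 subrr mul0r.
by rewrite big_nat_recr //= mulrDl IH exprS; ring.
Qed.

Lemma gN_qpoch N v : gN N v * qpoch Q v N = \prod_(0 <= i < N) (1 - (v * Q ^+ i) ^+ N).
Proof.
rewrite /gN /qpoch -big_split /=; apply: eq_bigr => i _; exact: sum_geomM.
Qed.

Section Bound.
Variables (rho : R) (v : C).
Hypotheses (rho_lt1 : rho < 1) (v_rho : normc v <= rho).

Let rho_ge0 : 0 <= rho := le_trans (normc_nneg v) v_rho.

(** Factor i differs from 1 by at most q^i rho / (1 - rho). Uniformity in N and v supplies the
    dominating constant for the limit under the integral. *)
Lemma normc_gN_le N : normc (gN N v) <= expR (rho / (1 - rho) / (1 - q)).
Proof.
have r1 : 0 < 1 - rho by rewrite subr_gt0.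
case: N => [|N].
  rewrite /gN big_geq // normc1; apply: le_trans (expR_ge1Dx _); rewrite lerDl.
  apply: divr_ge0; last by rewrite subr_ge0 ltW.
  by apply: divr_ge0 => //; exact: ltW.
apply: (normc_prod_le q_gt0 q_lt1) => [|i]; first by rewrite divr_ge0 // ltW.
set w := v * Q ^+ i.
have qi : q ^+ i <= 1 by rewrite exprn_ile1 // ltW.
have qi0 : 0 <= q ^+ i by rewrite exprn_ge0 // ltW.
have wr : normc w <= rho * q ^+ i by rewrite normcM nQ ler_wpM2r.
have w1 : normc w <= rho by apply: le_trans wr _; rewrite ler_piMr.
rewrite big_nat_recl // expr0 addrAC subrr add0r.
apply: (@le_trans _ _ (\sum_(0 <= r < N) normc w * rho ^+ r)).
  elim: N => [|N IH]; first by rewrite !big_geq // normc0.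
  rewrite !big_nat_recr //=; apply: le_trans (le_normcD _ _) _; apply: lerD => //.
  rewrite exprS normcM normcX ler_wpM2l ?normc_nneg // lerXn2r ?nnegrE ?normc_nneg //.
rewrite -mulr_sumr mulrAC ler_pdivlMr //.
apply: (@le_trans _ _ (normc w)); last by [].
rewrite -mulrA ler_piMr ?normc_nneg //.
elim: N => [|N IH]; first by rewrite big_geq // mul0r.
have E M : (\sum_(0 <= r < M) rho ^+ r) * (1 - rho) = 1 - rho ^+ M.
  elim: M => [|M IHM]; first by rewrite big_geq // expr0 subrr mul0r.
  by rewrite big_nat_recr //= mulrDl IHM exprS; ring.
by rewrite E gerBl exprn_ge0.
Qed.

(** The product equals that of 1 - (v q^i)^N over i < N, whose distance to 1 is of order rho^N. *)
Lemma gN_qpoch_cvg : gN N v * qpoch Q v N @[N --> \oo] --> (1 : C).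
Proof.
have K0 : 0 <= expR (1 / (1 - q)) / (1 - q) by rewrite divr_ge0 ?expR_ge0 // subr_ge0 ltW.
set K := expR _ / _ in K0.
have r1 : rho <= 1 by exact: ltW.
have bd N : normc (gN N.+1 v * qpoch Q v N.+1 - 1) <= K * rho ^+ N.+1.
  rewrite gN_qpoch.
  have h i : normc (1 - (v * Q ^+ i) ^+ N.+1 - 1) <= rho ^+ N.+1 * q ^+ i.
    have -> : 1 - (v * Q ^+ i) ^+ N.+1 - 1 = - (v * Q ^+ i) ^+ N.+1 by ring.
    rewrite normcN normcX normcM nQ exprMn ler_pM ?exprn_ge0 ?(ltW q_gt0) ?normc_nneg //.
      by rewrite lerXn2r ?nnegrE ?normc_nneg.
    by rewrite exprS ler_piMr ?exprn_ge0 ?(ltW q_gt0) // exprn_ile1 ?exprn_ge0 ?exprn_ile1 ?(ltW q_gt0) // ltW.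
  have := normc_prodB q_gt0 q_lt1 (exprn_ge0 N.+1 rho_ge0) h (leq0n N.+1).
  rewrite [X in _ - X]big_geq // expr0 mulr1 => /le_trans; apply.
  rewrite /K [leRHS]mulrAC ler_wpM2r ?invr_ge0 ?subr_ge0 ?(ltW q_lt1) //.
  rewrite ler_wpM2r ?exprn_ge0 // ler_expR ler_wpM2r ?invr_ge0 ?subr_ge0 ?(ltW q_lt1) //.
  by rewrite exprn_ile1.
have K_cvg : K * rho ^+ N @[N --> \oo] --> 0.
  rewrite -[X in _ --> X](mulr0 K); apply: cvgMl_tmp.
  by apply: cvg_expr; rewrite ger0_norm.
apply/cvgrPdist_le => e e0.
have [er e0r er0] : exists2 r : R, e = r%:C & 0 < r.
  by move: e0; case: e => r i; rewrite ltcE /= => /andP[/eqP-> ?]; exists r.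
move/cvgrPdist_le : K_cvg => /(_ _ er0)[m _ hm].
exists m.+1 => // -[//|N] /= mN; rewrite distrC normcE' e0r lecR.
apply: le_trans (bd N) _; apply: le_trans (hm N.+1 (ltnW mN)).
by rewrite sub0r normrN ler_norm.
Qed.

Lemma qpoch_neq0' N : qpoch Q v N != 0.
Proof.
apply: qpoch_neq0 => i _; rewrite subr_eq0; apply/eqP => h.
have : normc (v * Q ^+ i) < 1.
  rewrite normcM nQ; apply: le_lt_trans rho_lt1.
  by rewrite -[leRHS]mulr1 ler_pM ?normc_nneg ?exprn_ge0 ?exprn_ile1 ?(ltW q_gt0) // ltW.
by rewrite -h normc1 ltxx.
Qed.

Lemma gN_cvg : qpinf Q v != 0 -> gN N v @[N --> \oo] --> (qpinf Q v)^-1.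
Proof.
move=> v0; rewrite (_ : (fun N => gN N v) = (fun N => gN N v * qpoch Q v N * (qpoch Q v N)^-1)).
  rewrite -[X in _ --> X]mul1r; apply: cvgM; first exact: gN_qpoch_cvg.
  by apply: cvgV => //; exact: cqpinf_cvg.
by apply/funext => N; rewrite mulfK // qpoch_neq0'.
Qed.

End Bound.

Lemma gN_poly e N : {p : {poly R} | forall u : C, gN N (e%:C * u) = (map_poly (real_complex R) p).[u]}.
Proof.
exists (\prod_(0 <= i < N) \sum_(0 <= r < N) ((e * q ^+ i) ^+ r)%:P * 'X^r) => u.
rewrite rmorph_prod horner_prod; apply: eq_bigr => i _.
rewrite rmorph_sum horner_sum; apply: eq_bigr => r _ /=.
rewrite rmorphM /= map_polyXn map_polyC hornerM hornerC hornerXn.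
transitivity (((e * q ^+ i) ^+ r)%:C * u ^+ r : C); last by [].
by rewrite !(rmorphXn, rmorphM) /= !exprMn; ring.
Qed.

Lemma map_polyX2 : map_poly (real_complex R) 'X^2 = 'X^2. Proof. by rewrite map_polyXn. Qed.

Lemma qpoch2_poly N : {p : {poly R} | forall u : C, qpoch Q (Q * u ^+ 2) N = (map_poly (real_complex R) p).[u]}.
Proof.
exists (\prod_(0 <= i < N) (1 - (q * q ^+ i)%:P * 'X^2)) => u.
rewrite rmorph_prod horner_prod; apply: eq_bigr => i _ /=.
rewrite rmorphB rmorphM rmorph1 /= map_polyC map_polyX2 !hornerE.
transitivity (1 - (q * q ^+ i)%:C * u ^+ 2 : C); last by rewrite /= expr2 mulrA.
by rewrite !(rmorphXn, rmorphM) /=; ring.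
Qed.

Lemma kpolyE (p : {poly R}) u : (map_poly (real_complex R) p).[u] = kpoly (size p) (nth 0 p) u.
Proof.
rewrite horner_coef size_map_poly /kpoly big_mkord; apply: eq_bigr => i _.
by rewrite coef_map.
Qed.

End Kernel.

Section Moment.
Variables (R : realType) (q : R).
Hypotheses (q_gt0 : 0 < q) (q_lt1 : q < 1).
Local Notation C := (cplx R).
Local Notation Q := (q%:C : C).
Local Notation mu := (@lebesgue_measure R).
Local Notation I := ([set` `[(-1)%R, 1%R]] : set R).
Variables a b c d : R.

(** The numerator is (q z^2, q / z^2; q)_oo, because 2 x^2 - 1 is the real part of z^2. *)
Definition aw_kernel (x : R) : R :=
  azinf q q (2 * x ^+ 2 - 1) / (azinf q a x * azinf q b x * azinf q c x * azinf q d x).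

Definition aw_rdens (x : R) : R := aw_kernel x * Num.sqrt (1 - x ^+ 2).

Lemma in_I x : I x -> `|x| <= 1.
Proof. by rewrite /= in_itv /= => /andP[? ?]; rewrite ler_norml; apply/andP. Qed.

Hypotheses (a1 : `|a| < 1) (b1 : `|b| < 1) (c1 : `|c| < 1) (d1 : `|d| < 1).

Let q1 : `|q| < 1. Proof. by rewrite ger0_norm // ltW. Qed.

Lemma quad_I (x : R) : `|x| <= 1 -> `|2 * x ^+ 2 - 1| <= 1.
Proof.
move=> x1; have : 0 <= x ^+ 2 <= 1.
  by rewrite sqr_ge0 -real_normK ?num_real // exprn_ile1.
by move=> /andP[? ?]; rewrite ler_norml; lra.
Qed.

Lemma aw_kernel_gt0 x : `|x| <= 1 -> 0 < aw_kernel x.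
Proof.
move=> x1; rewrite /aw_kernel divr_gt0 ?mulr_gt0 ?azinf_gt0 //; exact: quad_I.
Qed.

Lemma aw_kernel_continuous : {within I, continuous aw_kernel}.
Proof.
apply: continuous_in_subspaceT => x; rewrite inE => /in_I x1.
have h e : `|e| < 1 -> {for x, continuous (azinf q e)}.
  by move=> e1; apply: azinf_continuous => //; exact: ltW.
apply: (@cvgM R R (nbhs x) _ (fun x => azinf q q (2 * x ^+ 2 - 1))
   (fun x => (azinf q a x * azinf q b x * azinf q c x * azinf q d x)^-1)).
  apply: (continuous_comp (f := fun x : R => 2 * x ^+ 2 - 1)).
    by apply: cvgB; [apply: cvgMl_tmp; exact: exprn_continuous|exact: cvg_cst].
  by apply: azinf_continuous => //; exact: ltW.
apply: cvgV; first by rewrite gt_eqF // !mulr_gt0 ?azinf_gt0.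
by apply: cvgM; [apply: cvgM; [apply: cvgM|]|]; exact: h.
Qed.

Lemma aw_rdens_continuous : {within I, continuous aw_rdens}.
Proof.
apply: withinM; first exact: aw_kernel_continuous.
by apply: continuous_subspaceT; exact: continuous_circ_im.
Qed.

(* A polynomial approximation of
   K(u) = (q u^2; q)_oo / (a u, b u, c u, d u; q)_oo; the weight is, up to
   elementary factors, K(z) K(q / z), and for a polynomial K the integral of
   Im ((z^2 - q) (1 - q^2 / z^2) K(z) K(q / z)) vanishes by [int_kform]. *)
Definition kN (N : nat) (u : C) : C := qpoch Q (Q * u ^+ 2) N
  * gN q N (a%:C * u) * gN q N (b%:C * u) * gN q N (c%:C * u) * gN q N (d%:C * u).

Lemma kN_poly N : {p : {poly R} | forall u, kN N u = (map_poly (real_complex R) p).[u]}.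
Proof.
have [p0 h0] := qpoch2_poly q N.
have [pa ha] := gN_poly q a N; have [pb hb] := gN_poly q b N.
have [pc hc] := gN_poly q c N; have [pd hd] := gN_poly q d N.
exists (p0 * pa * pb * pc * pd) => u.
by rewrite /kN h0 ha hb hc hd !rmorphM /= !hornerM.
Qed.

Let E1 : R := expR (1 / (1 - q)).
Let E (e : R) : R := expR (`|e| / (1 - `|e|) / (1 - q)).
Let M : R := E1 * E a * E b * E c * E d.

Lemma normc_rc (e : R) : normc (e%:C : C) = `|e|.
Proof. by rewrite /= expr0n addr0 sqrtr_sqr. Qed.

Lemma normc_kN_le N u : normc u <= 1 -> normc (kN N u) <= M.
Proof.
move=> u1.
have h e : `|e| < 1 -> normc (gN q N (e%:C * u)) <= E e.
  move=> e1; apply: (normc_gN_le q_gt0 q_lt1 e1).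
  by rewrite normcM normc_rc ler_piMr.
rewrite /kN !normcM /M.
do 4 (apply: ler_pM; rewrite ?mulr_ge0 ?normc_nneg ?h //).
apply: le_trans (normc_qpoch_le q_gt0 q_lt1 _ _) _.
rewrite ler_expR ler_wpM2r ?invr_ge0 ?subr_ge0 ?(ltW q_lt1) //.
rewrite normcM normc_rc normcX.
by rewrite mulr_ile1 ?exprn_ge0 ?exprn_ile1 ?normc_nneg // ltW.
Qed.

Definition kV (N : nat) (x : R) : R := complex.Im
  ((circ x ^+ 2 - q%:C) * (1 - q%:C ^+ 2 * (circ x)^*%C ^+ 2)
   * kN N (circ x) * kN N (q%:C * (circ x)^*%C) : C).

Let kVE N : exists D k, kV N = kform q D k.
Proof.
have [p hp] := kN_poly N; exists (size p), (nth 0 p).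
by apply/funext => x; rewrite /kV !hp !kpolyE.
Qed.

Lemma int_kV N : (\int[mu]_(x in I) kV N x = 0)%R.
Proof. by have [D [k ->]] := kVE N; exact: int_kform. Qed.

Lemma kV_continuous N : {within I, continuous (kV N)}.
Proof. by have [D [k ->]] := kVE N; exact: kform_continuous. Qed.

Let s1 := a + b + c + d.
Let s3 := a * b * c + a * b * d + a * c * d + b * c * d.
Let s4 := a * b * c * d.

Lemma normc_conj (z : C) : normc (z^*%C) = normc z.
Proof. by case: z => u v /=; rewrite sqrrN. Qed.

Lemma kV_le N x : I x -> `|kV N x| <= 4 * (M * M).
Proof.
move=> /in_I x1; apply: le_trans (normIm_le _) _.
have z1 := normc_circ x1.
have k1 : normc (kN N (circ x)) <= M by apply: normc_kN_le; rewrite z1.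
have k2 : normc (kN N (Q * (circ x)^*%C)) <= M.
  by apply: normc_kN_le; rewrite normcM normc_conj z1 mulr1 normc_rc ltW.
move: (kN N _) (kN N _) k1 k2 => K1 K2 k1 k2.
rewrite !normcM -mulrA; apply: ler_pM; rewrite ?mulr_ge0 ?normc_nneg //; last first.
  by apply: ler_pM; rewrite ?normc_nneg.
have -> : (4 : R) = 2 * 2 by rewrite -natrM.
apply: ler_pM; rewrite ?normc_nneg //.
  apply: le_trans (le_normcD _ _) _; rewrite normcN normcX z1 expr1n normc_rc.
  by rewrite lerD2l ltW.
apply: le_trans (le_normcD _ _) _; rewrite normcN normcM !normcX normc_conj z1 normc_rc expr1n.
by rewrite normc1 mulr1 lerD2l exprn_ile1 // ltW.
Qed.

(** Completing K(q / z) to K(1 / z) uses up z^2 - q and 1 - q^2 / z^2 and leaves the kernel times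
    z^2 (1 - a/z) (1 - b/z) (1 - c/z) (1 - d/z). Its imaginary part is that of z^2 - s1 z + s2 - s3
    / z + s4 / z^2, namely sin t (2 x (1 - s4) - s1 + s3). *)
Lemma kV_cvg x : I x -> kV N x @[N --> \oo] --> aw_rdens x * (2 * x * (1 - s4) - s1 + s3).
Proof.
move=> /in_I x1; set z := circ x; set zz := (circ x)^*%C.
have z1 := normc_circ x1; have z0 := circ_neq0 x1.
have zV : z^-1 = zz := circV x1.
have zz1 : z * zz = 1 := circMV x1.
have zz0 : zz != 0 by rewrite -zV invr_eq0.
have pair e : `|e| < 1 -> qpinf Q (e%:C * z) * qpinf Q (e%:C * zz) = (azinf q e x)%:C :> C.
  move=> e1; rewrite -zV; apply: cqpinf_pair => //; first exact: ltW.
  by rewrite circDV.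
have pair0 e : `|e| < 1 -> qpinf Q (e%:C * z) != 0 /\ qpinf Q (e%:C * zz) != 0.
  move=> e1; have h : (azinf q e x)%:C != 0 :> C.
    by rewrite eq_complex /= eqxx andbT gt_eqF // azinf_gt0.
  by apply/andP; rewrite -negb_or -mulf_eq0 pair.
have S e : qpinf Q (e%:C * zz) = (1 - e%:C * zz) * qpinf Q (e%:C * (Q * zz)).
  by rewrite (cqpinfSl q_gt0 q_lt1); congr (_ * qpinf _ _); ring.
have S0 e : `|e| < 1 -> qpinf Q (e%:C * (Q * zz)) != 0.
  by move=> /pair0[_]; rewrite S mulf_eq0 negb_or => /andP[].
have g1 e : `|e| < 1 -> gN q N (e%:C * z) @[N --> \oo] --> (qpinf Q (e%:C * z))^-1.
  move=> e1; apply: (gN_cvg q_gt0 q_lt1 e1); last exact: (pair0 e e1).1.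
  by rewrite normcM z1 mulr1 normc_rc.
have g2 e : `|e| < 1 -> gN q N (e%:C * (Q * zz)) @[N --> \oo] --> (qpinf Q (e%:C * (Q * zz)))^-1.
  move=> e1; apply: (gN_cvg q_gt0 q_lt1 e1); last exact: S0.
  rewrite !normcM normc_conj z1 mulr1 !normc_rc ler_piMr // ltW //.
have k1 : kN N z @[N --> \oo] --> qpinf Q (Q * z ^+ 2) / qpinf Q (a%:C * z) / qpinf Q (b%:C * z)
   / qpinf Q (c%:C * z) / qpinf Q (d%:C * z).
  by do 4 (apply: cvgM; last exact: g1); exact: cqpinf_cvg.
have k2 : kN N (Q * zz) @[N --> \oo] --> qpinf Q (Q * (Q * zz) ^+ 2) / qpinf Q (a%:C * (Q * zz))
   / qpinf Q (b%:C * (Q * zz)) / qpinf Q (c%:C * (Q * zz)) / qpinf Q (d%:C * (Q * zz)).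
  by do 4 (apply: cvgM; last exact: g2); exact: cqpinf_cvg.
have L := cvg_Im (cvgM (cvgM (cvg_cst ((z ^+ 2 - q%:C) * (1 - q%:C ^+ 2 * zz ^+ 2) : C)) k1) k2).
pose X : C := (z ^+ 2 - q%:C) * (1 - q%:C ^+ 2 * zz ^+ 2)
  * (qpinf Q (Q * z ^+ 2) / qpinf Q (a%:C * z) / qpinf Q (b%:C * z)
   / qpinf Q (c%:C * z) / qpinf Q (d%:C * z))
  * (qpinf Q (Q * (Q * zz) ^+ 2) / qpinf Q (a%:C * (Q * zz))
   / qpinf Q (b%:C * (Q * zz)) / qpinf Q (c%:C * (Q * zz)) / qpinf Q (d%:C * (Q * zz))).
suff -> : aw_rdens x * (2 * x * (1 - s4) - s1 + s3) = complex.Im X by exact: L.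
have T : (1 - Q * zz ^+ 2) * (1 - Q ^+ 2 * zz ^+ 2) * qpinf Q (Q * (Q * zz) ^+ 2) = qpinf Q (Q * zz ^+ 2).
  rewrite (cqpinfSl q_gt0 q_lt1 (Q * zz ^+ 2)) (cqpinfSl q_gt0 q_lt1 (Q * zz ^+ 2 * Q)) mulrA.
  by congr (_ * (1 - _) * qpinf _ _); ring.
have P2 : qpinf Q (Q * z ^+ 2) * qpinf Q (Q * zz ^+ 2) = (azinf q q (2 * x ^+ 2 - 1))%:C :> C.
  have -> : zz ^+ 2 = (z ^+ 2)^-1 by rewrite -zV exprVn.
  apply: cqpinf_pair => //; [exact: ltW|by rewrite expf_neq0|].
  have := circDV x1; rewrite -/z => h.
  have -> : z ^+ 2 + (z ^+ 2)^-1 = (z + z^-1) ^+ 2 - 2 by field.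
  by rewrite h -rmorphXn -[2%:R : C](rmorph_nat (real_complex R)) -rmorphB; congr (_%:C); ring.
have EX : X = (aw_kernel x)%:C * (z ^+ 2 * ((1 - a%:C * zz) * (1 - b%:C * zz) * (1 - c%:C * zz) * (1 - d%:C * zz))).
  rewrite /X /aw_kernel fmorph_div !rmorphM /= -P2 -!pair // -T.
  rewrite (S a) (S b) (S c) (S d).
  have -> : z ^+ 2 - Q = z ^+ 2 * (1 - Q * zz ^+ 2).
    by rewrite mulrBr mulr1 mulrCA -exprMn zz1 expr1n mulr1.
  have n0 e : `|e| < 1 -> 1 - e%:C * zz != 0 :> C.
    by move=> /pair0[_]; rewrite S mulf_eq0 negb_or => /andP[].
  have := n0 _ a1; have := n0 _ b1; have := n0 _ c1; have := n0 _ d1.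
  have := (pair0 _ a1).1; have := (pair0 _ b1).1; have := (pair0 _ c1).1; have := (pair0 _ d1).1.
  have := S0 _ a1; have := S0 _ b1; have := S0 _ c1; have := S0 _ d1.
  move: (qpinf Q (Q * z ^+ 2)) (qpinf Q (Q * (Q * zz) ^+ 2)) => u0 w0.
  move: (qpinf Q (a%:C * (Q * zz))) (qpinf Q (b%:C * (Q * zz)))
    (qpinf Q (c%:C * (Q * zz))) (qpinf Q (d%:C * (Q * zz))) => wa wb wc wd.
  move: (qpinf Q (a%:C * z)) (qpinf Q (b%:C * z)) (qpinf Q (c%:C * z)) (qpinf Q (d%:C * z))
    => ua ub uc ud.
  move=> wd0 wc0 wb0 wa0 ud0 uc0 ub0 ua0 nd nc nb na.
  field.
  by rewrite wd0 wc0 wb0 wa0 ud0 uc0 ub0 ua0 nd nc nb na.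
rewrite EX ImZ /aw_rdens -mulrA; congr (_ * _).
have e1 : z ^+ 2 * zz = z by rewrite expr2 -mulrA zz1 mulr1.
have e2 : z ^+ 2 * zz ^+ 2 = 1 by rewrite -exprMn zz1 expr1n.
have e3 : z ^+ 2 * zz ^+ 3 = zz by rewrite (exprSr zz 2) mulrA e2 mul1r.
have e4 : z ^+ 2 * zz ^+ 4 = zz ^+ 2 by rewrite (exprSr zz 3) mulrA e3 expr2.
transitivity (complex.Im (z ^+ 2 + (- s1)%:C * z + (a * b + a * c + a * d + b * c + b * d + c * d)%:C * 1
  + (- s3)%:C * zz + s4%:C * zz ^+ 2)).
  by rewrite !ImD !ImZ /z /zz /circ !expr2 /=; ring.
congr complex.Im; symmetry.
transitivity (z ^+ 2 + (- s1)%:C * (z ^+ 2 * zz)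
  + (a * b + a * c + a * d + b * c + b * d + c * d)%:C * (z ^+ 2 * zz ^+ 2)
  + (- s3)%:C * (z ^+ 2 * zz ^+ 3) + s4%:C * (z ^+ 2 * zz ^+ 4) : C).
  by rewrite /s1 /s3 /s4 !(rmorphN, rmorphM, rmorphD) /=; ring.
by rewrite e1 e2 e3 e4.
Qed.

(** The limit of [int_kV] by dominated convergence. This relation between the moments of 1 and x
    holds for all admissible parameters; read with a q^j for a, it determines the moments of all the
    [azpoch] up to the total mass. *)
Lemma moment : (\int[mu]_(x in I) (aw_rdens x * (2 * x * (1 - s4) - s1 + s3)) = 0)%R.
Proof.
pose f x := aw_rdens x * (2 * x * (1 - s4) - s1 + s3).
have cf : {within I, continuous f}.
  apply: withinM; first exact: aw_rdens_continuous.
  apply: continuous_subspaceT => x; apply: cvgD; last exact: cvg_cst.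
  apply: cvgB; last exact: cvg_cst.
  by apply: cvgMr_tmp; apply: cvgMl_tmp; exact: cvg_id.
have mI : measurable (I : set (measurableTypeR R)) by exact: measurable_itv.
have [] := @dominated_convergence _ _ R mu I mI
  (fun N => EFin \o kV N) (EFin \o f) (EFin \o cst (4 * (M * M))).
- move=> N; apply/measurable_EFinP; apply: subspace_continuous_measurable_fun => //.
  exact: kV_continuous.
- by apply/measurable_EFinP; apply: subspace_continuous_measurable_fun.
- apply/aeW => x Ix; apply: cvg_EFin; first by apply: nearW.
  exact: kV_cvg.
- by apply: integrable_I; exact: within_cst.
- by apply/aeW => x Ix N; rewrite /= lee_fin; exact: kV_le.
move=> fi _ L; rewrite /Rintegral -/f.
suff -> : (\int[mu]_(x in I) (f x)%:E = 0)%E by [].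
have : [sequence (\int[mu]_(x in I) (EFin \o kV n) x)%E]_n @ \oo --> (0 : \bar R).
  rewrite (_ : [sequence _]_n = cst 0%E); first exact: cvg_cst.
  apply/funext => N /=; have := int_kV N; rewrite /Rintegral => h.
  rewrite -[LHS]fineK; first by rewrite h.
  apply: integrable_fin_num => //; apply: integrable_I; exact: kV_continuous.
by move=> h; apply: (cvg_unique _ L h).
Qed.

End Moment.

(** * The Askey-Wilson functional: orthogonality to constants and positivity *)

Section MomentFunctional.
Variables (R : realType) (q : R).
Hypotheses (q_gt0 : 0 < q) (q_lt1 : q < 1).
Local Notation mu := (@lebesgue_measure R).
Local Notation I := ([set` `[(-1)%R, 1%R]] : set R).

Lemma azinf_shift a x j : `|a| <= 1 ->
  azinf q a x = (azpoch q a j).[x] * azinf q (a * q ^+ j) x.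
Proof.
move=> a1; have aj : `|a * q ^+ j| <= 1.
  rewrite normrM mulr_ile1 // ger0_norm ?exprn_ge0 ?(ltW q_gt0) //.
  by rewrite exprn_ile1 // ltW.
apply/cvg_lim => //; rewrite -(cvg_shiftn j).
rewrite (_ : (fun _ => _) = (fun n => (azpoch q a j).[x] * (azpoch q (a * q ^+ j) n).[x])).
  by apply: cvgMl_tmp; exact: azinf_cvg.
apply/funext => n /=; elim: n => [|n IH]; first by rewrite azpoch0 mulr1.
by rewrite addSn !azpochS IH exprD -mulrA; congr (_ * (_ * _)); ring.
Qed.

Section Functional.
Variables a b c d : R.
Hypotheses (a0 : a != 0) (a1 : `|a| < 1) (b1 : `|b| < 1) (c1 : `|c| < 1) (d1 : `|d| < 1).

Definition rL (f : R -> R) : R := (\int[mu]_(x in I) (f x * aw_rdens q a b c d x))%R.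

Let cdens : {within I, continuous (aw_rdens q a b c d)}.
Proof. exact: aw_rdens_continuous. Qed.

Lemma rL_lin (h : R) (f g : R -> R) : {within I, continuous f} -> {within I, continuous g} ->
  rL (fun x => h * f x + g x) = h * rL f + rL g.
Proof.
move=> cf cg; rewrite /rL -intI_lin; try exact: withinM.
by congr Rintegral; apply/funext => x; rewrite mulrDl mulrA.
Qed.

Lemma within_horner (p : {poly R}) : {within I, continuous (horner p)}.
Proof. by apply: continuous_subspaceT; exact: continuous_horner. Qed.

Let phi j x := (azpoch q a j).[x].

(* The moment identity with [a] replaced by a q^j. *)
Lemma rL_azpochS j :
  rL (phi j.+1) * (1 - a * q ^+ j * b * c * d)
  = rL (phi j) * ((1 - a * q ^+ j * b) * (1 - a * q ^+ j * c) * (1 - a * q ^+ j * d)).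
Proof.
set A := a * q ^+ j.
have A1 : `|A| < 1.
  rewrite normrM (le_lt_trans _ a1) // ler_piMr // ger0_norm ?exprn_ge0 ?(ltW q_gt0) //.
  by rewrite exprn_ile1 // ltW.
have E x : I x -> aw_rdens q A b c d x = aw_rdens q a b c d x * phi j x.
  move=> /in_I x1; rewrite /aw_rdens /aw_kernel (azinf_shift x j (ltW a1)).
  have := azinf_gt0 q_gt0 q_lt1 a1 x1; rewrite (azinf_shift x j (ltW a1)) => /gt_eqF/negbT.
  rewrite mulf_eq0 negb_or => /andP[n1 n2].
  have nz e : `|e| < 1 -> azinf q e x != 0 by move=> e1; rewrite gt_eqF // azinf_gt0.
  rewrite /phi -/A; field.
  by rewrite n1 !nz // n2.
have := moment q_gt0 q_lt1 A1 b1 c1 d1.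
set s4 := A * b * c * d; set s1 := A + b + c + d; set s3 := A * b * c + A * b * d + A * c * d + b * c * d => M.
have : (\int[mu]_(x in I) (- (1 - s4) * (phi j.+1 x * aw_rdens q a b c d x) +
   ((1 - s4) * (1 + A ^+ 2) + A * (s3 - s1)) * (phi j x * aw_rdens q a b c d x)) = 0)%R.
  (* Since 2 A x = (1 + A^2) - (1 + A^2 - 2 A x), the multiple by A of the moment is a combination
     of [phi j] and [phi j.+1]. *)
  transitivity (A * \int[mu]_(x in I) (aw_rdens q A b c d x * (2 * x * (1 - s4) - s1 + s3)))%R; last by rewrite M mulr0.
  rewrite -RintegralZl //; last first.
    apply: integrable_I; apply: withinM; first exact: aw_rdens_continuous.
    rewrite (_ : (fun x => 2 * x * (1 - s4) - s1 + s3) = horner ((2 * (1 - s4)) *: 'X + (s3 - s1)%:P)); first exact: within_horner.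
    by apply/funext => x; rewrite hornerD hornerZ hornerX hornerC; ring.
  apply: eq_Rintegral => x; rewrite inE => /E ->.
  by rewrite /phi azpochS -/A; ring.
rewrite intI_lin; last 2 first.
- by apply: withinM => //; exact: within_horner.
- apply: withinM; first exact: within_cst.
  by apply: withinM => //; exact: within_horner.
rewrite RintegralZl //; last first.
  by apply: integrable_I; apply: withinM => //; exact: within_horner.
rewrite -/(rL (phi j)) -/(rL (phi j.+1)) => H.
transitivity (rL (phi j) * ((1 - s4) * (1 + A ^+ 2) + A * (s3 - s1))).
  by move: H; rewrite /s4; lra.
by rewrite /s1 /s3 /s4; ring.
Qed.

Let e := a * b * c * d.

Lemma mul_lt1 (u v : R) : `|u| < 1 -> `|v| < 1 -> `|u * v| < 1.
Proof. by move=> u1 v1; rewrite normrM mulr_ilt1. Qed.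

Lemma om_neq0 (u : R) i : `|u| < 1 -> 1 - u * q ^+ i != 0.
Proof.
move=> u1; rewrite subr_eq0; apply/eqP => h.
have : `|u * q ^+ i| < 1.
  rewrite normrM (le_lt_trans _ u1) // ler_piMr // ger0_norm ?exprn_ge0 ?(ltW q_gt0) //.
  by rewrite exprn_ile1 // ltW.
by rewrite -h normr1 ltxx.
Qed.

Let e1 : `|e| < 1. Proof. by rewrite /e; do 3 (apply: mul_lt1 => //). Qed.
Let qn1 : `|q| < 1. Proof. by rewrite ger0_norm // ltW. Qed.

Lemma rL_azpoch j : rL (phi j) =
  qpoch q (a * b) j * qpoch q (a * c) j * qpoch q (a * d) j / qpoch q e j * rL (phi 0).
Proof.
elim: j => [|j IH]; first by rewrite !qpoch0 invr1 !mul1r.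
have n1 : 1 - e * q ^+ j != 0 by exact: om_neq0.
have n2 : qpoch q e j != 0 by apply: qpoch_neq0 => i _; exact: om_neq0.
apply: (mulIf n1); have := rL_azpochS j.
have -> : 1 - a * q ^+ j * b * c * d = 1 - e * q ^+ j by rewrite /e; ring.
move=> ->; rewrite IH !qpochS; field; by rewrite n1 n2.
Qed.

(** An indefinite form of the q-Chu-Vandermonde sum: with lower parameter x y q every partial sum is
    a product, so induction on J applies. *)
Lemma qChu (x y : R) J : (forall i, 1 - x * y * q * q ^+ i != 0) ->
  \sum_(0 <= j < J.+1) qpoch q x j * qpoch q y j / (qpoch q (x * y * q) j * qpoch q q j) * q ^+ j
  = qpoch q (x * q) J * qpoch q (y * q) J / (qpoch q (x * y * q) J * qpoch q q J).
Proof.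
move=> xy; elim: J => [|J IH]; first by rewrite big_nat1 !qpoch0 expr0 !mulr1.
rewrite big_nat_recr //= IH (qpochSl _ x) (qpochSl _ y) !qpochS.
have n1 := xy J; have n2 : 1 - q * q ^+ J != 0 by exact: om_neq0.
have n3 : qpoch q (x * y * q) J != 0 by apply: qpoch_neq0.
have n4 : qpoch q q J != 0 by apply: qpoch_neq0 => i _; exact: om_neq0.
rewrite exprS; move: (q ^+ J) n1 n2 => Q n1 n2.
by field; rewrite n1 n2 n3 n4.
Qed.

Definition aw_val n x := aw_sum q a b c d x n.+1 (q ^+ n).

Lemma rL_sum J (k : nat -> R) (f : nat -> R -> R) : (forall i, {within I, continuous (f i)}) ->
  rL (fun x => \sum_(0 <= j < J) k j * f j x) = \sum_(0 <= j < J) k j * rL (f j).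
Proof.
move=> cf; rewrite /rL -intI_sum; last by move=> i; exact: withinM.
congr Rintegral; apply/funext => x; rewrite big_distrl /=.
by apply: eq_bigr => i _; rewrite mulrA.
Qed.

(** Termwise integration turns (a z, a / z; q)_j into (ab, ac, ad; q)_j / (abcd; q)_j up to the
    total mass. The remaining sum has upper parameters q^(-n) and abcd q^(n-1), whose product times
    q is abcd, and its value contains (q^(1-n); q)_n = 0. *)
Lemma rL_aw_val n : (0 < n)%N -> rL (aw_val n) = 0.
Proof.
move=> n0; have q0 : q != 0 by rewrite gt_eqF.
have -> : rL (aw_val n) = rL (phi 0) * \sum_(0 <= j < n.+1)
    qpoch q (q ^+ n)^-1 j * qpoch q (e * q ^+ n / q) j / (qpoch q e j * qpoch q q j) * q ^+ j.
  rewrite /aw_val /aw_sum /aw_term rL_sum => [|i]; last exact: within_horner.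
  rewrite mulr_sumr; apply: eq_bigr => j _; rewrite -/(phi j) rL_azpoch.
  have nz u : `|u| < 1 -> qpoch q u j != 0 by move=> u1; apply: qpoch_neq0 => i _; exact: om_neq0.
  by field; rewrite !nz ?mul_lt1.
have E : e = (q ^+ n)^-1 * (e * q ^+ n / q) * q by field; rewrite expf_neq0 // q0.
under eq_bigr do rewrite {2}E.
rewrite qChu; last by move=> i; rewrite -E; exact: om_neq0.
suff -> : qpoch q ((q ^+ n)^-1 * q) n = 0 by rewrite !mul0r mulr0.
case: n n0 {E} => // n _; rewrite qpochS.
have -> : (q ^+ n.+1)^-1 * q * q ^+ n = 1 by rewrite -mulrA -exprS mulVf ?expf_neq0.
by rewrite subrr mulr0.
Qed.

(** The kernel is bounded below by its minimum on [-1, 1] and sqrt (1 - x^2) by 1 - x^2; the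
    integral of the latter is 4 / 3. *)
Lemma rL1_gt0 : 0 < rL (fun=> 1).
Proof.
have [z /in_I z1 hz] := @EVT_min R (aw_kernel q a b c d) (-1) 1 ltac:(lra) (aw_kernel_continuous q_gt0 q_lt1 a1 b1 c1 d1).
have k0 := aw_kernel_gt0 q_gt0 q_lt1 a1 b1 c1 d1 z1.
set K := aw_kernel q a b c d z in k0 hz.
pose f (x : R) := K * (1 - x ^+ 2).
pose F : R -> R := horner (K *: ('X - (3^-1) *: 'X^3)).
have cF : continuous F by exact: continuous_horner.
have cf : {within I, continuous f}.
  rewrite (_ : f = horner (K *: (1 - 'X^2))); first exact: within_horner.
  by apply/funext => x; rewrite !hornerE.
have If : (\int[mu]_(x in I) f x = K * (4 / 3))%R.
  have := @continuous_FTC2 R f F (-1) 1; rewrite /Rintegral => ->.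
  - by rewrite -EFinB /= /F !hornerE /=; field.
  - lra.
  - exact: cf.
  - split.
    + by move=> x _; exact: derivable_horner.
    + by apply: cvg_at_right_filter; exact: cF.
    + by apply: cvg_at_left_filter; exact: cF.
  - move=> x _; rewrite derive1E /F derive_val /f derivZ derivB derivX derivZ derivXn.
    by rewrite !(hornerZ, hornerD, hornerN, hornerMn, hornerXn, hornerC) /=; field.
apply: (@lt_le_trans _ _ (\int[mu]_(x in I) f x)%R).
  by rewrite If mulr_gt0.
apply: le_Rintegral => //; [exact: integrable_I| |].
  by apply: integrable_I; apply: withinM => //; exact: within_cst.
move=> x Ix; have x1 := in_I Ix.
rewrite mul1r /f /aw_rdens.
have h0 : 0 <= 1 - x ^+ 2 by rewrite subr_ge0 -real_normK ?num_real // exprn_ile1.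
have s1 : 1 - x ^+ 2 <= Num.sqrt (1 - x ^+ 2).
  rewrite -[leLHS]ger0_norm // -sqrtr_sqr ler_wsqrtr // expr2 ler_piMr //.
  by rewrite gerBl sqr_ge0.
by apply: ler_pM => //; [exact: ltW|apply: hz; rewrite inE].
Qed.

End Functional.
End MomentFunctional.

(** * Complex integrals and the density *)

Section ComplexIntegral.
Variable R : realType.
Local Notation C := (cplx R).
Local Notation mu := (@lebesgue_measure R).
Local Notation I := ([set` `[(-1)%R, 1%R]] : set R).

Definition ccont (f : R -> C) :=
  {within I, continuous (fun x => complex.Re (f x))} /\
  {within I, continuous (fun x => complex.Im (f x))}.

Lemma ccontD f g : ccont f -> ccont g -> ccont (fun x => f x + g x).
Proof.
move=> [fr fi] [gr gi]; split.
  rewrite (_ : (fun x => _) = (fun x => complex.Re (f x) + complex.Re (g x))); first exact: withinD.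
  by apply/funext => x; case: (f x) (g x) => ? ? [].
rewrite (_ : (fun x => _) = (fun x => complex.Im (f x) + complex.Im (g x))); first exact: withinD.
by apply/funext => x; case: (f x) (g x) => ? ? [].
Qed.

Lemma ccontM f g : ccont f -> ccont g -> ccont (fun x => f x * g x).
Proof.
move=> [fr fi] [gr gi]; split.
  rewrite (_ : (fun x => _) = (fun x => complex.Re (f x) * complex.Re (g x)
      + -1 * (complex.Im (f x) * complex.Im (g x)))).
    by apply: withinD; [exact: withinM|apply: withinM; [exact: within_cst|exact: withinM]].
  by apply/funext => x; case: (f x) (g x) => ? ? [] ? ? /=; ring.
rewrite (_ : (fun x => _) = (fun x => complex.Re (f x) * complex.Im (g x)
    + complex.Im (f x) * complex.Re (g x))).
  by apply: withinD; exact: withinM.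
by apply/funext => x; case: (f x) (g x) => ? ? [] ? ? /=; ring.
Qed.

Lemma ccont_cst (k : C) : ccont (fun=> k).
Proof. by split; exact: within_cst. Qed.

Lemma ccont_real (f : R -> R) : {within I, continuous f} -> ccont (fun x => (f x)%:C).
Proof. by move=> cf; split => //; exact: within_cst. Qed.

Lemma ccont_horner (p : {poly C}) : ccont (fun x => p.[x%:C]).
Proof.
elim/poly_ind: p => [|p k IH].
  by rewrite (_ : (fun x => _) = (fun=> 0)); [exact: ccont_cst|apply/funext => x; rewrite horner0].
rewrite (_ : (fun x => _) = (fun x => p.[x%:C] * x%:C + k)); last first.
  by apply/funext => x; rewrite hornerMXaddC.
apply: ccontD; last exact: ccont_cst.
apply: ccontM => //; apply: (@ccont_real id).
by apply: continuous_subspaceT => x; exact: cvg_id.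
Qed.

Lemma eq_cintegral (f g : R -> C) : (forall x, I x -> f x = g x) -> cintegral f = cintegral g.
Proof.
move=> fg; rewrite /cintegral.
by congr (_ +i* _); apply: eq_Rintegral => x; rewrite inE => /fg ->.
Qed.

Lemma cintegral_lin (h : C) f g : ccont f -> ccont g ->
  cintegral (fun x => h * f x + g x) = h * cintegral f + cintegral g.
Proof.
move=> [fr fi] [gr gi]; case: h => u v; rewrite /cintegral.
have HW k (t : R -> R) : {within I, continuous t} -> {within I, continuous (fun x => k * t x)}.
  by move=> ct; apply: withinM => //; exact: within_cst.
apply/eqP; rewrite eq_complex /=; apply/andP; split; apply/eqP.
  transitivity (\int[mu]_(x in I) (u * complex.Re (f x) + (- v * complex.Im (f x) + complex.Re (g x))))%R.
    by apply: eq_Rintegral => x _; case: (f x) (g x) => ? ? [] ? ? /=; ring.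
  by rewrite !intI_lin //; [ring|apply: withinD => //; exact: HW].
transitivity (\int[mu]_(x in I) (u * complex.Im (f x) + (v * complex.Re (f x) + complex.Im (g x))))%R.
  by apply: eq_Rintegral => x _; case: (f x) (g x) => ? ? [] ? ? /=; ring.
by rewrite !intI_lin //; [ring|apply: withinD => //; exact: HW].
Qed.

Lemma cintegral_real (f : R -> R) : cintegral (fun x => (f x)%:C) = (\int[mu]_(x in I) f x)%R%:C.
Proof. by rewrite /cintegral /= Rintegral_cst ?mul0r. Qed.

End ComplexIntegral.

Section Density.
Variables (R : realType) (q : R).
Hypotheses (q_gt0 : 0 < q) (q_lt1 : q < 1).
Local Notation C := (cplx R).
Local Notation mu := (@lebesgue_measure R).
Local Notation I := ([set` `[(-1)%R, 1%R]] : set R).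
Variables a b c d : R.
Hypotheses (a1 : `|a| < 1) (b1 : `|b| < 1) (c1 : `|c| < 1) (d1 : `|d| < 1).

(** The factor (1 - z^2) (1 - z^-2) = 4 (1 - x^2), split off the numerator, meets 2 pi sqrt (1 -
    x^2) in the denominator; hence the square root upstairs and the constant 2 / pi. *)
Lemma aw_densityE x : I x ->
  aw_density q a b c d x = (2 / pi * aw_rdens q a b c d x)%:C.
Proof.
move=> /in_I x1; have z0 := circ_neq0 x1.
have q1 : `|q| <= 1 by rewrite ger0_norm // ltW.
have zx := circDV x1.
transitivity ((qpinf q%:C (circ x ^+ 2) * qpinf q%:C (circ x ^- 2)
  / (qpinf q%:C (a%:C * circ x) * qpinf q%:C (a%:C / circ x)
     * (qpinf q%:C (b%:C * circ x) * qpinf q%:C (b%:C / circ x))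
     * (qpinf q%:C (c%:C * circ x) * qpinf q%:C (c%:C / circ x))
     * (qpinf q%:C (d%:C * circ x) * qpinf q%:C (d%:C / circ x))))
  / (2 * pi * Num.sqrt (1 - x ^+ 2))%:C : C); first exact: erefl.
move: (circ x) z0 zx => z z0 zx.
have P : qpinf q%:C (q%:C * z ^+ 2) * qpinf q%:C (q%:C / z ^+ 2)
    = (azinf q q (2 * x ^+ 2 - 1))%:C :> C.
  apply: cqpinf_pair => //; first by rewrite expf_neq0.
  have -> : z ^+ 2 + (z ^+ 2)^-1 = (z + (z)^-1) ^+ 2 - 2 by field.
  by rewrite zx -rmorphXn -[2%:R : C](rmorph_nat (real_complex R)) -rmorphB; congr (_%:C); ring.
have ha := cqpinf_pair q_gt0 q_lt1 (ltW a1) z0 zx.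
have hb := cqpinf_pair q_gt0 q_lt1 (ltW b1) z0 zx.
have hc := cqpinf_pair q_gt0 q_lt1 (ltW c1) z0 zx.
have hd := cqpinf_pair q_gt0 q_lt1 (ltW d1) z0 zx.
have W : (1 - z ^+ 2) * (1 - z ^- 2) = (4 * (1 - x ^+ 2))%:C :> C.
  transitivity (4 - (z + z^-1) ^+ 2 : C); first by field.
  by rewrite zx -rmorphXn -[4%:R : C](rmorph_nat (real_complex R)) -rmorphB; congr (_%:C); ring.
have HU : qpinf q%:C (z ^+ 2) * qpinf q%:C (z ^- 2)
    = (4 * (1 - x ^+ 2) * azinf q q (2 * x ^+ 2 - 1))%:C :> C.
  have E1 := etrans (cqpinfSl q_gt0 q_lt1 (z ^+ 2))
    (congr1 (fun t => (1 - z ^+ 2) * qpinf q%:C t) (mulrC _ _)).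
  have E2 := etrans (cqpinfSl q_gt0 q_lt1 (z ^- 2))
    (congr1 (fun t => (1 - z ^- 2) * qpinf q%:C t) (mulrC _ _)).
  by apply: (etrans (f_equal2 *%R E1 E2)); rewrite mulrACA W P -rmorphM.
have aux (u u' A A' B B' E E' D D' k : C) : u = u' -> A = A' -> B = B' -> E = E' -> D = D' ->
  u / (A * B * E * D) / k = u' / (A' * B' * E' * D') / k by do 5 move=> ->.
apply: (etrans (aux _ _ _ _ _ _ _ _ _ _ _ HU ha hb hc hd)).
rewrite -!rmorphM -!fmorph_div; congr (_%:C).
rewrite /aw_rdens /aw_kernel.
have h0 : 0 <= 1 - x ^+ 2 by rewrite subr_ge0 -real_normK ?num_real // exprn_ile1.
rewrite -[in X in 4 * X](sqr_sqrtr h0).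
set y := Num.sqrt _; set E := azinf q q _; set D := azinf q a x * _ * _ * _.
(* At the end points the left side is 0 / 0 = 0 and the right side is 0. *)
have [->|y0] := eqVneq y 0; first by rewrite expr2 !mulr0 !mul0r ?mulr0 ?mul0r.
have D0 : D != 0 by rewrite gt_eqF // !mulr_gt0 ?azinf_gt0.
have pi0 : pi != 0 :> R by rewrite gt_eqF // pi_gt0.
by move: (pi : R) pi0 => pp pp0; field; rewrite y0 D0 pp0.
Qed.

Section Weighted.
Variables (k : nat) (y : 'I_k -> R).
Hypothesis y_gt1 : forall j, 1 < `|y j|.

Definition krall_cont (f : {poly C}) : C :=
  cintegral (fun x => f.[x%:C] * aw_density q a b c d x / (\prod_j (x - y j))%:C).

Let prod0 x : I x -> \prod_j (x - y j) != 0.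
Proof.
move=> /in_I x1; apply/prodf_neq0 => j _; rewrite subr_eq0; apply/eqP => xy.
by move: (y_gt1 j); rewrite -xy ltNge x1.
Qed.

Let rho x := 2 / pi * aw_rdens q a b c d x / \prod_j (x - y j).

Let rho_cont : {within I, continuous rho}.
Proof.
apply: withinM.
  by apply: withinM; [exact: within_cst|exact: aw_rdens_continuous].
apply: continuous_in_subspaceT => x; rewrite inE => Ix.
apply: (@cvgV _ _ (nbhs x) _ (fun x => \prod_j (x - y j))); first exact: prod0.
have E : horner (\prod_j ('X - (y j)%:P)) = (fun x => \prod_j (x - y j)).
  by apply/funext => z; rewrite horner_prod; apply: eq_bigr => j _; rewrite hornerXsubC.
have cp : continuous (horner (\prod_j ('X - (y j)%:P))) by move=> z; exact: continuous_horner.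
by rewrite E in cp; exact: cp.
Qed.

Let krallE f : krall_cont f = cintegral (fun x => f.[x%:C] * (rho x)%:C).
Proof.
apply: eq_cintegral => x Ix; rewrite aw_densityE //.
have -> : (rho x)%:C = (2 / pi * aw_rdens q a b c d x)%:C / (\prod_j (x - y j))%:C :> C.
  by rewrite -fmorph_div.
by rewrite [RHS]mulrA.
Qed.

Lemma krall_cont_lin (h : C) f g : krall_cont (h *: f + g) = h * krall_cont f + krall_cont g.
Proof.
have H p : ccont (fun x => p.[x%:C] * (rho x)%:C).
  by apply: ccontM; [exact: ccont_horner|exact: ccont_real].
rewrite !krallE -cintegral_lin //.
by congr cintegral; apply/funext => x; rewrite hornerD hornerZ mulrDl mulrA.
Qed.

Lemma krall_cont_real (p : {poly R}) :
  krall_cont (map_poly (real_complex R) p * \prod_j ('X - (y j)%:C%:P))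
  = (2 / pi * rL q a b c d (horner p))%:C.
Proof.
rewrite krallE /rL -RintegralZl //; last first.
  apply: integrable_I; apply: withinM; [exact: within_horner|exact: aw_rdens_continuous].
rewrite -cintegral_real; apply: eq_cintegral => x Ix.
rewrite hornerM horner_prod horner_map /rho.
have -> : \prod_j ('X - (y j)%:C%:P).[x%:C] = (\prod_j (x - y j))%:C :> C.
  by rewrite rmorph_prod; apply: eq_bigr => j _; rewrite hornerXsubC rmorphB.
have n0 := prod0 Ix.
have pi0 : pi != 0 :> R by rewrite gt_eqF // pi_gt0.
by rewrite -!rmorphM; congr (_%:C); move: (pi : R) pi0 => pp pp0; field; rewrite n0 pp0.
Qed.

End Weighted.
End Density.

(** * Darboux transforms of orthogonal polynomials over a field *)

Section Interpolation.
Variables (F : fieldType) (k : nat) (y : 'I_k -> F).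
Hypothesis y_inj : injective y.

Definition nodal : {poly F} := \prod_j ('X - (y j)%:P).
Definition conodal (j : 'I_k) : {poly F} := \prod_(i | i != j) ('X - (y i)%:P).
Definition bary (j : 'I_k) : F := (conodal j).[y j]^-1.

Lemma conodalM j : conodal j * ('X - (y j)%:P) = nodal.
Proof. by rewrite /nodal (bigD1 j) //= mulrC. Qed.

Lemma size_nodal : size nodal = k.+1.
Proof. by have := size_prod_XsubC (enum 'I_k) y; rewrite big_enum size_enum_ord. Qed.

Lemma conodal_monic j : conodal j \is monic.
Proof. by apply: monic_prod => i _; exact: monicXsubC. Qed.

Lemma size_conodal j : size (conodal j) = k.
Proof.
have := size_nodal; rewrite -(conodalM j) size_Mmonic ?monicXsubC //; last first.
  by rewrite monic_neq0 // conodal_monic.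
by rewrite size_XsubC addn2 /= => -[].
Qed.

Lemma conodal_eval i j : (conodal j).[y i] = (conodal j).[y j] *+ (i == j).
Proof.
have [->//|ij] := eqVneq i j.
by rewrite /conodal horner_prod (bigD1 i) //= hornerXsubC subrr mul0r.
Qed.

Lemma conodal_neq0 j : (conodal j).[y j] != 0.
Proof.
rewrite /conodal horner_prod; apply/prodf_neq0 => i ij.
by rewrite hornerXsubC subr_eq0 (inj_eq y_inj) eq_sym.
Qed.

Lemma nodal_eval j : nodal.[y j] = 0.
Proof. by rewrite -(conodalM j) hornerM hornerXsubC subrr mulr0. Qed.

Lemma small_eq0 (p : {poly F}) : (size p <= k)%N -> (forall j, p.[y j] = 0) -> p = 0.
Proof.
move=> sp py; apply/eqP; apply: contraTT sp => p0; rewrite -ltnNge.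
have := max_poly_roots (rs := [seq y j | j <- enum 'I_k]) p0.
rewrite size_map size_enum_ord; apply.
  by apply/allP => _ /mapP[j _ ->]; apply/eqP/py.
by rewrite map_inj_uniq // enum_uniq.
Qed.

Lemma interp (f : {poly F}) :
  f = f %/ nodal * nodal + \sum_j (bary j * f.[y j]) *: conodal j.
Proof.
rewrite {1}(divp_eq f nodal); congr (_ + _); apply/eqP; rewrite -subr_eq0; apply/eqP.
apply: small_eq0.
  rewrite (leq_trans (size_polyD _ _)) // geq_max size_polyN; apply/andP; split.
    by rewrite -ltnS -size_nodal ltn_modp -size_poly_eq0 size_nodal.
  apply: (leq_trans (size_sum _ _ _)); apply/bigmax_leqP => j _; rewrite (leq_trans (size_scale_leq _ _)) // size_conodal //.
move=> i; rewrite hornerD hornerN horner_sum (bigD1 i) //= big1 => [|j ji].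
  rewrite addr0 hornerZ /bary mulrAC mulVf ?conodal_neq0 // mul1r.
  by rewrite {2}(divp_eq f nodal) hornerD hornerM nodal_eval mulr0 add0r subrr.
by rewrite hornerZ conodal_eval eq_sym (negbTE ji) mulr0n mulr0.
Qed.

(** The left side is the divided difference of f at all nodes. Each [conodal] is monic of degree k -
    1, so it is read off the Lagrange formula as the coefficient of X^(k-1). *)
Lemma bary_sum (f : {poly F}) : (size f <= k)%N -> (0 < k)%N ->
  \sum_j bary j * f.[y j] = f`_k.-1.
Proof.
move=> sf k0; rewrite {2}(interp f) divp_small; last by rewrite size_nodal ltnS.
rewrite mul0r add0r coef_sum; apply: eq_bigr => j _; rewrite coefZ.
by have := conodal_monic j; rewrite monicE lead_coefE size_conodal => /eqP->; rewrite mulr1.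
Qed.

End Interpolation.

(** * From solutions of the recurrence to orthogonality *)

Section Core.
Variables (F : fieldType) (k : nat) (y : 'I_k -> F).
Hypothesis y_inj : injective y.
Local Notation nodal := (nodal y).
Local Notation conodal := (conodal y).
Local Notation bary := (bary y).

Variable T : {poly F} -> F.
Hypothesis T_lin : forall h f g, T (h *: f + g) = h * T f + T g.

Variables A B C D : int -> F.
(** The guard matters: A(0) contains 1 - abcd / q^2, which vanishes when ad = bc = q. The bound k <
    alpha + l excludes this as soon as k > 0. *)
Hypothesis A_neq0 : (0 < k)%N -> forall n : nat, A n != 0.
Hypothesis A_N1 : A (-1) = 0.
Hypothesis C_neq0 : forall n : int, - k%:Z < n -> C n != 0.
Hypothesis D_neq0 : forall n : int, - k%:Z < n -> D n != 0.

Variable P : nat -> {poly F}.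
Hypothesis sizeP : forall n, size (P n) = n.+1.
Hypothesis recP : forall n : nat,
  D n.+1 *: ('X * P n.+1) = A n.+1 *: P n.+2 + B n.+1 *: P n.+1 + C n.+1 *: P n.
Hypothesis recP0 : D 0 *: ('X * P 0) = A 0 *: P 1 + B 0 *: P 0.

(* [T] integrates against dmu / prod_j (x - y_j), so [Lfun] integrates
   against mu and [stieltjes] is the function of the second kind at y_j. *)
Definition Lfun f := T (f * nodal).
Hypothesis L_P : forall n, Lfun (P n.+1) = 0.
Hypothesis L_P0 : Lfun (P 0) != 0.

Lemma T0 : T 0 = 0.
Proof. by have := T_lin (-1) 0 0; rewrite scaler0 addr0 mulN1r addNr. Qed.
Lemma TZ h f : T (h *: f) = h * T f.
Proof. by have := T_lin h f 0; rewrite !addr0 T0 addr0. Qed.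
Lemma TD f g : T (f + g) = T f + T g.
Proof. by have := T_lin 1 f g; rewrite scale1r mul1r. Qed.
Lemma T_sum I (r : seq I) (Q : pred I) (f : I -> {poly F}) :
  T (\sum_(i <- r | Q i) f i) = \sum_(i <- r | Q i) T (f i).
Proof. exact: (big_morph T TD T0). Qed.

Lemma LZ h f : Lfun (h *: f) = h * Lfun f.
Proof. by rewrite /Lfun -scalerAl TZ. Qed.
Lemma LD f g : Lfun (f + g) = Lfun f + Lfun g.
Proof. by rewrite /Lfun mulrDl TD. Qed.

Lemma drop1_split (f : {poly F}) : f = drop_poly 1 f * 'X + (f`_0)%:P.
Proof.
rewrite -{1}(poly_take_drop 1 f) expr1 addrC; congr (_ + _).
by apply/polyP => i; rewrite coef_take_poly coefC; case: i.
Qed.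

Lemma LM n (g : {poly F}) : D n.+1 * Lfun (P n.+1 * (g * 'X)) =
  A n.+1 * Lfun (P n.+2 * g) + B n.+1 * Lfun (P n.+1 * g) + C n.+1 * Lfun (P n * g).
Proof.
have -> : D n.+1 * Lfun (P n.+1 * (g * 'X)) = Lfun (D n.+1 *: ('X * P n.+1) * g).
  by rewrite -LZ; congr Lfun; rewrite -scalerAl; congr (_ *: _); ring.
by rewrite recP !mulrDl -!scalerAl !LD !LZ.
Qed.

(** The recurrence trades one factor X of f for the neighbours of P_n; after peeling off all of
    them, only L(P_i) with i > 0 occurs. *)
Lemma L_orth m n (f : {poly F}) : (size f <= m)%N -> (m <= n)%N -> Lfun (P n * f) = 0.
Proof.
elim: m n f => [|m IH] n f.
  by rewrite leqn0 size_poly_eq0 => /eqP-> _; rewrite /Lfun mulr0 mul0r T0.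
case: n => // n sf mn.
rewrite (drop1_split f) mulrDr.
have sg : (size (drop_poly 1 f) <= m)%N by rewrite size_drop_poly; lia.
set g := drop_poly 1 f in sg *.
have -> : Lfun (P n.+1 * (g * 'X) + P n.+1 * (f`_0)%:P) = Lfun (P n.+1 * (g * 'X)).
  by rewrite LD [X in _ + Lfun X]mulrC mul_polyC LZ L_P mulr0 addr0.
have D0 : D n.+1 != 0 by apply: D_neq0; lia.
apply: (mulfI D0); rewrite LM mulr0 !IH ?mulr0 ?addr0 //; lia.
Qed.

(** The same peeling, in top degree, descends from P_n to P_0 and collects the factors C(i) / D(i),
    none of which is zero. *)
Lemma L_neq0 n (f : {poly F}) : size f = n.+1 -> Lfun (P n * f) != 0.
Proof.
elim: n f => [|n IH] f sf.
  have /size_poly1P[c c0 ->] : size f == 1 by rewrite sf.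
  by rewrite mulrC mul_polyC LZ mulf_neq0.
rewrite (drop1_split f) mulrDr.
have sg : size (drop_poly 1 f) = n.+1 by rewrite size_drop_poly sf subn1.
set g := drop_poly 1 f in sg *.
have -> : Lfun (P n.+1 * (g * 'X) + P n.+1 * (f`_0)%:P) = Lfun (P n.+1 * (g * 'X)).
  by rewrite LD [X in _ + Lfun X]mulrC mul_polyC LZ L_P mulr0 addr0.
have D0 : D n.+1 != 0 by apply: D_neq0; lia.
suff : D n.+1 * Lfun (P n.+1 * (g * 'X)) != 0 by rewrite mulf_eq0 negb_or => /andP[].
have o2 : Lfun (P n.+2 * g) = 0 by apply: (L_orth (m := n.+1)); rewrite ?sg.
have o1 : Lfun (P n.+1 * g) = 0 by apply: (L_orth (m := n.+1)); rewrite ?sg.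
have cn : C n.+1 != 0 by apply: C_neq0; lia.
by rewrite LM o2 o1 !mulr0 !add0r mulf_neq0 // IH.
Qed.

Definition stieltjes j f := T (f * conodal j).

Lemma stieltjesZ j h f : stieltjes j (h *: f) = h * stieltjes j f.
Proof. by rewrite /stieltjes -scalerAl TZ. Qed.

Lemma stieltjesD j f g : stieltjes j (f + g) = stieltjes j f + stieltjes j g.
Proof. by rewrite /stieltjes mulrDl TD. Qed.

(** The error term L(f) vanishes for f = P_n with n > 0, so the functions of the second kind satisfy
    the recurrence for n > 0 and miss it at n = 0 by D(0) L(P_0). *)
Lemma stieltjesX j f : stieltjes j ('X * f) = y j * stieltjes j f + Lfun f.
Proof.
rewrite -[RHS]addrC /Lfun -(conodalM y j) -TZ -TD; congr T.
by rewrite -mul_polyC; ring.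
Qed.

Lemma k_gt0 (j : 'I_k) : (0 < k)%N. Proof. exact: leq_ltn_trans (ltn_ord j). Qed.

Lemma rec_uniq j (u : nat -> F) :
  (forall n : nat, D n.+1 * y j * u n.+1 = A n.+1 * u n.+2 + B n.+1 * u n.+1 + C n.+1 * u n) ->
  D 0 * y j * u 0 = A 0 * u 1 + B 0 * u 0 ->
  forall n, u n = u 0 / (P 0).[y j] * (P n).[y j].
Proof.
move=> h h0.
have p0 : (P 0).[y j] != 0.
  have s0 : size (P 0) == 1 by rewrite sizeP.
  by have /size_poly1P[c c0 ->] := s0; rewrite hornerC.
set t := u 0 / _.
have H n : u n = t * (P n).[y j] /\ u n.+1 = t * (P n.+1).[y j].
  elim: n => [|n [IH1 IH2]].
    split; first by rewrite /t divfK.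
    apply: (mulfI (A_neq0 (k_gt0 j) 0)).
    have := congr1 (horner^~ (y j)) recP0; rewrite /= hornerD !hornerZ hornerM hornerX => h1.
    have -> : A 0 * u 1 = D 0 * y j * u 0 - B 0 * u 0 by rewrite h0 addrK.
    have -> : A 0 * (t * (P 1).[y j]) = t * (A 0 * (P 1).[y j] + B 0 * (P 0).[y j]) - t * B 0 * (P 0).[y j] by ring.
    by rewrite -h1 /t; field.
  split=> //; apply: (mulfI (A_neq0 (k_gt0 j) n.+1)).
  have := congr1 (horner^~ (y j)) (recP n); rewrite /= !hornerD !hornerZ hornerM hornerX => h1.
  have -> : A n.+1 * u n.+2 = D n.+1 * y j * u n.+1 - B n.+1 * u n.+1 - C n.+1 * u n.
    by rewrite h; ring.
  have -> : A n.+1 * (t * (P n.+2).[y j]) = t * (A n.+1 * (P n.+2).[y j] + B n.+1 * (P n.+1).[y j]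
    + C n.+1 * (P n).[y j]) - t * B n.+1 * (P n.+1).[y j] - t * C n.+1 * (P n).[y j] by ring.
  by rewrite -h1 IH1 IH2; ring.
by move=> n; have [] := H n.
Qed.

Section Seeds.
Variable Phi : 'I_k -> int -> F.
Hypothesis recPhi : forall j n, - k%:Z < n ->
  D n * y j * Phi j n = A n * Phi j (n + 1) + B n * Phi j n + C n * Phi j (n - 1).

(** Determined at n = 0: the defect D(0) L(P_0) of [stieltjes], times this constant, has to cancel
    C(0) Phi_j(-1). *)
Definition scaleK j := - (C 0 * Phi j (-1)) / (D 0 * Lfun (P 0)).

(** With this scale the difference of the two sequences solves the homogeneous recurrence started at
    n = 0, hence is a multiple of P_n(y_j). *)
Lemma Phi_stieltjes j : Phi j (-1) != 0 -> exists theta, forall n : nat,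
  Phi j n = scaleK j * (stieltjes j (P n) + theta * (P n).[y j]).
Proof.
move=> p0; have k0 := k_gt0 j.
have c0 : C 0 != 0 by apply: C_neq0; lia.
have d0 : D 0 != 0 by apply: D_neq0; lia.
have K0 : scaleK j != 0 by rewrite mulf_neq0 ?oppr_eq0 ?invr_eq0 ?mulf_neq0.
pose u n := Phi j n%:Z - scaleK j * stieltjes j (P n).
exists (u 0 / (P 0).[y j] / scaleK j) => n.
suff : u n = u 0 / (P 0).[y j] * (P n).[y j].
  rewrite /u => /eqP; rewrite subr_eq => /eqP->; field.
  rewrite K0; have /size_poly1P[c c1 ->] : size (P 0) == 1 by rewrite sizeP.
  by rewrite hornerC c1.
apply: rec_uniq => [{}n|].
  have := recPhi j (n := n.+1); rewrite -addn1 PoszD addrK -!PoszD addn1 => /(_ ltac:(lia)).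
  have : stieltjes j (D n.+1 *: ('X * P n.+1)) =
    stieltjes j (A n.+1 *: P n.+2 + B n.+1 *: P n.+1 + C n.+1 *: P n) by rewrite recP.
  rewrite !(stieltjesD, stieltjesZ) stieltjesX L_P addr0.
  rewrite addn1 /u => h1 h2.
  have -> : D n.+1 * y j * (Phi j n.+1 - scaleK j * stieltjes j (P n.+1))
    = D n.+1 * y j * Phi j n.+1 - scaleK j * (D n.+1 * (y j * stieltjes j (P n.+1))) by ring.
  by rewrite h1 h2; ring.
have := recPhi j (n := 0); rewrite add0r sub0r => /(_ ltac:(lia)) h2.
have : stieltjes j (D 0 *: ('X * P 0)) =
    stieltjes j (A 0 *: P 1 + B 0 *: P 0) by rewrite recP0.
rewrite !(stieltjesD, stieltjesZ) stieltjesX => h1.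
rewrite /u.
have -> : D 0 * y j * (Phi j 0 - scaleK j * stieltjes j (P 0))
    = D 0 * y j * Phi j 0 - scaleK j * (D 0 * (y j * stieltjes j (P 0) + Lfun (P 0)))
      + scaleK j * (D 0 * Lfun (P 0)) by ring.
have KE : scaleK j * (D 0 * Lfun (P 0)) = - (C 0 * Phi j (-1)).
  by rewrite /scaleK divfK ?mulf_neq0.
rewrite h1 h2 KE; ring.
Qed.

(* Running the recurrence backwards from n = -1, where A vanishes:
   Phi_j(-i-1) = Phi_j(-1) b_i(y_j) with b_i = (back i).1 of degree i. *)
Fixpoint back (i : nat) : {poly F} * {poly F} :=
  if i is i'.+1 then
    ((C (- i%:Z))^-1 *: ((D (- i%:Z) *: 'X - (B (- i%:Z))%:P) * (back i').1
       - A (- i%:Z) *: (back i').2), (back i').1)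
  else (1, 0).

Lemma backE i : (i < k)%N -> size (back i).1 = i.+1 /\ (size (back i).2 <= i)%N /\
  (forall j, Phi j (- (i.+1)%:Z) = Phi j (-1) * (back i).1.[y j]) /\
  (forall j, (0 < i)%N -> Phi j (- i%:Z) = Phi j (-1) * (back i).2.[y j]).
Proof.
elim: i => [|i IH] ik.
  split; first by rewrite size_poly1.
  split; first by rewrite size_poly0.
  by split=> // j; rewrite /= hornerE mulr1.
have [s1 [s2 [e1 e2]]] := IH (ltnW ik).
have d0 : D (- i.+1%:Z) != 0 by apply: D_neq0; lia.
have c0 : C (- i.+1%:Z) != 0 by apply: C_neq0; lia.
have sX : size (D (- i.+1%:Z) *: 'X - (B (- i.+1%:Z))%:P) = 2.
  rewrite size_polyDl size_scale ?size_polyX // size_polyN.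
  by rewrite (leq_ltn_trans (size_polyC_leq1 _)).
split.
  rewrite /= size_scale ?invr_eq0 // size_polyDl.
    by rewrite size_mul ?s1 ?sX // -size_poly_eq0 ?sX ?s1.
  rewrite size_polyN size_mul ?s1 ?sX // -?size_poly_eq0 ?sX ?s1 //.
  by rewrite (leq_ltn_trans (size_scale_leq _ _)) // (leq_ltn_trans s2) //; lia.
split; first by rewrite /= s1.
split=> j; last by rewrite /= e1.
apply: (mulfI c0).
have := recPhi j (n := - i.+1%:Z) ltac:(lia).
have -> : - i.+1%:Z - 1 = - i.+2%:Z by lia.
have -> : - i.+1%:Z + 1 = - i%:Z by lia.
move=> h; have {h} -> : C (- i.+1%:Z) * Phi j (- i.+2%:Z) = D (- i.+1%:Z) * y j * Phi j (- i.+1%:Z)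
   - A (- i.+1%:Z) * Phi j (- i%:Z) - B (- i.+1%:Z) * Phi j (- i.+1%:Z) by rewrite h; ring.
rewrite e1 /= hornerZ !(hornerD, hornerM, hornerN, hornerZ, hornerX, hornerC).
(* For i = 0 the recurrence is read at n = -1, where A = 0 removes Phi_j(0), a value not controlled
   by Phi_j(-1). *)
case: i {IH ik s1 s2} e1 e2 c0 d0 sX => [|i] e1 e2 c0 d0 sX.
  by rewrite A_N1; field.
by rewrite e2 //; field.
Qed.

(** The last row, which would carry the polynomials, is filled with zeros: only cofactors along it
    are taken. *)
Definition coef_mx (n : int) : 'M[F]_k.+1 :=
  \matrix_(i, l) oapp (fun i' => Phi i' (n - (l : nat)%:Z)) 0 (unlift ord_max i).

Definition dcoef (n : int) (l : 'I_k.+1) : F := cofactor (coef_mx n) ord_max l.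

Definition dtau (n : int) : F := \det (\matrix_(i < k, j < k) Phi i (n - (j : nat)%:Z)).

(** The sum is the expansion along the last row of a determinant whose last row repeats row j. *)
Lemma dcoef_rel n j : \sum_l dcoef n l * Phi j (n - (l : nat)%:Z) = 0.
Proof.
pose M : 'M[F]_k.+1 := \matrix_(i, l) Phi (odflt j (unlift ord_max i)) (n - (l : nat)%:Z).
transitivity (\det M); last first.
  apply: (@determinant_alternate _ _ _ (lift ord_max j) ord_max).
    by rewrite eq_sym neq_lift.
  by move=> l; rewrite !mxE liftK unlift_none.
rewrite (expand_det_row _ ord_max); apply: eq_bigr => l _.
rewrite mxE unlift_none /= mulrC; congr (_ * _).
rewrite /dcoef /cofactor; congr (_ * \det _); apply/matrixP => i i'.
by rewrite !mxE liftK.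
Qed.

(** The two extreme cofactors are tau_n, up to sign tau_{n-1}: the first multiplies P_{n-k} and
    decides the norms, the second multiplies P_n and decides the degree. *)
Lemma dcoef_max n : dcoef n ord_max = dtau n.
Proof.
rewrite /dcoef /cofactor /= -signr_odd oddD addbb expr0 mul1r.
congr (\det _); apply/matrixP => i j; rewrite !mxE liftK /=.
by congr (Phi _ (_ - _%:Z)); rewrite /bump leqNgt ltn_ord.
Qed.

Lemma dcoef0 n : dcoef n ord0 = (-1) ^+ k * dtau (n - 1).
Proof.
rewrite /dcoef /cofactor /= addn0.
congr (_ * \det _); apply/matrixP => i j; rewrite !mxE liftK /=.
by congr Phi; rewrite /bump leq0n; lia.
Qed.

Definition dpoly (n : nat) : {poly F} := \sum_(l < k.+1 | (l <= n)%N) dcoef n l *: P (n - l).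

Hypothesis dtau_neq0 : forall n : int, -1 <= n -> dtau n != 0.

(** Running backwards, every entry of row j of tau_{-1} is a multiple of Phi_j(-1). *)
Lemma Phi_N1_neq0 j : Phi j (-1) != 0.
Proof.
apply/eqP => h; have := dtau_neq0 (lexx _); rewrite /dtau (expand_det_row _ j) big1 ?eqxx //.
move=> l _; rewrite mxE.
have [_ [_ [e _]]] := backE (ltn_ord l).
have -> : -1 - (l : nat)%:Z = - l.+1%:Z by lia.
by rewrite e h !mul0r.
Qed.

Lemma size_dpoly n : size (dpoly n) = n.+1.
Proof.
rewrite /dpoly (bigD1 ord0) //= subn0 size_polyDl.
  by rewrite size_scale ?sizeP // dcoef0 mulf_neq0 ?signr_eq0 // dtau_neq0 //; lia.
rewrite size_scale ?sizeP; last by rewrite dcoef0 mulf_neq0 ?signr_eq0 // dtau_neq0 //; lia.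
rewrite ltnS; apply: (leq_trans (size_sum _ _ _)); apply/bigmax_leqP => l /andP[ln l0].
rewrite (leq_trans (size_scale_leq _ _)) // sizeP.
have : (0 < l)%N by rewrite lt0n; apply: contra l0 => /eqP l00; apply/eqP/val_inj.
by lia.
Qed.

Variable theta : 'I_k -> F.
Hypothesis Phi_theta : forall j (n : nat),
  Phi j n = scaleK j * (stieltjes j (P n) + theta j * (P n).[y j]).

Definition krall f := T f + \sum_j (theta j * bary j) * f.[y j].

(** This is the ratio of Phi_j(-1) to [scaleK]. It does not depend on j, and so the contributions of
    negative indices can be summed over the nodes. *)
Let kappa := - (D 0 * Lfun (P 0)) / C 0.

(** The part of f divisible by [nodal] cancels the denominator of the measure and vanishes at the
    nodes; the Lagrange remainder meets [T] and the point masses node by node. *)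
Lemma kralllamE g f : krall (g * f) = Lfun (g * (f %/ nodal))
  + \sum_j (bary j * f.[y j]) * (stieltjes j g + theta j * g.[y j]).
Proof.
rewrite /krall {1}(interp y_inj f) mulrDr TD mulrA -addrA; congr (_ + _).
rewrite mulr_sumr T_sum -big_split /=; apply: eq_bigr => j _.
by rewrite -scalerAr TZ hornerM /stieltjes; ring.
Qed.

(* The cofactors annihilate the full window Phi_j(n), ..., Phi_j(n-k); the part
   of the window at negative indices is polynomial in y_j. *)
Lemma lam_dpoly n j : stieltjes j (dpoly n) + theta j * (dpoly n).[y j] =
  - kappa * \sum_(l < k.+1 | (n < l)%N) dcoef n l * (back (l - n.+1)).1.[y j].
Proof.
have k0 := k_gt0 j.
have c0 : C 0 != 0 by apply: C_neq0; lia.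
have d0 : D 0 != 0 by apply: D_neq0; lia.
have p0 := Phi_N1_neq0 j.
have K0 : scaleK j != 0 by rewrite mulf_neq0 ?oppr_eq0 ?invr_eq0 ?mulf_neq0.
apply: (mulfI K0).
have -> : scaleK j * (stieltjes j (dpoly n) + theta j * (dpoly n).[y j])
  = \sum_(l < k.+1 | (l <= n)%N) dcoef n l * Phi j (n%:Z - (l : nat)%:Z).
  rewrite /dpoly /stieltjes mulr_suml T_sum horner_sum mulr_sumr -big_split /= mulr_sumr.
  apply: eq_bigr => l ln; rewrite subzn // Phi_theta -scalerAl TZ hornerZ /stieltjes; ring.
have := dcoef_rel n j; rewrite (bigID (fun l : 'I_k.+1 => (l <= n)%N)) /=.
move/eqP; rewrite addr_eq0 => /eqP->.
rewrite !mulr_sumr -sumrN; apply: eq_big => [l|l nl]; first by rewrite ltnNge.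
rewrite -ltnNge in nl.
have lk : (l - n.+1 < k)%N by have := ltn_ord l; lia.
have [_ [_ [e _]]] := backE lk.
have -> : n%:Z - (l : nat)%:Z = - (l - n.+1).+1%:Z by lia.
rewrite e /kappa /scaleK; field.
by rewrite c0 d0 L_P0.
Qed.

Lemma kappa_neq0 : (0 < k)%N -> kappa != 0.
Proof.
move=> k0.
have c0 : C 0 != 0 by apply: C_neq0; lia.
have d0 : D 0 != 0 by apply: D_neq0; lia.
by rewrite /kappa mulf_neq0 ?oppr_eq0 ?invr_eq0 ?mulf_neq0.
Qed.

(** For n >= k no window index is negative, the sum over nodes is zero, and only tau_n L(P_{n-k} (f
    %/ nodal)) survives. For n < k the quotient f %/ nodal is zero, and the sum over nodes extracts
    the coefficient of X^(k-1) from f b_{l-n-1}; the degree deg f + l - n - 1 reaches k - 1 only for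
    l = k and deg f = n. *)
Lemma krall_dpoly n (f : {poly F}) : (size f <= n.+1)%N ->
  (krall (dpoly n * f) == 0) = (size f <= n)%N.
Proof.
move=> sf; rewrite kralllamE.
have nd0 : nodal != 0 by rewrite -size_poly_eq0 size_nodal.
have [kn|nk] := leqP k n.
  rewrite [X in _ + X]big1 ?addr0; last first.
    move=> j _; rewrite lam_dpoly big_pred0 ?mulr0 // => l.
    by apply/negbTE; rewrite -leqNgt (leq_trans _ kn) // -ltnS.
  set h := f %/ nodal.
  have sh : size h = (size f - k)%N by rewrite size_divp // size_nodal.
  have E : Lfun (dpoly n * h) = dtau n * Lfun (P (n - k) * h).
    transitivity (\sum_(l < k.+1 | (l <= n)%N) dcoef n l * Lfun (P (n - l) * h)).
      rewrite {1}/Lfun /dpoly !mulr_suml T_sum; apply: eq_bigr => l _.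
      by rewrite -!scalerAl TZ.
    rewrite (bigD1 ord_max) //= dcoef_max big1 ?addr0 // => l /andP[ln lk].
    rewrite (L_orth (m := n - l)) ?mulr0 //.
    rewrite sh; have : (l < k)%N by rewrite ltn_neqAle -ltnS ltn_ord andbT.
    by move=> ?; lia.
  rewrite E mulf_eq0 (negbTE (dtau_neq0 _)) /=; last by lia.
  have [fn|nf] := leqP (size f) n.
    by rewrite (L_orth (m := n - k)) ?eqxx // sh leq_sub2r.
  by apply/negbTE; apply: L_neq0; rewrite sh; lia.
have k0 : (0 < k)%N by lia.
rewrite divp_small ?size_nodal ?(leq_ltn_trans sf) // mulr0 {1}/Lfun mul0r T0 add0r.
under eq_bigr do rewrite lam_dpoly.
have -> : \sum_j bary j * f.[y j] * (- kappa * \sum_(l < k.+1 | (n < l)%N)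
     dcoef n l * (back (l - n.+1)).1.[y j])
  = - kappa * \sum_(l < k.+1 | (n < l)%N) dcoef n l * (f * (back (l - n.+1)).1)`_k.-1.
  under eq_bigr do rewrite mulrCA mulr_sumr.
  rewrite -mulr_sumr exchange_big /=; congr (_ * _); apply: eq_bigr => l nl.
  rewrite -(bary_sum y_inj) //; last first.
    have lk : (l - n.+1 < k)%N by have := ltn_ord l; lia.
    have [s1 _] := backE lk.
    rewrite (leq_trans (size_mul_leq _ _)) // s1; have := ltn_ord l; lia.
  rewrite mulr_sumr; apply: eq_bigr => j _; rewrite hornerM; ring.
rewrite mulf_eq0 oppr_eq0 (negbTE (kappa_neq0 k0)) /=.
rewrite (bigD1 ord_max) //= [X in _ + X]big1 ?addr0; last first.
  move=> l /andP[nl lk]; have {}lk : (l < k)%N by rewrite ltn_neqAle -ltnS ltn_ord andbT.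
  have lk' : (l - n.+1 < k)%N by lia.
  have [s1 _] := backE lk'.
  rewrite nth_default ?mulr0 // (leq_trans (size_mul_leq _ _)) // s1; lia.
rewrite mulf_eq0 dcoef_max (negbTE (dtau_neq0 _)) /=; last by lia.
have lk' : (k - n.+1 < k)%N by lia.
have [s1 _] := backE lk'.
have b0 : (back (k - n.+1)).1 != 0 by rewrite -size_poly_eq0 s1.
have [fn|nf] := leqP (size f) n.
  by rewrite nth_default ?eqxx // (leq_trans (size_mul_leq _ _)) // s1; lia.
have sfE : size f = n.+1 by apply/eqP; rewrite eqn_leq sf.
have f0 : f != 0 by rewrite -size_poly_eq0 sfE.
have -> : k.-1 = (size (f * (back (k - n.+1)).1)).-1 by rewrite size_mul // s1 sfE; lia.
by rewrite -lead_coefE lead_coef_eq0 mulf_eq0 (negbTE f0) (negbTE b0).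
Qed.

Lemma krall_orth n m : n <> m -> krall (dpoly n * dpoly m) = 0.
Proof.
have H i j : (j < i)%N -> krall (dpoly i * dpoly j) = 0.
  by move=> ji; apply/eqP; rewrite krall_dpoly ?size_dpoly // ltnW.
by move=> nm; have [mn|mn|mn] := ltngtP m n; [exact: H|rewrite mulrC; exact: H|case: nm].
Qed.

Lemma krall_norm n : krall (dpoly n * dpoly n) != 0.
Proof. by rewrite krall_dpoly ?size_dpoly // ltnn. Qed.

End Seeds.
Section Deformation.
Variables Phi1 Phi2 : 'I_k -> int -> F.
Hypothesis recPhi1 : forall j n, - k%:Z < n ->
  D n * y j * Phi1 j n = A n * Phi1 j (n + 1) + B n * Phi1 j n + C n * Phi1 j (n - 1).
Hypothesis recPhi2 : forall j n, - k%:Z < n ->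
  D n * y j * Phi2 j n = A n * Phi2 j (n + 1) + B n * Phi2 j n + C n * Phi2 j (n - 1).
Hypothesis Phi1_N1 : forall j, Phi1 j (-1) != 0.
Hypothesis Phi2_N1 : forall j, Phi2 j (-1) = 0.
Hypothesis Phi2_0 : forall j, Phi2 j 0 != 0.

Lemma deformation : exists u v : 'I_k -> F, (forall j, u j != 0) /\
  forall (nu : 'I_k -> F) j (n : nat), Phi1 j n + (u j * nu j + v j) * Phi2 j n =
    scaleK (fun i m => Phi1 i m + (u i * nu i + v i) * Phi2 i m) j
    * (stieltjes j (P n) + nu j / bary j * (P n).[y j]).
Proof.
have [th H] : exists th : 'I_k -> F, forall j (n : nat),
    Phi1 j n = scaleK Phi1 j * (stieltjes j (P n) + th j * (P n).[y j]).
  apply: (@fin_all_exists _ _ (fun j x => forall n : nat,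
    Phi1 j n = scaleK Phi1 j * (stieltjes j (P n) + x * (P n).[y j]))) => j.
  exact: Phi_stieltjes.
have p0 j : (P 0).[y j] != 0.
  have s0 : size (P 0) == 1 by rewrite sizeP.
  by have /size_poly1P[c c0 ->] := s0; rewrite hornerC.
have K0 j : scaleK Phi1 j != 0.
  have k0 := k_gt0 j.
  have c0 : C 0 != 0 by apply: C_neq0; lia.
  have d0 : D 0 != 0 by apply: D_neq0; lia.
  by rewrite mulf_neq0 ?oppr_eq0 ?invr_eq0 ?mulf_neq0.
pose mu j := Phi2 j 0 / (P 0).[y j].
have E2 j (n : nat) : Phi2 j n = mu j * (P n).[y j].
  apply: (rec_uniq (u := fun n : nat => Phi2 j n)) => [{}n|].
    have k0 := k_gt0 j.
    have := recPhi2 j (n := n.+1); rewrite -addn1 PoszD addrK -!PoszD !addn1 => -> //; lia.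
  have k0 := k_gt0 j.
  by have := recPhi2 j (n := 0); rewrite add0r sub0r Phi2_N1 mulr0 addr0 => -> //; lia.
have mu0 j : mu j != 0 by rewrite mulf_neq0 ?invr_eq0.
have b0 j : bary j != 0 by rewrite invr_eq0 conodal_neq0.
(* The coefficient c_j = u_j nu_j + v_j solves th_j + c_j mu_j / K_j = nu_j / bary_j, where
   Phi2_j(n) = mu_j P_n(y_j). *)
exists (fun j => scaleK Phi1 j / (mu j * bary j)), (fun j => - scaleK Phi1 j * th j / mu j); split.
  by move=> j; apply: mulf_neq0; rewrite ?K0 // invr_eq0; apply: mulf_neq0.
move=> nu j n.
set Phi := fun i m => _.
have -> : scaleK Phi j = scaleK Phi1 j by rewrite /scaleK /Phi Phi2_N1 mulr0 addr0.
rewrite E2 H; field; rewrite ?mu0 ?b0 //.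
Qed.

End Deformation.
End Core.

(** * The seed functions *)

Section Gauge.
Variables (R : realType) (q : R).
Hypothesis q0 : q != 0.

Section Coefs.
Variables a b c d : R.
Local Notation e := (a * b * c * d).

(* The coefficients of the recurrence in the gauge where p_n is multiplied by
   xi^a_n. *)
Definition gaugeA (N : R) : R := a / q * (1 - b * c * N) * (1 - b * d * N) * (1 - c * d * N)
  * (1 - q * N) * (1 - e * N ^+ 2 / q ^+ 2).

Definition gaugeC (N : R) : R := q / a * (1 - e * N / q ^+ 2) * (1 - a * b * N / q)
  * (1 - a * c * N / q) * (1 - a * d * N / q) * (1 - e * N ^+ 2).

Definition gaugeB (N : R) : R :=
  (a + a^-1) * recD q a b c d N - recA q a b c d N - recC q a b c d N.

Definition gauge_sol (Y : R) (U : R -> R) := forall N, N != 0 ->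
  2 * recD q a b c d N * Y * U N =
  gaugeA N * U (q * N) + gaugeB N * U N + gaugeC N * U (N / q).

End Coefs.

(** A trace of the symmetry of the Askey-Wilson polynomials in their parameters; it permits writing
    the recurrence around d in place of a. *)
Lemma gaugeB_perm a b c d N : a != 0 -> d != 0 -> gaugeB a b c d N = gaugeB d a b c N.
Proof.
move=> a0 d0; rewrite /gaugeB /recD /recA /recC.
by field; rewrite q0 a0 d0.
Qed.

Definition Lam (e N : R) : R := (N^-1 - 1) * (1 - e / q * N).

(** Identities between seeds are proved in N = q^n for all N != 0. A polynomial in lambda is built
    from N^-1 + e N / q, which is invariant under N -> q / (e N). *)
Definition polyfun (e : R) (f : R -> R) := exists p : {poly R}, forall N, N != 0 -> f N = p.[Lam e N].

Lemma polyfunM e f g : polyfun e f -> polyfun e g -> polyfun e (fun N => f N * g N).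
Proof. by move=> [p hp] [r hr]; exists (p * r) => N N0; rewrite hornerM hp ?hr. Qed.

Lemma polyfun_sum e n f : (forall i, polyfun e (f i)) -> polyfun e (fun N => \sum_(0 <= i < n) f i N).
Proof.
move=> h; elim: n => [|n [p hp]]; first by exists 0 => N _; rewrite big_geq // horner0.
have [r hr] := h n; exists (p + r) => N N0.
by rewrite big_nat_recr //= hornerD hp ?hr.
Qed.

Lemma polyfun_prod e n f : (forall i, polyfun e (f i)) -> polyfun e (fun N => \prod_(0 <= i < n) f i N).
Proof.
move=> h; elim: n => [|n [p hp]]; first by exists 1 => N _; rewrite big_geq // hornerC.
have [r hr] := h n; exists (p * r) => N N0.
by rewrite big_nat_recr //= hornerM hp ?hr.
Qed.

Lemma polyfun_lin e h k : polyfun e (fun N => h * (N^-1 + e / q * N) + k).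
Proof.
exists (h *: ('X + (1 + e / q)%:P) + k%:P) => N N0.
by rewrite hornerD hornerZ hornerD hornerX !hornerC /Lam; field; rewrite q0.
Qed.

Section Seeds.
Variables (a b c d : R) (alpha l m : nat).
Local Notation e := (a * b * c * d).
Hypotheses (q_gt0 : 0 < q) (q_lt1 : q < 1).
Hypotheses (d0 : d != 0) (aE : a = d * q ^+ alpha) (d2 : d ^+ 2 = q ^+ l).
Hypotheses (l_gt0 : (0 < l)%N) (m_lt : (m < alpha)%N).
Hypotheses (ab : a * b < 0) (ac : a * c < 0) (bd : b * d < 0) (cd : c * d < 0).

Let z := d * q ^+ m.
Definition seed_node := (z + z^-1) / 2.

(* u^{1,m} is the truncated sum with parameters q/a, q/b, q/c, q/d at 1/(qN), and
   u^{2,m} is a gauge factor times the sum with [d] in the role of [a]. *)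
Definition seed1 (N : R) : R :=
  aw_sum q (q / a) (q / b) (q / c) (q / d) seed_node (alpha - m) (q * N)^-1.

(** Up to a constant this is xi^a_n (ad, bd, cd; q)_n / d^n. Because ad = q^(alpha+l), the quotients
    (ad; q)_n / (q; q)_n and (abcd/q; q)_n / (bc; q)_n collapse to alpha + l - 1 factors each, which
    leaves a Laurent polynomial in q^n. *)
Definition pref (N : R) : R :=
  qpoch q (b * c * N) (alpha + l - 1) * qpoch q (q * N) (alpha + l - 1) / N ^+ (alpha + l - 1).

Definition seed2 (N : R) : R := pref N * aw_sum q d a b c seed_node m.+1 N.

Let a0 : a != 0. Proof. by rewrite aE mulf_neq0 ?expf_neq0. Qed.
Let b0 : b != 0. Proof. by apply: contraTneq ab => ->; rewrite mulr0 ltxx. Qed.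
Let c0 : c != 0. Proof. by apply: contraTneq ac => ->; rewrite mulr0 ltxx. Qed.
Let z0 : z != 0. Proof. by rewrite mulf_neq0 ?expf_neq0. Qed.
Let adE : a * d = q ^+ (alpha + l).
Proof. by rewrite aE mulrAC -expr2 d2 -exprD addnC. Qed.

Let neg_neq0 (u : R) i : u < 0 -> 1 - u * q ^+ i != 0.
Proof.
move=> u0; rewrite gt_eqF // subr_gt0 (lt_trans (y := 0)) //.
by rewrite pmulr_llt0 // exprn_gt0.
Qed.

Lemma azpoch_node A j : (azpoch q A j).[seed_node] = qpoch q (A * z) j * qpoch q (A / z) j.
Proof. by rewrite /seed_node azpochE. Qed.

Lemma qpoch_eq0 (u : R) i j : (i < j)%N -> u * q ^+ i = 1 -> qpoch q u j = 0.
Proof.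
move=> ij h; rewrite /qpoch (big_cat_nat _ (n := i)) //=; last exact: ltnW.
by rewrite (@big_ltn _ _ _ i) // h subrr mul0r mulr0.
Qed.

(** The factor of index alpha - m - 1 vanishes: (q / a) z q^(alpha-m-1) = 1 for z = d q^m. *)
Lemma azpoch_seed1 j : (alpha - m <= j)%N -> (azpoch q (q / a) j).[seed_node] = 0.
Proof.
move=> mj; rewrite azpoch_node (@qpoch_eq0 _ (alpha - m).-1) ?mul0r //; first by move: m_lt mj; clear; lia.
rewrite /z aE; have -> : alpha = (m + (alpha - m).-1.+1)%N by move: m_lt; clear; lia.
have -> : (m + (alpha - m).-1.+1 - m).-1 = (alpha - m).-1 by rewrite addKn.
by rewrite exprD exprS; field; rewrite !expf_neq0 ?d0 ?q0.
Qed.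

Lemma azpoch_seed2 j : (m < j)%N -> (azpoch q d j).[seed_node] = 0.
Proof.
move=> mj; rewrite azpoch_node (@qpoch_eq0 (d / z) m) ?mulr0 //.
by rewrite /z; field; rewrite expf_neq0 // d0.
Qed.

(** The substitution of q/a, q/b, q/c, q/d, 1/(q N) for a, b, c, d, N reverses the direction of the
    recurrence: up to the common factor - (e N^2 / q)^3 it keeps [recD] and turns [recA] into
    [gaugeC] and [recC] into [gaugeA]. *)
Lemma seed1_sol : gauge_sol a b c d seed_node seed1.
Proof.
move=> N N0; rewrite /seed1; have [n nE] : exists n, (alpha - m = n.+1)%N.
  by exists (alpha - m).-1; rewrite prednK // subn_gt0.
have N0' : (q * N)^-1 != 0 by rewrite invr_eq0 mulf_neq0.
have nz j : (j < n)%N -> [/\ 1 - q / a * (q / b) * q ^+ j != 0, 1 - q / a * (q / c) * q ^+ j != 0,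
     1 - q / a * (q / d) * q ^+ j != 0 & 1 - q * q ^+ j != 0].
  move=> jn; split.
  - apply: neg_neq0; rewrite mulf_div pmulr_rlt0 ?mulr_gt0 ?invr_lt0 //.
  - apply: neg_neq0; rewrite mulf_div pmulr_rlt0 ?mulr_gt0 ?invr_lt0 //.
  (* Here (q/a) (q/d) q^j = q^(2 + j - alpha - l) with 2 + j <= alpha - m < alpha + l, so this power
     of q exceeds 1. *)
  - rewrite mulf_div adE -expr2 mulrAC -exprD.
    have -> : (alpha + l = (2 + j) + (alpha + l - 2 - j).-1.+1)%N.
      by move: m_lt nE jn l_gt0; clear; lia.
    rewrite (exprD q (2 + j)) invfM mulrA mulfV ?expf_neq0 // mul1r subr_eq0 eq_sym invr_eq1.
    by rewrite lt_eqF // exprn_ilt1 // ltW.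
  - by rewrite -exprS subr_eq0 eq_sym lt_eqF // exprn_ilt1 // ltW.
have qa0 : q / a != 0 by rewrite mulf_neq0 ?invr_eq0.
have := @aw_sum_rec R q (q / a) (q / b) (q / c) (q / d) seed_node n _ q0 qa0 N0' nz.
rewrite -nE azpoch_seed1 // mulr0 !mul0r subr0.
have -> : q * (q * N)^-1 = (q * (N / q))^-1 by field; rewrite N0 q0.
have -> : (q * N)^-1 / q = (q * (q * N))^-1 by field; rewrite N0 q0.
move: (aw_sum _ _ _ _ _ _ _ _) (aw_sum _ _ _ _ _ _ _ (q * (N / q))^-1)
  (aw_sum _ _ _ _ _ _ _ (q * (q * N))^-1) => S Sm Sp H.
pose X := e * N ^+ 2.
have X0 : X != 0 by rewrite /X !mulf_neq0 ?expf_neq0.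
have := congr1 (fun t => - (X / q) ^+ 3 * t) H.
have E1 : - (X / q) ^+ 3 * recD q (q / a) (q / b) (q / c) (q / d) (q * N)^-1 = recD q a b c d N.
  by rewrite /recD /X; field; rewrite q0 a0 b0 c0 d0 N0.
have E2 : - (X / q) ^+ 3 * recA q (q / a) (q / b) (q / c) (q / d) (q * N)^-1 = gaugeC a b c d N.
  by rewrite /recA /gaugeC /X; field; rewrite q0 a0 b0 c0 d0 N0.
have E3 : - (X / q) ^+ 3 * recC q (q / a) (q / b) (q / c) (q / d) (q * N)^-1 = gaugeA a b c d N.
  by rewrite /recC /gaugeA /X; field; rewrite q0 a0 b0 c0 d0 N0.
have E4 : (q / a + (q / a)^-1) * recD q a b c d N - gaugeC a b c d N - gaugeA a b c d N
   = gaugeB a b c d N.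
  by rewrite /gaugeB /gaugeA /gaugeC /recA /recC /recD; field; rewrite q0 a0.
rewrite -E4 -E1 -E2 -E3 => h.
transitivity (- (X / q) ^+ 3 * (2 * seed_node * recD q (q / a) (q / b) (q / c) (q / d) (q * N)^-1 * S)).
  by ring.
by rewrite h; ring.
Qed.

Let r := (alpha + l - 1)%N.
Let rE : q ^+ r.+1 = a * d. Proof. by rewrite adE /r; congr (_ ^+ _); move: m_lt; clear; lia. Qed.

Lemma prefS N : N != 0 ->
  pref (q * N) * (1 - b * c * N) * (1 - q * N) * q ^+ r = pref N * (1 - e * N / q) * (1 - a * d * N).
Proof.
move=> N0; rewrite /pref -/r.
have h1 : (1 - b * c * N) * qpoch q (b * c * (q * N)) r = qpoch q (b * c * N) r * (1 - e * N / q).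
  have -> : b * c * (q * N) = b * c * N * q by ring.
  rewrite -qpochSl qpochS; congr (_ * (1 - _)).
  have -> : e = q ^+ r.+1 * b * c by rewrite rE; ring.
  by rewrite exprS; field.
have h2 : (1 - q * N) * qpoch q (q * (q * N)) r = qpoch q (q * N) r * (1 - a * d * N).
  have -> : q * (q * N) = q * N * q by ring.
  by rewrite -qpochSl qpochS -rE exprS; congr (_ * (1 - _)); ring.
rewrite exprMn.
transitivity (((1 - b * c * N) * qpoch q (b * c * (q * N)) r) * ((1 - q * N) * qpoch q (q * (q * N)) r)
  / N ^+ r); first by field; rewrite !expf_neq0.
by rewrite h1 h2; ring.
Qed.

(** The sum around d satisfies the ungauged recurrence; [pref] carries it to the gauge of xi^a, its
    shift being given by [prefS]. *)
Lemma seed2_sol : gauge_sol a b c d seed_node seed2.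
Proof.
move=> N N0; rewrite /seed2.
have nz j : (j < m)%N -> [/\ 1 - d * a * q ^+ j != 0, 1 - d * b * q ^+ j != 0,
     1 - d * c * q ^+ j != 0 & 1 - q * q ^+ j != 0].
  move=> jm; split; last by rewrite -exprS subr_eq0 eq_sym lt_eqF // exprn_ilt1 // ltW.
  - rewrite mulrC [d * a]mulrC adE -exprD subr_eq0 eq_sym lt_eqF // exprn_ilt1 ?(ltW q_gt0) //.
    by move: l_gt0; clear; lia.
  - by apply: neg_neq0; rewrite mulrC.
  - by apply: neg_neq0; rewrite mulrC.
have := @aw_sum_rec R q d a b c seed_node m N q0 d0 N0 nz.
rewrite azpoch_seed2 // mulr0 !mul0r subr0 -/(gaugeB d a b c N) -gaugeB_perm //.
move: (aw_sum _ _ _ _ _ _ _ N) (aw_sum _ _ _ _ _ _ _ (N / q))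
  (aw_sum _ _ _ _ _ _ _ (q * N)) => S Sm Sp H.
have qr0 : q ^+ r != 0 by rewrite expf_neq0.
have ar : a = q ^+ r * q / d by rewrite -exprSr rE mulfK.
have E1 : gaugeA a b c d N * pref (q * N) = recA q d a b c N * pref N.
  apply: (mulIf qr0).
  transitivity (a / q * (1 - b * d * N) * (1 - c * d * N) * (1 - e * N ^+ 2 / q ^+ 2)
    * (pref (q * N) * (1 - b * c * N) * (1 - q * N) * q ^+ r)); first by rewrite /gaugeA; ring.
  rewrite prefS // /recA.
  transitivity ((q ^+ r * q / d) / q * (1 - b * d * N) * (1 - c * d * N) * (1 - e * N ^+ 2 / q ^+ 2)
    * (pref N * (1 - e * N / q) * (1 - a * d * N))); first by rewrite -ar.
  by move: (q ^+ r) => Q; field; rewrite q0 d0.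
have E2 : gaugeC a b c d N * pref (N / q) = recC q d a b c N * pref N.
  apply: (mulIf qr0); have := prefS (N := N / q) ltac:(by rewrite mulf_neq0 ?invr_eq0).
  have -> : q * (N / q) = N by rewrite mulrC divfK.
  move=> h.
  transitivity (d * (1 - N) * (1 - a * b * N / q) * (1 - a * c * N / q) * (1 - b * c * N / q)
  * (1 - e * N ^+ 2) * pref N * q ^+ r); last by rewrite /recC; ring.
  transitivity (d * (1 - a * b * N / q) * (1 - a * c * N / q) * (1 - e * N ^+ 2)
     * (pref N * (1 - b * c * (N / q)) * (1 - N) * q ^+ r)); last by ring.
  rewrite h /gaugeC.
  have -> : q / a = d / q ^+ r.
    by rewrite {1}ar; field; rewrite q0 d0 qr0.
  by move: (pref _) => PP; field; rewrite q0 qr0.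
have D1 : recD q d a b c N = recD q a b c d N by rewrite /recD; have -> : d * a * b * c = e by ring.
rewrite D1 in H.
transitivity (pref N * (2 * seed_node * recD q a b c d N * S)); first by ring.
rewrite H.
transitivity (recA q d a b c N * pref N * Sp + gaugeB a b c d N * (pref N * S) + recC q d a b c N * pref N * Sm);
  first by ring.
by rewrite -E1 -E2; ring.
Qed.

Lemma aw_sum1 (A B C D x : R) J : aw_sum q A B C D x J.+1 1 = 1.
Proof.
rewrite /aw_sum big_nat_recl // big1 ?addr0.
  by rewrite /aw_term !qpoch0 azpoch0 expr0; field.
move=> i _; rewrite /aw_term invr1 (@qpoch_eq0 1 0) ?mul0r //.
by rewrite expr0 mulr1.
Qed.

(** At N = 1 / q the sum is taken at 1 / (q N) = 1, where all terms but the first vanish. *)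
Lemma seed1_N1 : seed1 q^-1 = 1.
Proof.
rewrite /seed1 mulfV // invr1; have -> : (alpha - m = (alpha - m).-1.+1)%N by rewrite prednK // subn_gt0.
exact: aw_sum1.
Qed.

(** [pref] contains the factor 1 - q N, as alpha + l - 1 > 0. *)
Lemma seed2_N1 : seed2 q^-1 = 0.
Proof.
rewrite /seed2 /pref mulfV // (@qpoch_eq0 1 0) ?mulr0 ?mul0r //; first by move: m_lt l_gt0; clear; lia.
by rewrite expr0 mulr1.
Qed.

Lemma seed2_0 : `|b * c| < 1 -> seed2 1 != 0.
Proof.
move=> bc1; rewrite /seed2 aw_sum1 mulr1 /pref expr1n invr1 !mulr1.
rewrite mulf_neq0 //; apply: qpoch_neq0 => i _.
  rewrite subr_eq0; apply/eqP => h; have : `|b * c * q ^+ i| < 1.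
    rewrite normrM (le_lt_trans _ bc1) // ler_piMr // ger0_norm ?exprn_ge0 ?(ltW q_gt0) //.
    by rewrite exprn_ile1 // ltW.
  by rewrite -h normr1 ltxx.
by rewrite -exprS subr_eq0 eq_sym lt_eqF // exprn_ilt1 // ltW.
Qed.

Let e0 : e != 0. Proof. by rewrite !mulf_neq0. Qed.

Lemma seed1_poly : polyfun e seed1.
Proof.
rewrite /seed1 /aw_sum; apply: polyfun_sum => j; rewrite /aw_term.
set K := qpoch q _ _ * _ * _ * _.
have [p hp] : polyfun e (fun N => \prod_(0 <= i < j) (- (q ^+ i * q ^+ 2 / e) * (N^-1 + e / q * N)
     + (1 + q ^+ i * q ^+ i * q ^+ 3 / e))).
  by apply: polyfun_prod => i; exact: polyfun_lin.
exists ((q ^+ j * (azpoch q (q / a) j).[seed_node] / K) *: p) => N N0.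
rewrite hornerZ -hp // /qpoch -big_split /=.
have -> : \prod_(0 <= i < j) ((1 - (q * N)^-1^-1 * q ^+ i) *
    (1 - q / a * (q / b) * (q / c) * (q / d) / (q * N) / q * q ^+ i)) =
  \prod_(0 <= i < j) (- (q ^+ i * q ^+ 2 / e) * (N^-1 + e / q * N)
     + (1 + q ^+ i * q ^+ i * q ^+ 3 / e)).
  apply: eq_bigr => i _; move: (q ^+ i) => Q.
  by rewrite invrK; field; rewrite q0 a0 b0 c0 d0 N0.
by ring.
Qed.

(** Reversing one of the two products pairs 1 - bc N q^(r-i-1) with 1 - N q^(i+1). Divided by N,
    each pair is N^-1 + e N / q plus a constant, because e = q^(r+1) bc. *)
Lemma pref_poly : polyfun e pref.
Proof.
have [p hp] : polyfun e (fun N => \prod_(0 <= i < r) (1 * (N^-1 + e / q * N)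
     + (- (q * q ^+ i) - b * c * q ^+ (r - i.+1)))).
  by apply: polyfun_prod => i; exact: polyfun_lin.
exists p => N N0; rewrite -hp // /pref -/r /qpoch.
have -> : N ^+ r = \prod_(0 <= i < r) N by rewrite prodr_const_nat subn0.
rewrite [X in X * _ / _](big_nat_rev) /= add0n -prodfV -!big_split /=.
rewrite big_nat_cond [RHS]big_nat_cond; apply: eq_bigr => i /andP[/andP[_ ir] _].
have -> : e = q ^+ r.+1 * b * c by rewrite rE; ring.
have -> : q ^+ r.+1 = q * q * q ^+ i * q ^+ (r - i.+1).
  rewrite {1}(_ : r.+1 = (i + (r - i.+1)).+2) ?(exprS, exprD) ?mulrA //.
  by rewrite -addSn subnKC.
by move: (q ^+ i) (q ^+ (r - i.+1)) => Q1 Q2; field; rewrite q0 N0.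
Qed.

Lemma seed2_poly : polyfun e seed2.
Proof.
apply: polyfunM; first exact: pref_poly.
rewrite /aw_sum; apply: polyfun_sum => j; rewrite /aw_term.
set K := qpoch q _ _ * _ * _ * _.
have [p hp] : polyfun e (fun N => \prod_(0 <= i < j) (- q ^+ i * (N^-1 + e / q * N)
     + (1 + q ^+ i * q ^+ i * e / q))).
  by apply: polyfun_prod => i; exact: polyfun_lin.
exists ((q ^+ j * (azpoch q d j).[seed_node] / K) *: p) => N N0.
rewrite hornerZ -hp // /qpoch -big_split /=.
have -> : \prod_(0 <= i < j) ((1 - N^-1 * q ^+ i) * (1 - d * a * b * c * N / q * q ^+ i)) =
  \prod_(0 <= i < j) (- q ^+ i * (N^-1 + e / q * N) + (1 + q ^+ i * q ^+ i * e / q)).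
  apply: eq_bigr => i _; move: (q ^+ i) => Q.
  by field; rewrite q0 N0.
by ring.
Qed.

End Seeds.
End Gauge.

Lemma poly_ext (F : numDomainType) (p r : {poly F}) : (forall x, p.[x] = r.[x]) -> p = r.
Proof.
move=> h; apply/eqP; rewrite -subr_eq0; apply/negPn/negP => n0.
have := max_poly_roots (rs := [seq i%:R | i <- iota 0 (size (p - r))]) n0.
rewrite size_map size_iota ltnn => H; suff : false by [].
apply: H.
  by apply/allP => _ /mapP[i _ ->]; rewrite rootE hornerD hornerN h subrr.
by rewrite map_inj_uniq ?iota_uniq // => i j /eqP; rewrite eqr_nat => /eqP.
Qed.

(** * The Askey-Wilson polynomials as truncated sums at N = q^n *)

Section AWPoly.
Variables (R : realType) (q a b c d : R).
Hypotheses (q_gt0 : 0 < q) (q_lt1 : q < 1).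
Hypotheses (a0 : a != 0) (a1 : `|a| < 1) (b1 : `|b| < 1) (c1 : `|c| < 1) (d1 : `|d| < 1).
Local Notation e := (a * b * c * d).

Let q0 : q != 0. Proof. by rewrite gt_eqF. Qed.
Let qn1 : `|q| < 1. Proof. by rewrite ger0_norm // ltW. Qed.
Let e1 : `|e| < 1. Proof. by do 3 (apply: mul_lt1 => //). Qed.

Lemma aw_polyE' n x : (aw_poly q a b c d n).[x] =
  qpoch q (a * b) n * qpoch q (a * c) n * qpoch q (a * d) n / a ^+ n * aw_val q a b c d n x.
Proof.
rewrite /aw_poly hornerZ horner_sum; congr (_ * _); apply: eq_bigr => j _.
by rewrite hornerZ.
Qed.

(** (q^(-n); q)_j = 0 for j > n, so the sums of three consecutive degrees may share one cut in
    [aw_sum_rec]. *)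
Lemma aw_sum_stable n J x : (n < J)%N -> aw_sum q a b c d x J (q ^+ n) = aw_val q a b c d n x.
Proof.
move=> nJ; rewrite /aw_val /aw_sum (big_cat_nat _ nJ) //= [X in _ + X]big1_seq ?addr0 // => j.
rewrite mem_index_iota => /= /andP[nj _]; rewrite /aw_term.
by rewrite (qpoch_eq0 nj) ?mul0r // mulVf ?expf_neq0.
Qed.

Let nz j : [/\ 1 - a * b * q ^+ j != 0, 1 - a * c * q ^+ j != 0,
     1 - a * d * q ^+ j != 0 & 1 - q * q ^+ j != 0].
Proof. by split; apply: om_neq0 => //; exact: mul_lt1. Qed.

Lemma aw_val_rec n x :
  2 * x * recD q a b c d (q ^+ n.+1) * aw_val q a b c d n.+1 x =
    recA q a b c d (q ^+ n.+1) * aw_val q a b c d n.+2 x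
    + gaugeB q a b c d (q ^+ n.+1) * aw_val q a b c d n.+1 x
    + recC q a b c d (q ^+ n.+1) * aw_val q a b c d n x.
Proof.
have := @aw_sum_rec R q a b c d x n.+2 _ q0 a0 (expf_neq0 n.+1 q0) (fun j _ => nz j).
rewrite (@qpoch_eq0 _ _ _ n.+1) ?mulVf ?expf_neq0 // mul0r !mulr0 !mul0r subr0.
have -> : q ^+ n.+1 / q = q ^+ n by rewrite exprS mulrAC mulfV // mul1r.
by rewrite -exprS !aw_sum_stable ?ltnS ?leqW ?leqnn // => ->; rewrite /gaugeB.
Qed.

Lemma aw_val_rec0 x :
  2 * x * recD q a b c d 1 * aw_val q a b c d 0 x =
    recA q a b c d 1 * aw_val q a b c d 1 x + gaugeB q a b c d 1 * aw_val q a b c d 0 x.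
Proof.
have := @aw_sum_rec R q a b c d x 1 1 q0 a0 (oner_neq0 _) (fun j _ => nz j).
rewrite (@qpoch_eq0 _ _ _ 0) ?invr1 ?expr0 ?mulr1 // mul0r !mulr0 !mul0r subr0.
have cz : recC q a b c d 1 = 0 by rewrite /recC subrr mulr0 !mul0r.
rewrite cz mul0r addr0.
have s0 := @aw_sum_stable 0 2 x isT; have s1 := @aw_sum_stable 1 2 x isT.
by rewrite expr0 in s0; rewrite expr1 in s1; rewrite s0 s1 /gaugeB cz => ->.
Qed.

Lemma size_azpoch j : size (azpoch q a j) = j.+1.
Proof.
elim: j => [|j IH]; first by rewrite /azpoch big_geq // size_poly1.
have s2 : size ((1 + (a * q ^+ j) ^+ 2)%:P - (2 * (a * q ^+ j)) *: 'X) = 2.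
  rewrite addrC size_polyDl size_polyN size_scale ?size_polyX ?mulf_neq0 ?expf_neq0 ?pnatr_eq0 //.
  by rewrite (leq_ltn_trans (size_polyC_leq1 _)).
rewrite /azpoch big_nat_recr //= -/(azpoch q a j) size_mul -?size_poly_eq0 ?IH ?s2 //.
by rewrite addn2.
Qed.

Lemma size_aw_poly n : size (aw_poly q a b c d n) = n.+1.
Proof.
have nzq u m : `|u| < 1 -> qpoch q u m != 0 by move=> u1; apply: qpoch_neq0 => i _; exact: om_neq0.
rewrite /aw_poly size_scale; last first.
  by rewrite !mulf_neq0 ?invr_eq0 ?expf_neq0 ?nzq ?mul_lt1.
rewrite big_nat_recr //= addrC.
set S0 := \sum_(0 <= j < n) _; set cn := _ * _ in |- *.
have s0 : (size S0 <= n)%N.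
  apply: (leq_trans (size_sum _ _ _)); apply/bigmax_leqP_seq => j.
  rewrite mem_index_iota => /= jn _.
  by rewrite (leq_trans (size_scale_leq _ _)) // size_azpoch.
have cn0 : cn != 0.
  have h1 : qpoch q (q ^- n) n != 0.
    apply: qpoch_neq0 => i i_n; rewrite subr_eq0 eq_sym.
    have -> : q ^- n * q ^+ i = (q ^+ (n - i))^-1.
      by rewrite -{1}(subnK (ltnW i_n)) exprD invfM mulfVK ?expf_neq0.
    by rewrite invr_eq1 lt_eqF // exprn_ilt1 ?(ltW q_gt0) // -lt0n subn_gt0.
  have h2 : qpoch q (e * q ^+ n / q) n != 0.
    case: (n) => [|n']; first by rewrite qpoch0 oner_neq0.
    apply: nzq; rewrite exprS [q * _]mulrC mulrA mulfK // normrM (le_lt_trans _ e1) // ler_piMr //.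
    by rewrite ger0_norm ?exprn_ge0 ?(ltW q_gt0) // exprn_ile1 // ltW.
  by rewrite /cn !mulf_neq0 ?invr_eq0 ?mulf_neq0 ?expf_neq0 ?h1 ?h2 ?nzq ?mul_lt1.
by rewrite size_polyDl size_scale ?size_azpoch // ltnS.
Qed.

End AWPoly.

Section RealPowers.
Variables (R : realType) (q : R).
Hypothesis q_gt0 : 0 < q.

Lemma qpowD x y : q `^ (x + y) = q `^ x * q `^ y.
Proof. by rewrite powRD // (gt_eqF q_gt0) implybT. Qed.

Lemma qpowB x y : q `^ (x - y) = q `^ x / q `^ y.
Proof. by rewrite qpowD powRN. Qed.

Lemma qpow_nat n : q `^ n%:R = q ^+ n.
Proof. by rewrite powR_mulrn // ltW. Qed.

Lemma qpow1 : q `^ 1 = q. Proof. by rewrite powRr1 // ltW. Qed.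

Lemma qpow_neq0 x : q `^ x != 0.
Proof. by rewrite gt_eqF // powR_gt0. Qed.

Lemma lambdaE a b c d g : lambda q a b c d g = Lam q (a * b * c * d) (q `^ g).
Proof.
have q0 : q != 0 by rewrite gt_eqF.
rewrite /lambda /Lam powRN qpowB qpow1; congr (_ * _).
by field.
Qed.

End RealPowers.

Lemma phi43_term (R : realType) (q a1 a2 a3 a4 b1 b2 b3 : R) J :
  (forall j, (J <= j)%N -> qpoch q a1 j * qpoch q a2 j * qpoch q a3 j * qpoch q a4 j = 0) ->
  phi43 q a1 a2 a3 a4 b1 b2 b3 = \sum_(0 <= j < J)
    (qpoch q a1 j * qpoch q a2 j * qpoch q a3 j * qpoch q a4 j)
    / (qpoch q b1 j * qpoch q b2 j * qpoch q b3 j * qpoch q q j) * q ^+ j.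
Proof.
move=> h; apply/cvg_lim => //; apply: cvg_near_cst; near=> N.
have JN : (J <= N)%N by near: N; exact: nbhs_infty_ge.
rewrite (big_cat_nat _ JN) //= [X in _ + X]big1_seq ?addr0 // => j.
by rewrite mem_index_iota => /= /andP[Jj _]; rewrite h // !mul0r.
Unshelve. all: by end_near. Qed.

Section SeedFunctions.
Variables (R : realType) (q : R).
Hypotheses (q_gt0 : 0 < q) (q_lt1 : q < 1).
Variables (a b c d : R) (alpha l m : nat).
Hypotheses (b0 : b != 0) (c0 : c != 0).
Hypotheses (d0 : d != 0) (aE : a = d * q ^+ alpha) (d2 : d ^+ 2 = q ^+ l).
Hypotheses (m_lt : (m < alpha)%N).

Let q0 : q != 0. Proof. by rewrite gt_eqF. Qed.

Lemma u1E g : u1 q a b c d alpha m g = seed1 q a b c d alpha m (q `^ g).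
Proof.
have N0 := qpow_neq0 q_gt0 g.
have a0 : a != 0 by rewrite aE mulf_neq0 ?expf_neq0.
rewrite /u1; set a1 := q `^ _; set a2 := q `^ _ / _.
have E1 : a1 = q / a * (d * q ^+ m).
  rewrite /a1 !qpowD // powRN !qpow_nat // qpow1 // aE; field.
  by rewrite d0 expf_neq0.
have E2 : a2 = q / a / (d * q ^+ m).
  rewrite /a2 !qpowD // powRN !qpow_nat // qpow1 // aE; field.
  by rewrite d0 !expf_neq0.
have az j : (azpoch q (q / a) j).[seed_node q d m] = qpoch q a1 j * qpoch q a2 j.
  by rewrite azpoch_node // E1 E2.
rewrite (@phi43_term _ _ _ _ _ _ _ _ _ (alpha - m)); last first.
  by move=> j mj; rewrite -az (azpoch_seed1 q0 d0 aE m_lt mj) !mul0r.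
rewrite /seed1 /aw_sum; apply: eq_bigr => j _; rewrite /aw_term az invrK.
have -> : q `^ (g + 1) = q * q `^ g by rewrite qpowD // qpow1 // mulrC.
have -> : (a * b * c * d * q `^ (g - 2))^-1 = q / a * (q / b) * (q / c) * (q / d) / (q * q `^ g) / q.
  by rewrite qpowB // qpow_nat //; field; rewrite ?q0 ?a0 ?b0 ?c0 ?d0 ?N0.
rewrite !mulf_div -!expr2.
by move: (qpoch q a1 j) (qpoch q a2 j) => *; ring.
Qed.

Lemma u2E g : u2 q a b c d alpha l m g = seed2 q a b c d alpha l m (q `^ g).
Proof.
have N0 := qpow_neq0 q_gt0 g.
rewrite /u2 /seed2 /pref.
have -> : q `^ (g + 1) = q * q `^ g by rewrite qpowD // qpow1 // mulrC.
congr (_ * _).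
have az j : (azpoch q d j).[seed_node q d m] = qpoch q (q ^+ (m + l)) j * qpoch q (q ^- m) j.
  rewrite azpoch_node //; congr (qpoch _ _ _ * qpoch _ _ _).
    by rewrite mulrA -expr2 d2 -exprD addnC.
  by field; rewrite d0 expf_neq0.
rewrite (@phi43_term _ _ _ _ _ _ _ _ _ m.+1); last first.
  by move=> j mj; rewrite -mulrA -az (azpoch_seed2 q0 d0 mj) mulr0.
rewrite /aw_sum; apply: eq_bigr => j _; rewrite /aw_term az powRN.
have -> : a * b * c * d * q `^ (g - 1) = d * a * b * c * q `^ g / q.
  by rewrite qpowB // qpow1 //; field.
rewrite [d * a]mulrC [d * b]mulrC [d * c]mulrC.
by move: (qpoch q (q ^+ (m + l)) j) (qpoch q (q ^- m) j) => *; ring.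
Qed.

End SeedFunctions.

Lemma div_neq0 (F : fieldType) (x y : F) : x != 0 -> y != 0 -> x / y != 0.
Proof. by move=> x0 y0; rewrite mulf_neq0 ?invr_eq0. Qed.

(** * Meromorphic extension in n *)

Section RealPowerOfReal.
Variable R : realType.
Local Notation C := (cplx R).

Lemma powR_exp_continuous (x : R) : x != 0 -> continuous (fun s => x `^ s).
Proof.
move=> x0; rewrite (_ : (fun s => x `^ s) = (fun s => expR (s * ln x))); last first.
  by apply/funext => u; rewrite /powR (negbTE x0).
move=> s.
have P : u * ln x @[u --> s] --> s * ln x by apply: cvgMr_tmp; exact: cvg_id.
exact: (cvg_comp _ _ P (@continuous_expR R _)).
Qed.

Lemma rcpow_neq0 (x s : R) : x != 0 -> rcpow x s != 0.
Proof.
move=> x0; rewrite /rcpow; case: ifPn => [xge0|_].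
  by rewrite eq_complex /= eqxx andbT gt_eqF // powR_gt0 // lt_neqAle eq_sym x0.
apply: mulf_neq0; first by rewrite eq_complex /= eqxx andbT gt_eqF // powR_gt0 // normr_gt0.
rewrite eq_complex /=; apply/negP => /andP[/eqP c0 /eqP s0].
by have := cos2Dsin2 (pi * s); rewrite c0 s0 expr0n /= addr0 => /eqP; rewrite eq_sym oner_eq0.
Qed.

(** For x < 0 the principal branch contributes exp (i pi s), which changes sign when s grows by
    1. *)
Lemma rcpowS (x s : R) : x != 0 -> rcpow x (s + 1) = x%:C * rcpow x s.
Proof.
move=> x0; rewrite /rcpow; case: ifPn => [xge0|xlt0].
  by rewrite powRD ?(negbTE x0) ?implybT // powRr1 // mulrC rmorphM.
rewrite -ltNge in xlt0.
rewrite powRD ?normr_eq0 ?x0 ?implybT // powRr1 // ltr0_norm // mulrDr mulr1 cosDpi sinDpi.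
by apply/eqP; rewrite eq_complex /=; apply/andP; split; apply/eqP; ring.
Qed.

Lemma rcpow_continuous (x : R) : x != 0 -> continuous (rcpow x : R -> C).
Proof.
move=> x0 s; rewrite /rcpow; case: (0 <= x).
  by apply: cvg_real_complex; exact: powR_exp_continuous.
have h : `|x| != 0 by rewrite normr_eq0.
have P : pi * u @[u --> s] --> pi * s by apply: cvgMl_tmp; exact: cvg_id.
apply: cvgM; first by apply: cvg_real_complex; exact: powR_exp_continuous.
by apply: cvg_cplx => /=; [exact: (cvg_comp _ _ P (@continuous_cos R _))|exact: (cvg_comp _ _ P (@continuous_sin R _))].
Qed.

End RealPowerOfReal.

(** * The gauges xi^a, xi^b and their quotient *)

Section Xi.
Variables (R : realType) (q : R).
Hypotheses (q_gt0 : 0 < q) (q_lt1 : q < 1).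
Local Notation C := (cplx R).
Local Notation theta := (qpinf q).

(** A small punctured neighbourhood of an integer contains no integer, and at non-integers none of
    the infinite products used here vanishes. All cancellations take place there. *)
Definition nonint (s : R) := forall m : int, s != m%:~R.

Lemma nonintB s (j : nat) : nonint s -> nonint (s - j%:R).
Proof.
move=> gs m; have := gs (m + j%:Z); apply: contraNneq => h.
by rewrite rmorphD /= -h subrK.
Qed.

Lemma near_nonint (n : int) : \forall s \near (n%:~R : R)^', nonint s.
Proof.
have h : \forall s \near (n%:~R : R)^', `|n%:~R - s| < 1.
  by apply: nbhs_dnbhs; exact: (nbhsx_ballx (n%:~R : R) 1 ltr01).
have h' : \forall s \near (n%:~R : R)^', s != n%:~R by exact: nbhs_dnbhs_neq.
near=> s => m; apply/negP => /eqP sm.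
have : s != n%:~R by near: s.
have : `|n%:~R - s| < 1 by near: s.
rewrite sm -rmorphB /= -intr_norm -[1]/(1%:~R) ltr_int => nm /eqP; apply; congr (_%:~R).
by move: nm; clear; lia.
Unshelve. all: by end_near. Qed.

Lemma theta_pow_neq0 (x : R) : (forall i : nat, x + i%:R != 0) -> theta (q `^ x) != 0.
Proof.
move=> h; apply: qpinf_neq0 => // i; rewrite -qpow_nat // -qpowD // subr_eq0 eq_sym.
apply/eqP => h1; have := ln_powR q (x + i%:R); rewrite h1 ln1 => /esym/eqP.
by rewrite mulf_eq0 (negbTE (h i)) /= lt_eqF // ln_lt0 // q_gt0.
Qed.

Lemma theta_neg_neq0 (u s : R) : u < 0 -> theta (u * q `^ s) != 0.
Proof.
move=> u0; apply: qpinf_neq0 => // i; rewrite gt_eqF // subr_gt0 (lt_trans (y := 0)) //.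
by rewrite -mulrA pmulr_llt0 // mulr_gt0 ?exprn_gt0 ?powR_gt0.
Qed.

Lemma theta_nat_neq0 (n : nat) s : (forall i : nat, s + (n + i)%:R != 0) ->
  theta (q ^+ n * q `^ s) != 0.
Proof.
move=> h; rewrite -qpow_nat // -qpowD //; apply: theta_pow_neq0 => i.
by have := h i; rewrite natrD addrA [_ + s]addrC.
Qed.

Lemma theta_nonint_neq0 n s : nonint s -> theta (q ^+ n * q `^ s) != 0.
Proof.
move=> gs; apply: theta_nat_neq0 => i; rewrite addr_eq0.
by have := gs (- (n + i)%:Z); rewrite rmorphN.
Qed.

Lemma theta_int_neq0 (n : nat) (m : int) : 0 < n%:Z + m -> theta (q ^+ n * q `^ (m%:~R)) != 0.
Proof.
move=> h; apply: theta_nat_neq0 => i; rewrite -[(n + i)%:R]/((n + i)%:Z%:~R) -rmorphD intr_eq0.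
by apply/eqP; move: h; clear; lia.
Qed.

Lemma theta_continuous (u : R) : continuous (fun s => theta (u * q `^ s)).
Proof.
move=> s; have P : u * q `^ t @[t --> s] --> u * q `^ s.
  by apply: cvgMl_tmp; apply: powR_exp_continuous; rewrite gt_eqF.
have H := qpinf_continuous q_gt0 q_lt1 (x := u * q `^ s). 
exact: (cvg_comp _ _ P H).
Qed.

Variables a b c d : R.
Variables A1 B1 : nat.
Hypotheses (a_gt0 : 0 < a) (b_lt0 : b < 0) (c_lt0 : c < 0) (d_gt0 : 0 < d).
Hypotheses (A1_gt0 : (0 < A1)%N) (B1_gt0 : (0 < B1)%N).
Hypotheses (adE : a * d = q ^+ A1) (bcE : b * c = q ^+ B1).

Let q0 : q != 0. Proof. by rewrite gt_eqF. Qed.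
Let a0 : a != 0. Proof. by rewrite gt_eqF. Qed.
Let b0 : b != 0. Proof. by rewrite lt_eqF. Qed.

Let ac : a * c < 0. Proof. by rewrite pmulr_rlt0. Qed.
Let bd : b * d < 0. Proof. by rewrite pmulr_llt0. Qed.
Let cd : c * d < 0. Proof. by rewrite pmulr_llt0. Qed.
Let eE : a * b * c * d / q = q ^+ (A1 + B1).-1.
Proof.
have -> : a * b * c * d = (a * d) * (b * c) by ring.
by rewrite adE bcE -exprD -{1}(@prednK (A1 + B1)) ?addn_gt0 ?A1_gt0 // exprS mulrAC mulfV // mul1r.
Qed.

(** xi^a without its power of a, in infinite products. Since bd and cd are negative, only those
    whose argument is an integral power of q at integers s can vanish there. *)
Definition xi_real (s : R) : R :=
  q `^ s * (theta (a * b * c * d / q) / theta (a * b * c * d / q * q `^ s))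
  * (theta (b * c * q `^ s) / theta (b * c)) * (theta (b * d * q `^ s) / theta (b * d))
  * (theta (c * d * q `^ s) / theta (c * d)) * (theta (q * q `^ s) / theta q).

Lemma xi_aE s : xi_a q a b c d s = (xi_real s)%:C / rcpow a s.
Proof.
rewrite /xi_a /qpochr /xi_real invfM mulrA mulrAC -fmorphV -rmorphM; congr (_%:C / _).
by rewrite !invfM !invrK; ring.
Qed.

(* xi^a / xi^b after cancellation of the common factors, hence also meaningful at
   those negative integers where xi^a and xi^b vanish. *)
Definition omega (s : R) : C := rcpow b s / rcpow a s *
  (theta (a * c) * theta (a * d) / (theta (b * c) * theta (b * d))
   * (theta (b * c * q `^ s) * theta (b * d * q `^ s)
      / (theta (a * c * q `^ s) * theta (a * d * q `^ s))))%:C.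

Let th0 u : theta u = theta (u * q `^ 0).
Proof. by rewrite powRr0 mulr1. Qed.

Let tneg u : u < 0 -> theta u != 0.
Proof. by rewrite th0; exact: theta_neg_neq0. Qed.

Let tpos n : (0 < n)%N -> theta (q ^+ n) != 0.
Proof. by move=> n0; rewrite th0 -[0]/(0%:~R); apply: theta_int_neq0; rewrite addr0. Qed.

Let tbc : theta (b * c) != 0. Proof. by rewrite bcE tpos. Qed.
Let tad : theta (a * d) != 0. Proof. by rewrite adE tpos. Qed.
Let tq : theta q != 0. Proof. by rewrite -[q]expr1 tpos. Qed.
Let te : theta (a * b * c * d / q) != 0.
Proof. by rewrite eE tpos //; move: A1_gt0 B1_gt0; clear; lia. Qed.

Let xi_a_neq0_aux s : (forall n, (0 < n)%N -> theta (q ^+ n * q `^ s) != 0) ->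
  xi_a q a b c d s != 0.
Proof.
move=> tn.
rewrite xi_aE mulf_neq0 ?invr_eq0 ?rcpow_neq0 // eq_complex /= eqxx andbT /xi_real.
have t1 : theta (q * q `^ s) != 0 by have := tn 1 isT; rewrite expr1.
have t2 : theta (a * b * c * d / q * q `^ s) != 0.
  by rewrite eE; apply: tn; move: A1_gt0 B1_gt0; clear; lia.
have t3 : theta (b * c * q `^ s) != 0 by rewrite bcE tn.
have t4 := theta_neg_neq0 s bd; have t5 := theta_neg_neq0 s cd.
apply: mulf_neq0; last exact: div_neq0 t1 tq.
apply: mulf_neq0; last exact: div_neq0 t5 (tneg cd).
apply: mulf_neq0; last exact: div_neq0 t4 (tneg bd).
apply: mulf_neq0; last exact: div_neq0 t3 tbc.
by apply: mulf_neq0; [exact: qpow_neq0|exact: div_neq0].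
Qed.

Lemma xi_a_neq0 s : nonint s -> xi_a q a b c d s != 0.
Proof. by move=> gs; apply: xi_a_neq0_aux => n _; exact: theta_nonint_neq0. Qed.

Lemma xi_a_nat_neq0 (n : nat) : xi_a q a b c d n%:R != 0.
Proof.
apply: xi_a_neq0_aux => m m0; rewrite -[n%:R]/(n%:Z%:~R); apply: theta_int_neq0.
by move: m0; clear; lia.
Qed.

Lemma xi_a_nat (n : nat) : xi_a q a b c d n%:R =
  (q ^+ n * qpoch q (a * b * c * d / q) n / (a ^+ n * (qpoch q (b * c) n * qpoch q (b * d) n
    * qpoch q (c * d) n * qpoch q q n)))%:C.
Proof.
have S u : theta u = qpoch q u n * theta (u * q `^ n%:R).
  rewrite qpow_nat //; elim: n => [|n IH]; first by rewrite qpoch0 expr0 mulr1 mul1r.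
  by rewrite IH (qpinfSl q_gt0 q_lt1 (u * q ^+ n)) qpochS exprSr (mulrA u) mulrA.
have nz m : (0 < m)%N -> theta (q ^+ m * q `^ n%:R) != 0.
  by move=> m0; rewrite -[n%:R]/(n%:Z%:~R); apply: theta_int_neq0; move: m0; clear; lia.
rewrite xi_aE /rcpow (ltW a_gt0) -fmorph_div /= powR_mulrn ?(ltW a_gt0) //; congr (_%:C).
have h u : theta (u * q `^ n%:R) != 0 -> theta u / theta (u * q `^ n%:R) = qpoch q u n.
  by move=> tn0; rewrite {1}S mulfK.
have h' u : theta (u * q `^ n%:R) != 0 -> theta (u * q `^ n%:R) / theta u = (qpoch q u n)^-1.
  by move=> tn0; rewrite -invf_div h.
have t1 : theta (q * q `^ n%:R) != 0 by have := nz 1 isT; rewrite expr1.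
have t2 : theta (a * b * c * d / q * q `^ n%:R) != 0.
  by rewrite eE nz //; move: A1_gt0 B1_gt0; clear; lia.
have t3 : theta (b * c * q `^ n%:R) != 0 by rewrite bcE nz.
have t4 := theta_neg_neq0 n%:R bd; have t5 := theta_neg_neq0 n%:R cd.
rewrite /xi_real (h _ t2) (h' _ t1) (h' _ t3) (h' _ t4) (h' _ t5) qpow_nat // !invfM; ring.
Qed.

Let cneq0 (f : R -> R) s : continuous f -> {for s, continuous (fun s => (f s)%:C : C)}.
Proof. by move=> cf; apply: cvg_real_complex; exact: cf. Qed.

Lemma xi_a_continuous (n : nat) : {for n%:R, continuous (xi_a q a b c d)}.
Proof.
rewrite (_ : xi_a q a b c d = (fun s => (xi_real s)%:C / rcpow a s)); last first.
  by apply/funext => s; exact: xi_aE.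
have cr : {for n%:R, continuous xi_real}.
  have t2 : theta (a * b * c * d / q * q `^ n%:R) != 0.
    rewrite eE -[n%:R]/(n%:Z%:~R); apply: theta_int_neq0.
    by move: A1_gt0 B1_gt0; clear; lia.
  have ct u := @theta_continuous u n%:R.
  apply: cvgM; last by apply: cvgMr_tmp; exact: ct.
  apply: cvgM; last by apply: cvgMr_tmp; exact: ct.
  apply: cvgM; last by apply: cvgMr_tmp; exact: ct.
  apply: cvgM; last by apply: cvgMr_tmp; exact: ct.
  apply: cvgM; first by apply: powR_exp_continuous.
  by apply: cvgMl_tmp; apply: cvgV => //; exact: ct.
apply: cvgM; first by apply: cvg_real_complex; exact: cr.
by apply: cvgV; [exact: rcpow_neq0|exact: rcpow_continuous].
Qed.

Let omega_neq0_aux s : theta (b * c * q `^ s) != 0 -> theta (a * d * q `^ s) != 0 -> omega s != 0.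
Proof.
move=> t1 t2; apply: mulf_neq0; first by apply: div_neq0; exact: rcpow_neq0.
rewrite eq_complex /= eqxx andbT; apply: mulf_neq0; apply: div_neq0; apply: mulf_neq0 => //;
  by [exact: tneg|exact: theta_neg_neq0].
Qed.

Lemma omega_neq0 s : nonint s -> omega s != 0.
Proof.
move=> gs; have tn n := theta_nonint_neq0 n gs.
apply: omega_neq0_aux; first by rewrite bcE.
by rewrite adE.
Qed.

Lemma omega_int_neq0 (n : int) : 0 < A1%:Z + n -> 0 < B1%:Z + n -> omega n%:~R != 0.
Proof.
move=> h1 h2; apply: omega_neq0_aux; first by rewrite bcE; exact: theta_int_neq0.
by rewrite adE; exact: theta_int_neq0.
Qed.

Lemma omega_continuous (n : int) : 0 < A1%:Z + n -> {for (n%:~R : R), continuous omega}.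
Proof.
move=> h1; rewrite /omega; apply: cvgM.
  apply: cvgM; first exact: rcpow_continuous.
  by apply: cvgV; [exact: rcpow_neq0|exact: rcpow_continuous].
have ct u := @theta_continuous u n%:~R.
apply: cvg_real_complex; apply: cvgMl_tmp; apply: cvgM.
  by apply: cvgM; exact: ct.
apply: cvgV; last by apply: cvgM; exact: ct.
by apply: mulf_neq0; [exact: theta_neg_neq0|rewrite adE; exact: theta_int_neq0].
Qed.

Lemma omega_shift s : theta (a * d * q `^ s) != 0 ->
  omega (s + 1) * (a * (1 - b * c * q `^ s) * (1 - b * d * q `^ s))%:C
  = omega s * (b * (1 - a * c * q `^ s) * (1 - a * d * q `^ s))%:C.
Proof.
move=> h; rewrite /omega !rcpowS //.
have S u : theta (u * q `^ s) = (1 - u * q `^ s) * theta (u * q `^ (s + 1)).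
  by rewrite (qpinfSl q_gt0 q_lt1) qpowD // qpow1 // -mulrA.
have n1 := theta_neg_neq0 s ac; have n2 := theta_neg_neq0 (s + 1) ac.
have n4 : theta (a * d * q `^ (s + 1)) != 0.
  by apply: contraNneq h => h; rewrite S h mulr0.
have aC : (a%:C : C) != 0 by rewrite eq_complex /= eqxx andbT.
set k := theta (a * c) * _ / _.
have H : k * (theta (b * c * q `^ (s + 1)) * theta (b * d * q `^ (s + 1))
      / (theta (a * c * q `^ (s + 1)) * theta (a * d * q `^ (s + 1))))
    * ((1 - b * c * q `^ s) * (1 - b * d * q `^ s))
  = k * (theta (b * c * q `^ s) * theta (b * d * q `^ s)
      / (theta (a * c * q `^ s) * theta (a * d * q `^ s)))
    * ((1 - a * c * q `^ s) * (1 - a * d * q `^ s)).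
  move: n1 h; rewrite !S; move: n2 n4.
  move: (theta _) (theta _) (theta _) (theta _) (1 - _) (1 - _) (1 - _) (1 - _) => t1 t2 t3 t4 u1 u2 u3 u4 n2 n4.
  rewrite !mulf_eq0 !negb_or => /andP[n5 _] /andP[n6 _].
  by move: (k) => kk; field; rewrite n2 n4 n5 n6.
have ra : rcpow a s != 0 by exact: rcpow_neq0.
have aux (K1 K2 U V : R) : K1 * U = K2 * V ->
    b%:C * rcpow b s / (a%:C * rcpow a s) * K1%:C * (a * U)%:C
    = rcpow b s / rcpow a s * K2%:C * (b * V)%:C.
  move=> /(congr1 (fun t => t%:C : C)); rewrite !rmorphM /= => E.
  transitivity (rcpow b s / rcpow a s * b%:C * (K1%:C * U%:C)).
    by field; rewrite ra aC.
  by rewrite E; ring.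
by rewrite -(mulrA a (1 - b * c * q `^ s)) -(mulrA b (1 - a * c * q `^ s)); exact: aux.
Qed.

Lemma xi_b_neq0_eq s : nonint s -> xi_b q a b c d s != 0 /\
  xi_a q a b c d s = omega s * xi_b q a b c d s.
Proof.
move=> gs; have tn n := theta_nonint_neq0 n gs.
have E : xi_b q a b c d s = (xi_real s)%:C / rcpow a s / omega s.
  have aux (X Y Z W : R) (u v : C) : u != 0 -> v != 0 -> X / Y = Z / W ->
      X%:C / (u * Y%:C) = Z%:C / v / (u / v * W%:C) :> C.
    move=> u0 v0 /(congr1 (fun t => t%:C : C)); rewrite !fmorph_div => E.
    rewrite !invfM !invrK; transitivity (X%:C / Y%:C / u); first by ring.
    by rewrite E; move: (W%:C)^-1 => w; field; rewrite u0 v0.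
  apply: aux; [exact: rcpow_neq0|exact: rcpow_neq0|].
  have t1 : theta (q * q `^ s) != 0 by have := tn 1; rewrite expr1.
  have t2 : theta (a * b * c * d / q * q `^ s) != 0 by rewrite eE.
  have t3 : theta (b * c * q `^ s) != 0 by rewrite bcE.
  have t4 := theta_neg_neq0 s bd; have t5 := theta_neg_neq0 s cd.
  have t6 := theta_neg_neq0 s ac; have t7 : theta (a * d * q `^ s) != 0 by rewrite adE.
  have := tneg ac; have := tneg bd; have := tneg cd; have := tbc; have := tad; have := tq.
  rewrite /qpochr /xi_real; move: te t1 t2 t3 t4 t5 t6 t7.
  move: (theta (q * q `^ s)) (theta (a * b * c * d / q * q `^ s)) (theta (b * c * q `^ s))
    (theta (b * d * q `^ s)) (theta (c * d * q `^ s)) (theta (a * c * q `^ s))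
    (theta (a * d * q `^ s)) => t1 t2 t3 t4 t5 t6 t7.
  move: (theta (a * b * c * d / q)) (theta (b * c)) (theta (b * d)) (theta (c * d)) (theta (a * c))
    (theta (a * d)) (theta q) (q `^ s) => u1 u2 u3 u4 u5 u6 u7 N.
  move=> *; field.
  by do !(apply/andP; split).
have o0 := omega_neq0 gs.
have x0 := xi_a_neq0 gs; rewrite xi_aE in x0.
rewrite E; split; first exact: div_neq0.
by rewrite xi_aE [RHS]mulrC divfK.
Qed.

End Xi.

Section Limits.
Variable R : realType.
Local Notation C := (cplx R).

Lemma ccvgM T (F : set_system T) {FF : Filter F} (f g : T -> C) (x y : C) :
  f u @[u --> F] --> x -> g u @[u --> F] --> y -> (f u * g u : C) @[u --> F] --> (x * y : C).
Proof. by move=> fx gy; exact: (@cvgM (cplx R) T F FF f g x y fx gy). Qed.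

Lemma ccvg_prod T (F : set_system T) {FF : Filter F} (I : Type) (r : seq I) (P : pred I)
    (f : I -> T -> C) (l : I -> C) :
  (forall i, P i -> f i u @[u --> F] --> l i) ->
  (\prod_(i <- r | P i) f i u : C) @[u --> F] --> (\prod_(i <- r | P i) l i : C).
Proof. by move=> h; apply: cvg_big => //; exact: mul_continuous. Qed.

Lemma ccvg_det T (F : set_system T) {FF : Filter F} n (A : T -> 'M[C]_n) (B : 'M[C]_n) :
  (forall i j, (A u i j : C) @[u --> F] --> (B i j : C)) ->
  (\det (A u) : C) @[u --> F] --> (\det B : C).
Proof.
move=> h; rewrite /determinant; apply: cvg_big => //; first exact: add_continuous.
by move=> p _; apply: cvgMl_tmp; apply: ccvg_prod => i _; exact: h.
Qed.

Lemma ccvg_horner T (F : set_system T) {FF : Filter F} (p : {poly C}) (f : T -> C) (l : C) :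
  f u @[u --> F] --> l -> (p.[f u] : C) @[u --> F] --> (p.[l] : C).
Proof.
move=> cf; elim/poly_ind: p => [|p k IH].
  rewrite horner0.
  by under eq_cvg do rewrite horner0; exact: cvg_cst.
rewrite hornerMXaddC; under eq_cvg do rewrite hornerMXaddC.
have H := @cvgM (cplx R) T F FF (fun u => p.[f u]) f p.[l] l IH cf.
have H2 := @cvgD (cplx R) (cplx R) T F FF _ _ _ _ H (cvg_cst k).
exact: H2.
Qed.

(** The way meromorphic values are computed: a function continuous at n which agrees with the given
    one off the integers. *)
Lemma extvalE (f g : R -> C) (n : int) : (forall s, nonint s -> f s = g s) ->
  {for (n%:~R : R), continuous g} -> extval f n = g n%:~R.
Proof.
move=> fg cg; apply/cvg_lim; first exact: norm_hausdorff.
have : g s @[s --> (n%:~R : R)^'] --> g n%:~R.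
  by apply: cvg_trans cg; apply: cvg_app; exact: nbhs_dnbhs.
apply: cvg_trans; apply: near_eq_cvg; near=> s; apply/esym/fg.
near: s; exact: near_nonint.
Unshelve. all: by end_near. Qed.

End Limits.

(** * Determinants and coefficients in the gauge xi^a *)

Section Darboux.
Variables (R : realType) (q : R).
Hypotheses (q_gt0 : 0 < q) (q_lt1 : q < 1).
Local Notation C := (cplx R).
Variables a b c d : R.
Variables A1 B1 : nat.
Hypotheses (a_gt0 : 0 < a) (b_lt0 : b < 0) (c_lt0 : c < 0) (d_gt0 : 0 < d).
Hypotheses (A1_gt0 : (0 < A1)%N) (B1_gt0 : (0 < B1)%N).
Hypotheses (adE : a * d = q ^+ A1) (bcE : b * c = q ^+ B1).
Variables (k : nat) (isb : 'I_k -> bool) (phi : 'I_k -> {poly C}).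

Let q0 : q != 0. Proof. by rewrite gt_eqF. Qed.
Let a0 : a != 0. Proof. by rewrite gt_eqF. Qed.
Let b0 : b != 0. Proof. by rewrite lt_eqF. Qed.
Let ac : a * c < 0. Proof. by rewrite pmulr_rlt0. Qed.
Let bd : b * d < 0. Proof. by rewrite pmulr_llt0. Qed.

Local Notation xa := (xi_a q a b c d).
Local Notation om := (omega q a b c d).

(** The cancelled form of xi^a psi^(j): the row which enters tau and, up to column factors, the
    coefficients of p_{n-l}. *)
Definition sol (j : 'I_k) (s : R) : C :=
  (if isb j then om s else 1) * (phi j).[(lambda q a b c d s)%:C].

(** The product of xi^b / xi^a at s - j with eta^{b,j+1}. Once [omega] is moved from s - j to s,
    only (b / a)^j depends on the row. *)
Definition rowfac (j : nat) (s : R) : C := (om s)^-1 *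
  ((b / a) ^+ j * q `^ (- (s * k.-1%:R)) * qpoch q (a * c * q `^ (s - k%:R + 1)) k.-1
   * qpoch q (a * d * q `^ (s - k%:R + 1)) k.-1)%:C.

Definition allfac (s : R) : C := \prod_(j < k | isb j) rowfac j s.

Let xa_neq0 s : nonint s -> xa s != 0.
Proof. by move=> gs; apply: (xi_a_neq0 _ _ _ _ _ _ _ _ adE bcE gs). Qed.

Let om_neq0 s : nonint s -> om s != 0.
Proof. by move=> gs; apply: (omega_neq0 _ _ _ _ _ _ _ _ adE bcE gs). Qed.

Let xb s : nonint s -> xi_b q a b c d s != 0 /\ xa s = om s * xi_b q a b c d s.
Proof. by move=> gs; apply: (xi_b_neq0_eq _ _ _ _ _ _ _ _ adE bcE gs). Qed.

Lemma psiE j s : nonint s -> psi q a b c d isb phi j s = sol j s / xa s.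
Proof.
move=> gs; rewrite /psi /xi /sol; case: (isb j); last by rewrite mul1r.
have [x0 ->] := xb gs; have o0 := om_neq0 gs.
by move: (_.[_]) => p; move: (om s) (xi_b _ _ _ _ _ _) o0 x0 => u v u0 v0; field; rewrite u0 v0.
Qed.

Lemma qpochD (u : R) m n : qpoch q u (m + n) = qpoch q u m * qpoch q (u * q ^+ m) n.
Proof.
elim: n => [|n IH]; first by rewrite addn0 qpoch0 mulr1.
by rewrite addnS !qpochS IH exprD !mulrA.
Qed.

(* [omega] absorbs the factors eta^{b,j}, so that all rows of the determinant are
   sampled at s, s - 1, ... in the xi^a gauge. *)
Lemma omega_steps j s : nonint s ->
  om s * (qpoch q (b * c * q `^ (s - j%:R)) j * qpoch q (b * d * q `^ (s - j%:R)) j)%:C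
  = om (s - j%:R) * ((b / a) ^+ j * qpoch q (a * c * q `^ (s - j%:R)) j
      * qpoch q (a * d * q `^ (s - j%:R)) j)%:C.
Proof.
move=> gs; elim: j => [|j IH]; first by rewrite !qpoch0 expr0 !mul1r subr0.
have gj := nonintB j.+1 gs.
have td : qpinf q (a * d * q `^ (s - j.+1%:R)) != 0 by rewrite adE; exact: theta_nonint_neq0.
have := omega_shift q_gt0 q_lt1 a_gt0 b_lt0 c_lt0 td.
have -> : s - j.+1%:R + 1 = s - j%:R by rewrite -natr1; ring.
have E u : u * q `^ (s - j.+1%:R) * q = u * q `^ (s - j%:R).
  have -> : s - j%:R = (s - j.+1%:R) + 1 by rewrite -natr1; ring.
  by rewrite (qpowD q_gt0 (s - j.+1%:R) 1) qpow1 // mulrA.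
rewrite !qpochSl !E.
move: IH; set X := qpoch q (b * c * _) j; set Y := qpoch q (b * d * _) j.
set Z := qpoch q (a * c * _) j; set W := qpoch q (a * d * _) j.
set u1 := 1 - b * c * _; set u2 := 1 - b * d * _; set u3 := 1 - a * c * _; set u4 := 1 - a * d * _.
move: (om s) (om (s - j%:R)) (om (s - j.+1%:R)) => o o' o'' IH H.
transitivity (o * (X * Y)%:C * (u1 * u2)%:C); first by rewrite -mulrA -rmorphM; congr (_ * _%:C); ring.
rewrite IH.
transitivity (o' * (a * u1 * u2)%:C * ((b / a) ^+ j * Z * W / a)%:C).
  by rewrite -!mulrA -!rmorphM; congr (_ * _%:C); field.
rewrite H -mulrA -rmorphM exprS; congr (_ * _%:C); by field.
Qed.

Lemma rowfacE (j : nat) s : (j < k)%N -> nonint s ->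
  (om (s - j%:R))^-1 * (eta q a b c d k j s)%:C = rowfac j s.
Proof.
move=> jk gs; rewrite /rowfac /eta; have o1 := om_neq0 gs; have o2 := om_neq0 (nonintB j gs).
have K : (k.-1 = (k - j.+1) + j)%N by move: jk; clear; lia.
have E u : u * q `^ (s - k%:R + 1) * q ^+ (k - j.+1) = u * q `^ (s - j%:R).
  rewrite -mulrA -(qpow_nat q_gt0) -(qpowD q_gt0); congr (_ * q `^ _).
  by rewrite natrB // -natr1; ring.
have H := omega_steps j gs.
rewrite [in RHS]K !qpochD !E -K.
move: H; set X := qpoch q (b * c * _) j; set Y := qpoch q (b * d * _) j.
set Z := qpoch q (a * c * q `^ (s - j%:R)) j; set W := qpoch q (a * d * q `^ (s - j%:R)) j.
set P := q `^ (- (s * _)); set U := qpoch q (a * c * _) (k - j.+1); set V := qpoch q (a * d * _) (k - j.+1).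
move: (om s) (om (s - j%:R)) o1 o2 => o o' o1 o2 H.
have aux (x y w : R) : o * x%:C = o' * y%:C -> o'^-1 * (x * w)%:C = o^-1 * (y * w)%:C :> C.
  move=> h; rewrite !rmorphM !mulrA; congr (_ * _).
  by apply: (mulfI o1); rewrite mulrCA h mulKf // mulVKf.
have := aux _ _ (P * U * V) H; set w1 := _ * (P * U * V); set w2 := _ * (P * U * V).
have -> : P * X * Y * U * V = w1 by rewrite /w1; ring.
by move=> ->; congr (_ * _%:C); rewrite /w2; ring.
Qed.

Lemma chiE s : nonint s ->
  chi q a b c d isb s = allfac s * \prod_(j < k.+1) xa (s - j%:R).
Proof.
move=> gs; rewrite /chi big_ord_recr /= mulrAC mulrA; congr (_ * _); rewrite /allfac.
rewrite [X in _ * X]big_mkcond [X in _ = X * _]big_mkcond /= -!big_split /=.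
apply: eq_bigr => j _; have gj := nonintB j gs.
have [x0 xE] := xb gj; have o0 := om_neq0 gj.
rewrite /xi; case: (isb j); last by rewrite mulr1 mul1r.
rewrite -rowfacE // xE; move: (_%:C) => e.
by move: (om _) (xi_b _ _ _ _ _ _) o0 x0 => u v u0 v0; field.
Qed.

Lemma qpow_cvg (f : R -> R) (x y : R) : f s @[s --> x] --> y ->
  q `^ (f s) @[s --> x] --> q `^ y.
Proof.
move=> P; have H : q `^ s @[s --> y] --> q `^ y by exact: powR_exp_continuous.
exact: (cvg_comp _ _ P H).
Qed.

Lemma qpoch_cvg (f : R -> R) (x y : R) m : f s @[s --> x] --> y ->
  qpoch q (f s) m @[s --> x] --> qpoch q y m.
Proof.
move=> P; elim: m => [|m IH].
  by rewrite qpoch0; under eq_cvg do rewrite qpoch0; exact: cvg_cst.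
rewrite qpochS; under eq_cvg do rewrite qpochS.
by apply: cvgM => //; apply: cvgB; [exact: cvg_cst|apply: cvgMr_tmp].
Qed.

(** For n > - A1 the product (a d q^n; q)_oo is nonzero, so [omega] has no pole at n. *)
Definition regular (n : int) := 0 < A1%:Z + n.

Lemma sol_cvg j (n : int) : regular n -> sol j s @[s --> (n%:~R : R)] --> (sol j n%:~R : C).
Proof.
move=> rn; rewrite /sol; apply: ccvgM.
  case: (isb j); last exact: cvg_cst.
  by have := omega_continuous q_gt0 q_lt1 a_gt0 b_lt0 c_lt0 adE rn; exact.
apply: ccvg_horner; apply: cvg_real_complex.
rewrite (_ : lambda q a b c d = (fun s => (q `^ (- s) - 1) * (1 - a * b * c * d / q * q `^ s))).
  apply: cvgM; apply: cvgB; try exact: cvg_cst.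
    by apply: qpow_cvg; apply: cvgN; exact: cvg_id.
  by apply: cvgMl_tmp; exact: powR_exp_continuous.
apply/funext => s; rewrite /lambda (qpowB q_gt0) qpow1 //; congr (_ * (1 - _)).
by field.
Qed.

Hypothesis k_lt : (k < A1)%N.
Hypothesis B1_gt1 : forall j, isb j -> (1 < B1)%N.

(** For n >= -1 the exponents of q in question stay positive: k < A1 keeps each 1 - a d q^(n-k+1+i)
    nonzero, and k < A1 with 1 < B1 makes [omega] finite and nonzero down to n = -1. *)
Lemma rowfac_int (j : 'I_k) (n : int) : isb j -> -1 <= n ->
  rowfac j n%:~R != 0 /\ {for (n%:~R : R), continuous (rowfac j)}.
Proof.
move=> ij n1; have b1 := B1_gt1 ij; have k0 := leq_ltn_trans (leq0n j) (ltn_ord j).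
have hA : 0 < A1%:Z + n by move: k_lt k0 n1; clear; lia.
have hB : 0 < B1%:Z + n by move: b1 n1; clear; lia.
have o0 : om n%:~R != 0 by apply: (omega_int_neq0 _ _ _ _ _ _ _ _ adE bcE hA hB).
split.
  rewrite /rowfac; apply: mulf_neq0; first by rewrite invr_eq0.
  rewrite fmorph_eq0; apply: mulf_neq0; first apply: mulf_neq0; first apply: mulf_neq0.
  - by rewrite expf_neq0 // mulf_neq0 ?invr_eq0.
  - exact: qpow_neq0.
  - apply: qpoch_neq0 => i _; rewrite gt_eqF // subr_gt0 (lt_trans (y := 0)) //.
    by rewrite pmulr_llt0 ?exprn_gt0 // pmulr_llt0 ?powR_gt0.
  - apply: qpoch_neq0 => i _; rewrite adE -mulrA mulrCA -!(qpow_nat q_gt0) -!(qpowD q_gt0).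
    have [r [r0 ->]] : exists r : nat, (0 < r)%N /\
       n%:~R - k%:R + 1 + (A1%:R + i%:R) = r%:R :> R.
      exists (absz (n - k%:Z + 1 + (A1 + i)%:Z)); split; first by move: k_lt n1; clear; lia.
      rewrite natr_absz ger0_norm; last by move: k_lt n1; clear; lia.
      by rewrite !rmorphD rmorphN.
    by rewrite (qpow_nat q_gt0) subr_eq0 eq_sym lt_eqF // exprn_ilt1 ?ltW // -lt0n.
rewrite /rowfac; apply: ccvgM.
  apply: cvgV => //.
  exact: (omega_continuous q_gt0 q_lt1 a_gt0 b_lt0 c_lt0 adE hA).
apply: cvg_real_complex.
have P u m : qpoch q (u * q `^ (s - k%:R + 1)) m @[s --> (n%:~R : R)] -->
    qpoch q (u * q `^ (n%:~R - k%:R + 1)) m.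
  apply: qpoch_cvg; apply: cvgMl_tmp; apply: qpow_cvg; apply: cvgD; last exact: cvg_cst.
  by apply: cvgB; [exact: cvg_id|exact: cvg_cst].
apply: cvgM => //; apply: cvgM => //; apply: cvgMl_tmp; apply: qpow_cvg.
by apply: cvgN; apply: cvgMr_tmp; exact: cvg_id.
Qed.

Lemma allfac_neq0 (n : int) : -1 <= n -> allfac n%:~R != 0.
Proof. by move=> n1; apply/prodf_neq0 => j ij; have [] := rowfac_int ij n1. Qed.

Lemma allfac_cvg (n : int) : -1 <= n -> allfac s @[s --> (n%:~R : R)] --> allfac n%:~R.
Proof.
by move=> n1; apply: ccvg_prod => j ij; have [_] := rowfac_int ij n1; exact.
Qed.

Lemma regularB (n : int) (j : nat) : -1 <= n -> (j < k)%N -> regular (n - j%:Z).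
Proof. by rewrite /regular; move: k_lt; clear; lia. Qed.

Lemma prod_xa_neq0 s : nonint s -> \prod_(j < k.+1) xa (s - j%:R) != 0.
Proof. by move=> gs; apply/prodf_neq0 => j _; apply: xa_neq0; exact: nonintB. Qed.

(** The xi^a contained in [chi] cancel against the product of inverses, which leaves [allfac]; the
    rows of the determinant cancel to [sol]. *)
Lemma tauE (n : int) : -1 <= n -> tau q a b c d isb phi n =
  allfac n%:~R * \det (\matrix_(i < k, j < k) sol i (n - (j : nat)%:Z)%:~R).
Proof.
move=> n1.
pose g s := allfac s * \det (\matrix_(i < k, j < k) sol i (s - j%:R)).
have -> : \det (\matrix_(i < k, j < k) sol i (n - (j : nat)%:Z)%:~R) =
    \det (\matrix_(i < k, j < k) sol i (n%:~R - j%:R)).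
  by congr (\det _); apply/matrixP => i j; rewrite !mxE rmorphB.
rewrite -[RHS]/(g n%:~R); apply: extvalE => [s gs|].
  rewrite (chiE gs) prodfV (mulfK (prod_xa_neq0 gs)) /g.
  congr (_ * \det _); apply/matrixP => i j; rewrite !mxE.
  by have gj := nonintB j gs; rewrite psiE // mulrC divfK // xa_neq0.
apply: ccvgM; first exact: allfac_cvg.
apply: ccvg_det => i j; under eq_cvg do rewrite mxE; rewrite mxE.
have H := sol_cvg (j := i) (regularB n1 (ltn_ord j)).
rewrite rmorphB /= in H.
have P : s - j%:R @[s --> (n%:~R : R)] --> (n%:~R : R) - (j : nat)%:~R.
  by apply: cvgB; [exact: cvg_id|exact: cvg_cst].
exact: (cvg_comp _ _ P H).
Qed.

Definition solcof (f : 'I_k -> R -> C) (s : R) (l : 'I_k.+1) : C :=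
  cofactor (\matrix_(i, j) (oapp (fun i' => f i' (s - (j : nat)%:R)) 0 (unlift ord_max i))
    : 'M[C]_k.+1) ord_max l.

Lemma det_scale_col n (M : 'M[C]_n) (v : 'I_n -> C) :
  \det (\matrix_(i, j) (M i j * v j)) = \det M * \prod_j v j.
Proof.
have -> : \matrix_(i, j) (M i j * v j) = M *m diag_mx (\row_j v j).
  by apply/matrixP => i j; rewrite mul_mx_diag !mxE.
rewrite det_mulmx det_diag; congr (_ * _); by apply: eq_bigr => j _; rewrite mxE.
Qed.

(** The columns other than l carry 1 / xi^a(s - j), while [chi] supplies all k + 1 factors xi^a;
    exactly xi^a(s - l) is left over, and it is continuous at n because l <= n. *)
Lemma QcoefE (l : 'I_k.+1) (n : nat) : (l <= n)%N -> Qcoef q a b c d isb phi l n =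
  allfac n%:R * xa (n - l)%:R * solcof sol n%:R l.
Proof.
move=> ln.
pose g s := allfac s * xa (s - l%:R) * solcof sol s l.
rewrite natrB // -[RHS]/(g n%:~R); apply: extvalE => [s gs|].
  have aux (al x p sg D1 D2 : C) : p * D1 = D2 -> al * (x * p) * (sg * D1) = al * x * (sg * D2).
    by move=> <-; ring.
  have EP : \prod_(j < k.+1) xa (s - j%:R) =
      xa (s - l%:R) * \prod_(j < k) xa (s - (lift l j : nat)%:R) by rewrite (bigD1_ord l).
  rewrite (chiE gs) EP.
  rewrite /g /solcof /cofactor; apply: aux.
  pose v (j : 'I_k) := (xa (s - (lift l j : nat)%:R))^-1.
  transitivity (\prod_(j < k) xa (s - (lift l j : nat)%:R) *
    \det (\matrix_(i, j) ((\matrix_(i < k, j < k) sol i (s - (lift l j : nat)%:R)) i j * v j))).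
    congr (_ * \det _); apply/matrixP => i j; rewrite !mxE liftK /=.
    by rewrite psiE //; exact: nonintB.
  rewrite det_scale_col mulrCA /v prodfV mulfV ?mulr1.
    by congr (\det _); apply/matrixP => i j; rewrite !mxE liftK.
  by apply/prodf_neq0 => j _; apply: xa_neq0; exact: nonintB.
have n1 : -1 <= n%:Z by [].
apply: ccvgM; first apply: ccvgM.
- exact: (allfac_cvg n1).
- have P : s - l%:R @[s --> (n%:~R : R)] --> (n%:R : R) - (l : nat)%:R.
    by apply: cvgB; [exact: cvg_id|exact: cvg_cst].
  rewrite -natrB // in P.
  have H := xi_a_continuous q_gt0 q_lt1 a_gt0 A1_gt0 B1_gt0 adE bcE (n := (n - l)%N).
  have := cvg_comp _ _ P H; rewrite natrB //; exact.
rewrite /solcof /cofactor; apply: cvgMl_tmp.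
apply: ccvg_det => i j; under eq_cvg do rewrite !mxE liftK /=; rewrite !mxE liftK /=.
have jl : (bump l j <= k)%N by rewrite /bump; move: (ltn_ord j) (leq_b1 (l <= j)%N); clear; lia.
have H := sol_cvg (j := i) (n := n%:Z - (bump l j)%:Z).
rewrite rmorphB /= in H.
have P : s - (bump l j)%:R @[s --> (n%:~R : R)] --> (n%:~R : R) - (bump l j)%:~R.
  by apply: cvgB; [exact: cvg_id|exact: cvg_cst].
apply: (cvg_comp _ _ P); apply: H; rewrite /regular.
by move: k_lt jl; move: (bump l j) => B; clear; lia.
Qed.

End Darboux.

Lemma cvg_punctured (T U : topologicalType) (f : T -> U) (x : T) (y : U) :
  f s @[s --> x] --> y -> f s @[s --> x^'] --> y.
Proof. by move=> h; apply: cvg_trans h; apply: cvg_app; exact: nbhs_dnbhs. Qed.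

Lemma cvgM_near (R : realType) (x : R) (f g h : R -> cplx R) (l m : cplx R) :
  f s @[s --> x^'] --> l -> g s @[s --> x^'] --> m ->
  (\forall s \near x^', f s * g s = h s) -> h s @[s --> x^'] --> l * m.
Proof.
move=> fl gm e; have FF : Filter (nbhs x^') by apply: filter_filter.
have H := @ccvgM R _ _ FF f g l m fl gm.
by apply: cvg_trans H; exact: near_eq_cvg.
Qed.

(** * The bounds on k contained in the standing assumptions *)

Section Ratio.
Variables (R : realType) (q : R).
Hypotheses (q_gt0 : 0 < q) (q_lt1 : q < 1).
Local Notation C := (cplx R).
Variables a b c d : R.
Variables A1 B1 : nat.
Hypotheses (a_gt0 : 0 < a) (b_lt0 : b < 0) (c_lt0 : c < 0) (d_gt0 : 0 < d).
Hypotheses (A1_gt0 : (0 < A1)%N) (B1_gt0 : (0 < B1)%N).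
Hypotheses (adE : a * d = q ^+ A1) (bcE : b * c = q ^+ B1).
Variables (k : nat) (isb : 'I_k -> bool).

Let q0 : q != 0. Proof. by rewrite gt_eqF. Qed.
Let a0 : a != 0. Proof. by rewrite gt_eqF. Qed.
Let b0 : b != 0. Proof. by rewrite lt_eqF. Qed.

Local Notation xa := (xi_a q a b c d).
Local Notation om := (omega q a b c d).

Lemma rowfac_step (j : 'I_k) s : nonint s ->
  rowfac q a b c d k j s *
    ((1 - a * c * q `^ (s - k%:R)) * (1 - a * d * q `^ (s - k%:R)))%:C =
  rowfac q a b c d k j (s - 1) *
    (q `^ (- k.-1%:R) * (a / b) * (1 - b * c * q `^ (s - 1)) * (1 - b * d * q `^ (s - 1)))%:C.
Proof.
move=> gs; have k0 := leq_ltn_trans (leq0n j) (ltn_ord j).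
have g1 := nonintB 1 gs; rewrite -[1%:R]/(1 : R) in g1.
have o1 : om s != 0 := omega_neq0 q_gt0 q_lt1 a_gt0 b_lt0 c_lt0 d_gt0 A1_gt0 B1_gt0 adE bcE gs.
have o2 : om (s - 1) != 0 := omega_neq0 q_gt0 q_lt1 a_gt0 b_lt0 c_lt0 d_gt0 A1_gt0 B1_gt0 adE bcE g1.
have td : qpinf q (a * d * q `^ (s - 1)) != 0 by rewrite adE; exact: theta_nonint_neq0.
have H := omega_shift q_gt0 q_lt1 a_gt0 b_lt0 c_lt0 td.
rewrite subrK in H.
have S u : qpoch q (u * q `^ (s - k%:R + 1)) k.-1 * (1 - u * q `^ (s - k%:R)) =
    qpoch q (u * q `^ (s - 1 - k%:R + 1)) k.-1 * (1 - u * q `^ (s - 1)).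
  have -> : s - 1 - k%:R + 1 = s - k%:R by ring.
  have -> : u * q `^ (s - k%:R + 1) = u * q `^ (s - k%:R) * q.
    by rewrite (qpowD q_gt0 (s - k%:R) 1) qpow1 // mulrA.
  have -> : u * q `^ (s - 1) = u * q `^ (s - k%:R) * q ^+ k.-1.
    rewrite -mulrA -(qpow_nat q_gt0) -(qpowD q_gt0); congr (_ * q `^ _).
    by rewrite -[in k%:R](prednK k0) -natr1; ring.
  by rewrite mulrC -qpochSl -qpochS.
have Sac := S (a * c); have Sad := S (a * d).
have Q : q `^ (- ((s - 1) * k.-1%:R)) * q `^ (- k.-1%:R) = q `^ (- (s * k.-1%:R)).
  by rewrite -(qpowD q_gt0); congr (q `^ _); ring.
rewrite /rowfac -Q.
move: Sac Sad H; set X := qpoch q _ _; set x := 1 - _; set Y := qpoch q _ _; set y := 1 - _.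
set Z := qpoch q (a * d * _) _; set z := 1 - a * d * _; set W := qpoch q (a * d * _) _; set w := 1 - a * d * _.
set u := 1 - b * c * _; set v := 1 - b * d * _.
set P1 := q `^ _; set P2 := q `^ _.
move: (om s) (om (s - 1)) o1 o2 => o o' o1 o2 Sac Sad H.
have aux (x1 y1 w1 : R) : o * x1%:C = o' * y1%:C -> o'^-1 * (x1 * w1)%:C = o^-1 * (y1 * w1)%:C :> C.
  move=> h; rewrite !rmorphM !mulrA; congr (_ * _).
  by apply: (mulfI o1); rewrite mulrCA h mulKf // mulVKf.
have := aux _ _ ((b / a) ^+ j * P1 * P2 * Y * W / b) H => E.
rewrite -!mulrA -!rmorphM.
transitivity (o^-1 * (b * y * w * ((b / a) ^+ j * P1 * P2 * Y * W / b))%:C).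
  congr (_ * _%:C).
  transitivity ((b / a) ^+ j * P1 * P2 * (X * x) * (Z * z)); first by ring.
  by rewrite Sac Sad; field.
by rewrite -E; congr (_ * _%:C); field.
Qed.

Lemma qpoch_neq0_inf u n : qpinf q u != 0 -> qpoch q u n != 0.
Proof.
elim: n u => [|n IH] u u0; first by rewrite qpoch0 oner_neq0.
move: u0; rewrite (qpinfSl q_gt0 q_lt1) mulf_eq0 negb_or => /andP[u1 u2].
by rewrite qpochSl mulf_neq0 // IH.
Qed.

Lemma rowfac_neq0 j s : nonint s -> rowfac q a b c d k j s != 0.
Proof.
move=> gs; have o0 : om s != 0 := omega_neq0 q_gt0 q_lt1 a_gt0 b_lt0 c_lt0 d_gt0 A1_gt0 B1_gt0 adE bcE gs.
rewrite /rowfac; apply: mulf_neq0; first by rewrite invr_eq0.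
rewrite fmorph_eq0; apply: mulf_neq0; first apply: mulf_neq0; first apply: mulf_neq0.
- by rewrite expf_neq0 // mulf_neq0 ?invr_eq0.
- exact: qpow_neq0.
- apply: qpoch_neq0_inf; apply: theta_neg_neq0 => //; by rewrite pmulr_rlt0.
- apply: qpoch_neq0_inf; rewrite adE; apply: theta_nonint_neq0 => // m.
  have := gs (m + k%:Z - 1); apply: contraNneq; rewrite rmorphB rmorphD /= => <-.
  by apply/eqP; ring.
Qed.

(** Between s - 1 and s the products in [chi] telescope: xi^a(s) remains, together with one rational
    quotient for each row of type b, written here without denominators. *)
Lemma ratioE s : nonint s ->
  ratio q a b c d isb s * \prod_(j < k | isb j)
    ((1 - a * c * q `^ (s - k%:R)) * (1 - a * d * q `^ (s - k%:R)))%:C =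
  xa s * \prod_(j < k | isb j)
    (q `^ (- k.-1%:R) * (a / b) * (1 - b * c * q `^ (s - 1)) * (1 - b * d * q `^ (s - 1)))%:C.
Proof.
move=> gs; have g1 := nonintB 1 gs; rewrite -[1%:R]/(1 : R) in g1.
have xa0 u : nonint u -> xa u != 0.
  by move=> gu; apply: (xi_a_neq0 _ _ _ _ _ _ _ _ adE bcE gu).
have om0 u : nonint u -> om u != 0.
  by move=> gu; apply: (omega_neq0 _ _ _ _ _ _ _ _ adE bcE gu).
have P (f : R -> C) : \prod_(j < k.+1) f (s - j%:R) * f (s - k.+1%:R) =
    f s * \prod_(j < k.+1) f (s - 1 - j%:R).
  transitivity (\prod_(j < k.+2) f (s - j%:R)); first by rewrite [RHS]big_ord_recr.
  rewrite big_ord_recl subr0; congr (_ * _).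
  by apply: eq_bigr => j _; rewrite lift0 -natr1; congr f; ring.
have P0 : \prod_(j < k.+1) xa (s - 1 - j%:R) != 0.
  by apply/prodf_neq0 => j _; apply: xa0; exact: nonintB.
have f0 : allfac q a b c d isb (s - 1) != 0 by apply/prodf_neq0 => j _; exact: rowfac_neq0.
have H : allfac q a b c d isb s * \prod_(j < k | isb j)
    ((1 - a * c * q `^ (s - k%:R)) * (1 - a * d * q `^ (s - k%:R)))%:C =
  allfac q a b c d isb (s - 1) * \prod_(j < k | isb j)
    (q `^ (- k.-1%:R) * (a / b) * (1 - b * c * q `^ (s - 1)) * (1 - b * d * q `^ (s - 1)))%:C.
  by rewrite /allfac -!big_split; apply: eq_bigr => j _; exact: rowfac_step.
have aux (f f' p p' x x' u v : C) : f' != 0 -> p' != 0 -> p * x' = x * p' -> f * u = f' * v ->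
    f * p * x' / (f' * p') * u = x * v.
  move=> f'0 p'0 e1 e2; transitivity ((f * u) * (p * x') / (f' * p')); first by rewrite -!mulrA; congr (_ * _); ring.
  by rewrite e1 e2; field; rewrite f'0 p'0.
have E := chiE q_gt0 q_lt1 a_gt0 b_lt0 c_lt0 d_gt0 A1_gt0 B1_gt0 adE bcE isb.
by rewrite /ratio (E _ gs) (E _ g1); apply: aux f0 P0 (P _) H.
Qed.

Hypothesis B1_gt1 : (1 < B1)%N.

(* At n = k - A1 the denominator of the ratio has a zero which its numerator does
   not share, unless k < A1. *)
Lemma k_lt_A1 (j0 : 'I_k) : isb j0 ->
  (forall n : nat, exists2 v : C, v != 0 & ratio q a b c d isb s @[s --> (n%:R : R)^'] --> v) ->
  (k < A1)%N.
Proof.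
move=> ij0 hr; rewrite ltnNge; apply/negP => Ak.
have [v v0 cv] := hr (k - A1)%N.
set n := (k - A1)%N in cv.
pose u s := \prod_(j < k | isb j)
    ((1 - a * c * q `^ (s - k%:R)) * (1 - a * d * q `^ (s - k%:R)))%:C : C.
pose w s := xa s * \prod_(j < k | isb j)
    (q `^ (- k.-1%:R) * (a / b) * (1 - b * c * q `^ (s - 1)) * (1 - b * d * q `^ (s - 1)))%:C : C.
have cu : u s @[s --> (n%:R : R)^'] --> u n%:R.
  apply: ccvg_prod => j _; apply: cvg_real_complex; apply: cvg_punctured.
  apply: cvgM; apply: cvgB; try exact: cvg_cst; apply: cvgMl_tmp;
  apply: qpow_cvg => //; apply: cvgB; try exact: cvg_cst; exact: cvg_id.
have cw : w s @[s --> (n%:R : R)^'] --> w n%:R.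
  apply: ccvgM.
    apply: cvg_punctured; exact: (xi_a_continuous q_gt0 q_lt1 a_gt0 A1_gt0 B1_gt0 adE bcE).
  apply: ccvg_prod => j _; apply: cvg_real_complex; apply: cvg_punctured.
  apply: cvgM; last first.
    apply: cvgB; try exact: cvg_cst; apply: cvgMl_tmp;
    apply: qpow_cvg => //; apply: cvgB; try exact: cvg_cst; exact: cvg_id.
  apply: cvgMl_tmp.
  apply: cvgB; try exact: cvg_cst; apply: cvgMl_tmp;
  apply: qpow_cvg => //; apply: cvgB; try exact: cvg_cst; exact: cvg_id.
have u0 : u n%:R = 0.
  rewrite /u (bigD1 j0) //=.
  suff -> : a * d * q `^ (n%:R - k%:R) = 1 by rewrite subrr mulr0 mul0r.
  rewrite adE -(qpow_nat q_gt0) -(qpowD q_gt0) /n natrB //.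
  by have -> : A1%:R + (k%:R - A1%:R - k%:R) = 0 :> R by [ring]; rewrite powRr0.
have w0 : w n%:R != 0.
  apply: mulf_neq0; first exact: (xi_a_nat_neq0 _ _ _ _ _ _ _ _ adE bcE).
  apply/prodf_neq0 => j _; rewrite fmorph_eq0.
  apply: mulf_neq0; first apply: mulf_neq0; first apply: mulf_neq0.
  - exact: qpow_neq0.
  - by rewrite mulf_neq0 ?invr_eq0.
  - rewrite bcE -(qpow_nat q_gt0) -(qpowD q_gt0).
    have E r : B1%:R + (r%:R - 1) = (B1 + r).-1%:R :> R.
      rewrite -subn1 natrB; last by apply: leq_trans B1_gt0 _; exact: leq_addr.
      by rewrite natrD addrA.
    rewrite E.
    rewrite qpow_nat // subr_eq0 eq_sym lt_eqF // exprn_ilt1 ?ltW //.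
    by move: B1_gt1; clear; lia.
  - rewrite gt_eqF // subr_gt0 (lt_trans (y := 0)) //.
    by rewrite pmulr_llt0 ?powR_gt0 // pmulr_llt0.
have H : w s @[s --> (n%:R : R)^'] --> v * u n%:R.
  apply: (cvgM_near (f := ratio q a b c d isb) cv cu).
  by have := near_nonint R n%:Z; apply: filterS => s; exact: ratioE.
have E : w n%:R = v * u n%:R by apply: cvg_unique cw H; exact: norm_hausdorff.
by move: w0; rewrite E u0 mulr0 eqxx.
Unshelve. all: by end_near. Qed.

End Ratio.

(* When the coefficient of y_j in the recurrence vanishes at n = -i, the recurrence
   becomes a linear relation between columns i - 2, i - 1 and i at n = -1. *)
Lemma det_three_col (F : fieldType) (k i : nat) (u : 'I_k -> int -> F) (A B C : F) :
  (0 < i)%N -> (i < k)%N -> C != 0 -> (i = 1%N -> A = 0) ->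
  (forall j, A * u j (- i%:Z + 1) + B * u j (- i%:Z) + C * u j (- i%:Z - 1) = 0) ->
  \det (\matrix_(r < k, j < k) u r (-1 - (j : nat)%:Z)) = 0.
Proof.
move=> i0 ik C0 A0 h; rewrite -det_tr; apply/eqP/det0P.
have ik1 : (i.-1 < k)%N by exact: leq_ltn_trans (leq_pred _) ik.
have ik2 : (i.-2 < k)%N by exact: leq_ltn_trans (leq_pred _) ik1.
pose o0 := Ordinal ik; pose o1 := Ordinal ik1; pose o2 := Ordinal ik2.
exists (C *: delta_mx 0 o0 + B *: delta_mx 0 o1 + (if i == 1%N then 0 else A) *: delta_mx 0 o2).
  apply/negP => /eqP /matrixP /(_ 0 o0); rewrite !mxE !eqxx /= -!val_eqE /=.
  rewrite [i == i.-1]gtn_eqF ?ltn_predL // [i == i.-2]gtn_eqF; last by move: i0; clear; lia.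
  by rewrite !mulr0 !addr0 mulr1 => /eqP; rewrite (negbTE C0).
rewrite !mulmxDl -!scalemxAl -!rowE; apply/rowP => r; rewrite !mxE /=.
have := h r.
have -> : -1 - i%:Z = - i%:Z - 1 by lia.
have -> : -1 - i.-1%:Z = - i%:Z by move: i0; clear; lia.
case: eqP => [i1|i1].
  by rewrite A0 // !mul0r add0r addr0 => <-; rewrite addrC.
have -> : -1 - i.-2%:Z = - i%:Z + 1 by move: i0 i1; clear; lia.
by move=> <-; rewrite [RHS]addrAC [LHS]addrC addrA addrAC.
Qed.

Lemma gaugeB_swap (R : realType) (q a b c d N : R) : q != 0 -> a != 0 -> b != 0 ->
  gaugeB q b a d c N = gaugeB q a b c d N.
Proof.
move=> q0 a0 b0; rewrite /gaugeB /recD /recA /recC.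
by field; rewrite q0 a0 b0.
Qed.

Section Instance.
Variables (R : realType) (q : R).
Hypotheses (q_gt0 : 0 < q) (q_lt1 : q < 1).
Local Notation C := (cplx R).
Variables a b c d : R.
Variables A1 B1 : nat.
Hypotheses (a_gt0 : 0 < a) (b_lt0 : b < 0) (c_lt0 : c < 0) (d_gt0 : 0 < d).
Hypotheses (A1_gt0 : (0 < A1)%N) (B1_gt0 : (0 < B1)%N).
Hypotheses (adE : a * d = q ^+ A1) (bcE : b * c = q ^+ B1).
Hypotheses (a1 : `|a| < 1) (b1 : `|b| < 1) (c1 : `|c| < 1) (d1 : `|d| < 1).

Let q0 : q != 0. Proof. by rewrite gt_eqF. Qed.
Let a0 : a != 0. Proof. by rewrite gt_eqF. Qed.
Let b0 : b != 0. Proof. by rewrite lt_eqF. Qed.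

Local Notation xa := (xi_a q a b c d).
Local Notation om := (omega q a b c d).
Local Notation N n := (q `^ (n%:~R : R)).

Lemma qpow_intS (n : int) : N (n + 1) = q * N n.
Proof. by rewrite rmorphD qpowD // qpow1 // mulrC. Qed.
Lemma qpow_intB (n : int) : N (n - 1) = N n / q.
Proof. by rewrite rmorphB qpowB // qpow1. Qed.

Lemma qpow_int_neq1 (n : int) : n != 0 -> 1 - N n != 0.
Proof.
move=> n0; rewrite subr_eq0 eq_sym; apply/eqP => h.
have := ln_powR q (n%:~R : R); rewrite h ln1 => /esym/eqP.
by rewrite mulf_eq0 intr_eq0 (negbTE n0) /= lt_eqF // ln_lt0 // q_gt0.
Qed.

Lemma om_neg_neq0 (u s : R) : u < 0 -> 1 - u * q `^ s != 0.
Proof. by move=> u0; rewrite gt_eqF // subr_gt0 (lt_trans (y := 0)) // pmulr_llt0 ?powR_gt0. Qed.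

Let ab : a * b < 0. Proof. by rewrite pmulr_rlt0. Qed.
Let ac : a * c < 0. Proof. by rewrite pmulr_rlt0. Qed.
Let bd : b * d < 0. Proof. by rewrite pmulr_llt0. Qed.
Let cd : c * d < 0. Proof. by rewrite pmulr_llt0. Qed.

Lemma qpow_natM (m : nat) (n : int) : q ^+ m * N n = N (m%:Z + n).
Proof. by rewrite -(qpow_nat q_gt0) -(qpowD q_gt0) rmorphD. Qed.

Lemma abcdE : a * b * c * d = q ^+ (A1 + B1).
Proof. by rewrite exprD -adE -bcE; ring. Qed.

Lemma qpow_sqr (n : int) : N n ^+ 2 = N (n + n).
Proof. by rewrite rmorphD qpowD. Qed.

Lemma gaugeA_neq0 (n : nat) : (2 < A1 + B1)%N -> gaugeA q a b c d (N n) != 0.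
Proof.
move=> s2; rewrite /gaugeA abcdE qpow_sqr bcE qpow_natM -[in q * _](expr1 q) !qpow_natM.
have -> : N ((A1 + B1)%N%:Z + (n%:Z + n%:Z)) / q ^+ 2 = N ((A1 + B1)%N%:Z + (n%:Z + n%:Z) - 1 - 1).
  by rewrite !qpow_intB expr2 invfM mulrA.
repeat apply: mulf_neq0 => //; try (apply: qpow_int_neq1; move: s2 B1_gt0; clear; lia).
- by rewrite invr_eq0.
- exact: om_neg_neq0.
- exact: om_neg_neq0.
Qed.

Lemma gaugeA_N1 : gaugeA q a b c d (N (-1)) = 0.
Proof.
rewrite /gaugeA; have -> : q * N (-1) = 1 by rewrite -qpow_intS addNr powRr0.
by rewrite subrr !mulr0 mul0r.
Qed.

Lemma gaugeC_neq0 (n : int) : 0 < A1%:Z + n - 1 -> 0 < (A1 + B1)%N%:Z + n - 2 ->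
  0 < (A1 + B1)%N%:Z + n + n -> gaugeC q a b c d (N n) != 0.
Proof.
move=> h1 h2 h3; rewrite /gaugeC abcdE qpow_sqr adE.
have E (u : R) : u * N n / q = u * N (n - 1) by rewrite -mulrA -qpow_intB.
rewrite !E !qpow_natM.
have -> : N ((A1 + B1)%N%:Z + n) / q ^+ 2 = N ((A1 + B1)%N%:Z + n - 1 - 1).
  by rewrite !qpow_intB expr2 invfM mulrA.
repeat apply: mulf_neq0 => //; try (apply: qpow_int_neq1; move: h1 h2 h3; clear; lia).
- by rewrite invr_eq0.
- exact: om_neg_neq0.
- exact: om_neg_neq0.
Qed.

Lemma recDE (n : int) : recD q a b c d (N n) = (1 - N ((A1 + B1)%N%:Z + (n + n) - 1 - 1)) *
  (1 - N ((A1 + B1)%N%:Z + (n + n) - 1)) * (1 - N ((A1 + B1)%N%:Z + (n + n))).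
Proof. by rewrite /recD abcdE qpow_sqr qpow_natM !qpow_intB expr2 invfM mulrA. Qed.

Lemma recD_neq0 (n : int) : 0 < (A1 + B1)%N%:Z + n + n - 2 -> recD q a b c d (N n) != 0.
Proof.
move=> h; rewrite recDE; repeat apply: mulf_neq0; apply: qpow_int_neq1; move: h; clear; lia.
Qed.

Lemma recD_eq0 (n : int) : (A1 + B1)%N%:Z + n + n - 1 = 0 \/ (A1 + B1)%N%:Z + n + n - 2 = 0 ->
  recD q a b c d (N n) = 0.
Proof.
move=> h; rewrite recDE; case: h => h.
  have -> : (A1 + B1)%N%:Z + (n + n) - 1 = 0 by move: h; clear; lia.
  by rewrite powRr0 subrr mulr0 mul0r.
have -> : (A1 + B1)%N%:Z + (n + n) - 1 - 1 = 0 by move: h; clear; lia.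
by rewrite powRr0 subrr !mul0r.
Qed.

Definition csol (a b c d Y : R) (f : R -> C) (s : R) :=
  (2 * recD q a b c d (q `^ s) * Y)%:C * f s = (gaugeA q a b c d (q `^ s))%:C * f (s + 1)
    + (gaugeB q a b c d (q `^ s))%:C * f s + (gaugeC q a b c d (q `^ s))%:C * f (s - 1).

(** xi^b is xi^a for the parameters (b, a, d, c). B and D are the same for both orders, and
    [omega_shift] at n and n - 1 converts the outer coefficients A and C of one gauge into those of
    the other. *)
Lemma csol_omega Y f (n : int) : 0 < A1%:Z + n - 1 -> csol b a d c Y f n%:~R ->
  csol a b c d Y (fun s => om s * f s) n%:~R.
Proof.
move=> h; rewrite /csol gaugeB_swap //.
have tn (m : int) : 0 < A1%:Z + m -> qpinf q (a * d * N m) != 0.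
  by move=> hm; rewrite adE; exact: theta_int_neq0.
have tn1 : qpinf q (a * d * q `^ (n%:~R - 1)) != 0.
  by have := tn (n - 1); rewrite rmorphB; apply; move: h; clear; lia.
have tn2 : qpinf q (a * d * N n) != 0 by apply: tn; move: h; clear; lia.
have := omega_shift q_gt0 q_lt1 a_gt0 b_lt0 c_lt0 tn2.
have := omega_shift q_gt0 q_lt1 a_gt0 b_lt0 c_lt0 tn1.
rewrite subrK qpowB // qpow1 // /gaugeA /gaugeC.
have -> : recD q b a d c (N n) = recD q a b c d (N n) by rewrite /recD; ring.
move: (N n) (recD q a b c d (N n)) (gaugeB q a b c d (N n)) => M D G.
move: (om (n%:~R + 1)) (om n%:~R) (om (n%:~R - 1)) (f (n%:~R + 1)) (f n%:~R) (f (n%:~R - 1)).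
move=> o1 o o2 f1 f2 f3 H1 H2 H.
have aux (u v : C) (x y x' y' w : R) : u * x%:C = v * y%:C -> x' = x * w -> y' = y * w ->
    x'%:C * u = v * y'%:C.
  by move=> e -> ->; rewrite !rmorphM mulrAC [x%:C * u]mulrC e mulrA.
set GA := (a / q * _ * _ * _ * _ * _); set GC := (q / a * _ * _ * _ * _ * _).
set GA' := (b / q * _ * _ * _ * _ * _) in H; set GC' := (q / b * _ * _ * _ * _ * _) in H.
have E1 : GA%:C * o1 = o * GA'%:C.
  apply: (aux _ _ _ _ _ _ (q^-1 * (1 - c * d * M) * (1 - q * M) * (1 - a * b * c * d * M ^+ 2 / q ^+ 2)) H2).
    by rewrite /GA; ring.
  by rewrite /GA'; ring.
have E2 : GC%:C * o2 = o * GC'%:C.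
  apply: (aux _ _ _ _ _ _ (q / (a * b) * (1 - a * b * c * d * M / q ^+ 2) * (1 - a * b * M / q)
     * (1 - a * b * c * d * M ^+ 2)) (esym H1)).
    by rewrite /GC; field; rewrite a0 b0 q0.
  by rewrite /GC'; field; rewrite a0 b0 q0.
by rewrite [GA%:C * _]mulrA E1 [GC%:C * _]mulrA E2 mulrCA H; ring.
Qed.

Section Rows.
Variables (k : nat) (isb : 'I_k -> bool) (phi : 'I_k -> {poly C}) (y : 'I_k -> R).
Local Notation f j := (fun s : R => (phi j).[(lambda q a b c d s)%:C]).

Hypothesis rows : forall j s,
  if isb j then csol b a d c (y j) (f j) s else csol a b c d (y j) (f j) s.

Definition Phi (j : 'I_k) (n : int) : C := sol q a b c d isb phi j n%:~R.

Lemma Phi_rec j (n : int) : 0 < A1%:Z + n - 1 ->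
  (2 * recD q a b c d (N n))%:C * (y j)%:C * Phi j n = (gaugeA q a b c d (N n))%:C * Phi j (n + 1)
    + (gaugeB q a b c d (N n))%:C * Phi j n + (gaugeC q a b c d (N n))%:C * Phi j (n - 1).
Proof.
move=> h; have H : csol a b c d (y j) (sol q a b c d isb phi j) n%:~R.
  have := rows j n%:~R; rewrite /sol; case: (isb j) => hj; first exact: csol_omega.
  by move: hj; rewrite /csol !mul1r.
have e1 : (n + 1)%:~R = n%:~R + 1 :> R by rewrite rmorphD.
have e2 : (n - 1)%:~R = n%:~R - 1 :> R by rewrite rmorphB.
by rewrite /Phi e1 e2 -rmorphM; exact: H.
Qed.

(** Otherwise D vanishes at some n = -i with 0 < i < k. There y_j drops out, and all rows of
    tau_{-1} satisfy one and the same column relation. *)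
Lemma double_k_lt : (k < A1)%N -> \det (\matrix_(i < k, j < k) Phi i (-1 - (j : nat)%:Z)) != 0 ->
  (k.*2 < A1 + B1)%N.
Proof.
move=> kA; apply: contraNT; rewrite -leqNgt => sk; apply/eqP.
(* The zero of D: A1 + B1 - 2 i is 1 or 2. *)
pose i := ((A1 + B1).+1./2).-1.
have iE : (A1 + B1 = i.*2.+1 \/ A1 + B1 = i.*2.+2)%N by rewrite /i; move: kA B1_gt0; clear; lia.
have sk' : (k.+2 <= A1 + B1)%N by move: kA B1_gt0; clear; lia.
have i0 : (0 < i)%N by move: iE sk sk'; clear; lia.
have ik : (i < k)%N by move: iE sk; clear; lia.
(* For i = 1 the value A1 + B1 = 3 has to be excluded, since the factor 1 - e N / q^2 of C(-1) would
   vanish. *)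
have i1 : i = 1%N -> (A1 + B1 = 4)%N by move: iE sk sk'; clear; lia.
pose M := N (- i%:Z).
apply: (det_three_col (i := i) (A := (gaugeA q a b c d M)%:C) (B := (gaugeB q a b c d M)%:C)
   (C := (gaugeC q a b c d M)%:C)) => //.
- rewrite fmorph_eq0; apply: gaugeC_neq0; last by move: iE; clear; lia.
    by move: kA ik; clear; lia.
  by move: iE i0 i1; clear; lia.
- by move=> iE1; rewrite /M iE1 gaugeA_N1.
- move=> j; rewrite -Phi_rec; last by move: kA ik; clear; lia.
  by rewrite recD_eq0 ?mulr0 ?mul0r //; move: iE; clear; lia.
Qed.

End Rows.

End Instance.

Lemma map_poly_rec (R : realType) (h x y z : R) (p p2 p1 p0 : {poly R}) :
  let cp r := map_poly (real_complex R) r : {poly cplx R} in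
  h *: ('X * p) = x *: p2 + y *: p1 + z *: p0 ->
  h%:C *: ('X * cp p) = x%:C *: cp p2 + y%:C *: cp p1 + z%:C *: cp p0.
Proof.
move=> cp /(congr1 cp); rewrite /cp !rmorphD /= !map_polyZ.
by rewrite (rmorphM (map_poly (real_complex R))) /= map_polyX.
Qed.

(** * The Krall-type Askey-Wilson polynomials *)

Section GaugedPolys.
Variables (R : realType) (q : R).
Hypotheses (q_gt0 : 0 < q) (q_lt1 : q < 1).
Local Notation C := (cplx R).
Variables a b c d : R.
Variables A1 B1 : nat.
Hypotheses (a_gt0 : 0 < a) (b_lt0 : b < 0) (c_lt0 : c < 0) (d_gt0 : 0 < d).
Hypotheses (A1_gt0 : (0 < A1)%N) (B1_gt0 : (0 < B1)%N).
Hypotheses (adE : a * d = q ^+ A1) (bcE : b * c = q ^+ B1).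
Hypotheses (a1 : `|a| < 1) (b1 : `|b| < 1) (c1 : `|c| < 1) (d1 : `|d| < 1).

Let q0 : q != 0. Proof. by rewrite gt_eqF. Qed.
Let qn1 : `|q| < 1. Proof. by rewrite ger0_norm // ltW. Qed.
Let a0 : a != 0. Proof. by rewrite gt_eqF. Qed.
Local Notation e := (a * b * c * d).

Definition gxi (n : nat) : R := q ^+ n * qpoch q (e / q) n
  / (a ^+ n * (qpoch q (b * c) n * qpoch q (b * d) n * qpoch q (c * d) n * qpoch q q n)).

(** The factor between [gpoly] and the bare 4phi3 [aw_val]: the gauge times the normalisation of
    p_n. *)
Definition gnorm (n : nat) : R :=
  gxi n * (qpoch q (a * b) n * qpoch q (a * c) n * qpoch q (a * d) n / a ^+ n).

Definition gpoly (n : nat) : {poly R} := gxi n *: aw_poly q a b c d n.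

Lemma gpolyE n x : (gpoly n).[x] = gnorm n * aw_val q a b c d n x.
Proof. by rewrite /gpoly hornerZ aw_polyE' // mulrA. Qed.

Let om1 u n : `|u| < 1 -> 1 - u * q ^+ n != 0.
Proof. by move=> u1; exact: om_neq0. Qed.
Let bc1 : `|b * c| < 1. Proof. exact: mul_lt1. Qed.
Let bd1 : `|b * d| < 1. Proof. exact: mul_lt1. Qed.
Let cd1 : `|c * d| < 1. Proof. exact: mul_lt1. Qed.

Lemma gnormS n : gnorm n.+1 * ((1 - b * c * q ^+ n) * (1 - b * d * q ^+ n) * (1 - c * d * q ^+ n)
    * (1 - q * q ^+ n)) = gnorm n * (q / a ^+ 2) * ((1 - e / q * q ^+ n)
    * (1 - a * b * q ^+ n) * (1 - a * c * q ^+ n) * (1 - a * d * q ^+ n)).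
Proof.
have n1 := om1 n bc1; have n2 := om1 n bd1; have n3 := om1 n cd1; have n4 := om1 n qn1.
have nz u m : `|u| < 1 -> qpoch q u m != 0 by move=> u1; apply: qpoch_neq0 => i _; exact: om1.
have z1 := nz _ n bc1; have z2 := nz _ n bd1; have z3 := nz _ n cd1; have z4 := nz _ n qn1.
rewrite /gnorm /gxi !qpochS !(exprS _ n).
have an : a ^+ n != 0 by rewrite expf_neq0.
move: (qpoch q _ n) (qpoch q _ n) (qpoch q (b * d) n) (qpoch q (c * d) n) (qpoch q q n)
  (qpoch q (a * b) n) (qpoch q (a * c) n) (qpoch q (a * d) n) z1 z2 z3 z4 n1 n2 n3 n4 an.
move: (q ^+ n) (a ^+ n) => Q A x1 x2 x3 x4 x5 x6 x7 x8 z1 z2 z3 z4 n1 n2 n3 n4 an.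
by field; rewrite a0 z1 z2 z3 z4 n1 n2 n3 n4 an q0.
Qed.

Lemma gnorm_neq0 n : gnorm n != 0.
Proof.
have nz u m : `|u| < 1 -> qpoch q u m != 0 by move=> u1; apply: qpoch_neq0 => i _; exact: om1.
have := xi_a_nat_neq0 q_gt0 q_lt1 a_gt0 b_lt0 c_lt0 d_gt0 A1_gt0 B1_gt0 adE bcE n.
rewrite (xi_a_nat q_gt0 q_lt1 a_gt0 b_lt0 c_lt0 d_gt0 A1_gt0 B1_gt0 adE bcE) fmorph_eq0 => h.
rewrite /gnorm; apply: mulf_neq0; first exact: h.
by rewrite !mulf_neq0 ?invr_eq0 ?expf_neq0 ?nz ?mul_lt1.
Qed.

Lemma gaugeA_gnorm n : gaugeA q a b c d (q ^+ n) * gnorm n.+1 = recA q a b c d (q ^+ n) * gnorm n.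
Proof.
rewrite /gaugeA /recA.
transitivity (a / q * (1 - e * q ^+ n ^+ 2 / q ^+ 2) * (gnorm n.+1 * ((1 - b * c * q ^+ n)
   * (1 - b * d * q ^+ n) * (1 - c * d * q ^+ n) * (1 - q * q ^+ n)))); first by ring.
by rewrite gnormS; field; rewrite a0 q0.
Qed.

Lemma gaugeC_gnorm n :
  gaugeC q a b c d (q ^+ n.+1) * gnorm n = recC q a b c d (q ^+ n.+1) * gnorm n.+1.
Proof.
rewrite /gaugeC /recC exprS.
have E u : u * (q * q ^+ n) / q = u * q ^+ n by field.
rewrite !E.
transitivity (a * (1 - e * (q * q ^+ n) ^+ 2) * (gnorm n.+1 * ((1 - b * c * q ^+ n)
   * (1 - b * d * q ^+ n) * (1 - c * d * q ^+ n) * (1 - q * q ^+ n)))); last by ring.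
by rewrite gnormS; field; rewrite a0 q0.
Qed.

Lemma gpolyZ (h : R) n x : (h *: gpoly n).[x] = h * (gnorm n * aw_val q a b c d n x).
Proof. by rewrite hornerZ gpolyE. Qed.

Lemma gpolyZX (h : R) n x : (h *: ('X * gpoly n)).[x] = h * (x * (gnorm n * aw_val q a b c d n x)).
Proof. by rewrite hornerZ hornerM hornerX gpolyE. Qed.

Lemma gpoly_rec n : 2 * recD q a b c d (q ^+ n.+1) *: ('X * gpoly n.+1) =
  gaugeA q a b c d (q ^+ n.+1) *: gpoly n.+2 + gaugeB q a b c d (q ^+ n.+1) *: gpoly n.+1
  + gaugeC q a b c d (q ^+ n.+1) *: gpoly n.
Proof.
apply: poly_ext => x; rewrite gpolyZX !hornerD !gpolyZ.
rewrite (mulrA _ (gnorm n.+2)) gaugeA_gnorm (mulrA _ (gnorm n)) gaugeC_gnorm.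
have H := aw_val_rec q_gt0 q_lt1 a0 a1 b1 c1 d1 n x.
transitivity (gnorm n.+1 * (2 * x * recD q a b c d (q ^+ n.+1) * aw_val q a b c d n.+1 x)).
  by ring.
by rewrite H; ring.
Qed.

Lemma gpoly_rec0 : 2 * recD q a b c d 1 *: ('X * gpoly 0) =
  gaugeA q a b c d 1 *: gpoly 1 + gaugeB q a b c d 1 *: gpoly 0.
Proof.
apply: poly_ext => x; rewrite gpolyZX !hornerD !gpolyZ.
have := gaugeA_gnorm 0; rewrite expr0 => EA.
rewrite (mulrA _ (gnorm 1)) EA.
have H := aw_val_rec0 q_gt0 q_lt1 a0 a1 b1 c1 d1 x.
transitivity (gnorm 0 * (2 * x * recD q a b c d 1 * aw_val q a b c d 0 x)); first by ring.
by rewrite H; ring.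
Qed.

Definition cpoly (n : nat) : {poly C} := map_poly (real_complex R) (gpoly n).

Lemma cpolyE n : cpoly n = xi_a q a b c d n%:R *: map_poly (real_complex R) (aw_poly q a b c d n).
Proof.
rewrite /cpoly /gpoly map_polyZ; congr (_ *: _).
by rewrite (xi_a_nat q_gt0 q_lt1 a_gt0 b_lt0 c_lt0 d_gt0 A1_gt0 B1_gt0 adE bcE).
Qed.

Lemma size_cpoly n : size (cpoly n) = n.+1.
Proof.
rewrite cpolyE size_scale; last exact: (xi_a_nat_neq0 _ _ _ _ _ _ _ _ adE bcE).
by rewrite size_map_poly size_aw_poly.
Qed.

Lemma cpoly_rec n : (2 * recD q a b c d (q ^+ n.+1))%:C *: ('X * cpoly n.+1) =
  (gaugeA q a b c d (q ^+ n.+1))%:C *: cpoly n.+2 + (gaugeB q a b c d (q ^+ n.+1))%:C *: cpoly n.+1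
  + (gaugeC q a b c d (q ^+ n.+1))%:C *: cpoly n.
Proof.
exact: map_poly_rec (gpoly_rec n).
Qed.

Lemma cpoly_rec0 : (2 * recD q a b c d 1)%:C *: ('X * cpoly 0) =
  (gaugeA q a b c d 1)%:C *: cpoly 1 + (gaugeB q a b c d 1)%:C *: cpoly 0.
Proof.
have H := gpoly_rec0.
have := map_poly_rec (h := 2 * recD q a b c d 1) (x := gaugeA q a b c d 1) (y := gaugeB q a b c d 1)
  (z := 0) (p := gpoly 0) (p2 := gpoly 1) (p1 := gpoly 0) (p0 := 0).
by rewrite scaler0 addr0 => /(_ H); rewrite scale0r addr0.
Qed.

Section Nodes.
Variables (k : nat) (y : 'I_k -> R).
Hypothesis y_gt1 : forall j, 1 < `|y j|.
Local Notation T := (krall_cont q a b c d y).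
Local Notation yc := (fun j => (y j)%:C : C).

Lemma Lfun_cpoly n : Lfun yc T (cpoly n) = (2 / pi * (gnorm n * rL q a b c d (aw_val q a b c d n)))%:C.
Proof.
rewrite /Lfun /nodal krall_cont_real //; congr (_%:C); congr (_ * _).
have ca : {within [set` `[(-1)%R, 1%R]], continuous (aw_val q a b c d n)}.
  rewrite (_ : aw_val _ _ _ _ _ _ = horner ((gnorm n)^-1 *: gpoly n)); first exact: within_horner.
  by apply/funext => x; rewrite hornerZ gpolyE mulKf // gnorm_neq0.
have c0 : {within ([set` `[(-1)%R, 1%R]] : set R), continuous (fun=> 0 : R)}.
  exact: within_cst.
have := rL_lin q_gt0 q_lt1 a1 b1 c1 d1 (gnorm n) ca c0.
have -> : rL q a b c d (fun=> 0) = 0.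
  have := rL_lin q_gt0 q_lt1 a1 b1 c1 d1 1 c0 c0.
  rewrite (_ : (fun x : R => 1 * 0 + 0) = (fun x : R => 0 : R)); last by apply/funext => x; rewrite mulr0 addr0.
  move: (rL _ _ _ _ _ _) => r; rewrite mul1r => /(congr1 (fun u => u - r)).
  by rewrite subrr addrK => ->.
rewrite addr0 => <-; congr rL; apply/funext => x; by rewrite gpolyE addr0.
Qed.

Lemma Lfun_cpolyS n : Lfun yc T (cpoly n.+1) = 0.
Proof. by rewrite Lfun_cpoly rL_aw_val // !mulr0. Qed.

Lemma Lfun_cpoly0 : Lfun yc T (cpoly 0) != 0.
Proof.
rewrite Lfun_cpoly fmorph_eq0; apply: mulf_neq0; first by rewrite mulf_neq0 ?invr_eq0 // gt_eqF // pi_gt0.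
apply: mulf_neq0; first exact: gnorm_neq0.
rewrite (_ : aw_val _ _ _ _ _ _ = (fun=> 1)) ?gt_eqF //; first exact: rL1_gt0.
by apply/funext => x; rewrite /aw_val aw_sum1.
Qed.

End Nodes.
End GaugedPolys.

(** * Polynomial dependence on the masses *)

Section PolynomialFunctions.
Variables (F : comNzRingType) (k : nat).

Definition mpolyfun (f : ('I_k -> F) -> F) :=
  exists p : mpoly.mpoly k F, forall x, mpoly.meval x p = f x.

Lemma mpolyfun_cst h : mpolyfun (fun=> h).
Proof. by exists (mpoly.mpolyC k h) => x; rewrite mpoly.mevalC. Qed.

Lemma mpolyfun_coord j : mpolyfun (fun x => x j).
Proof. by exists (mpoly.mpolyX F (mpoly.mnm1 j)) => x; rewrite mpoly.mevalXU. Qed.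

Lemma mpolyfunD f g : mpolyfun f -> mpolyfun g -> mpolyfun (fun x => f x + g x).
Proof. by move=> [p hp] [r hr]; exists (p + r) => x; rewrite mpoly.mevalD hp hr. Qed.

Lemma mpolyfunM f g : mpolyfun f -> mpolyfun g -> mpolyfun (fun x => f x * g x).
Proof. by move=> [p hp] [r hr]; exists (p * r) => x; rewrite mpoly.mevalM hp hr. Qed.

Lemma mpolyfun_sum I (r : seq I) (f : I -> ('I_k -> F) -> F) :
  (forall i, mpolyfun (f i)) -> mpolyfun (fun x => \sum_(i <- r) f i x).
Proof.
move=> h; elim: r => [|i r [p hp]]; first by exists 0 => x; rewrite big_nil mpoly.meval0.
by have [u hu] := h i; exists (u + p) => x; rewrite big_cons mpoly.mevalD hu hp.
Qed.

Lemma mpolyfun_prod I (r : seq I) (f : I -> ('I_k -> F) -> F) :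
  (forall i, mpolyfun (f i)) -> mpolyfun (fun x => \prod_(i <- r) f i x).
Proof.
move=> h; elim: r => [|i r [p hp]]; first by exists 1 => x; rewrite big_nil mpoly.meval1.
by have [u hu] := h i; exists (u * p) => x; rewrite big_cons mpoly.mevalM hu hp.
Qed.

Lemma mpolyfun_det n (f : 'I_n -> 'I_n -> ('I_k -> F) -> F) :
  (forall i j, mpolyfun (f i j)) -> mpolyfun (fun x => \det (\matrix_(i, j) f i j x)).
Proof.
move=> h; have [p hp] : mpolyfun (fun x => \sum_(s : 'S_n) (-1) ^+ s * \prod_i f i (s i) x).
  apply: mpolyfun_sum => s; apply: mpolyfunM; first exact: mpolyfun_cst.
  exact: mpolyfun_prod.
exists p => x; rewrite hp; apply: eq_bigr => s _; congr (_ * _).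
by apply: eq_bigr => i _; rewrite mxE.
Qed.

End PolynomialFunctions.

(** * Both directions for rows that solve the recurrence *)

Section Frame.
Variables (R : realType) (q : R).
Hypotheses (q_gt0 : 0 < q) (q_lt1 : q < 1).
Local Notation C := (cplx R).
Variables a b c d : R.
Variables A1 B1 : nat.
Hypotheses (a_gt0 : 0 < a) (b_lt0 : b < 0) (c_lt0 : c < 0) (d_gt0 : 0 < d).
Hypotheses (A1_gt0 : (0 < A1)%N) (B1_gt0 : (0 < B1)%N).
Hypotheses (adE : a * d = q ^+ A1) (bcE : b * c = q ^+ B1).
Hypotheses (a1 : `|a| < 1) (b1 : `|b| < 1) (c1 : `|c| < 1) (d1 : `|d| < 1).

Variables (k : nat) (isb : 'I_k -> bool) (y : 'I_k -> R).
Hypotheses (y_inj : injective y) (y_gt1 : forall j, 1 < `|y j|).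
Hypothesis B1_gt1 : forall j, isb j -> (1 < B1)%N.

Let yc j : C := (y j)%:C.
Local Notation N n := (q `^ (n%:~R : R)).
Local Notation T := (krall_cont q a b c d y).
Local Notation P := (cpoly q a b c d).

Let cA (n : int) : C := (gaugeA q a b c d (N n))%:C.
Let cB (n : int) : C := (gaugeB q a b c d (N n))%:C.
Let cC (n : int) : C := (gaugeC q a b c d (N n))%:C.
Let cD (n : int) : C := (2 * recD q a b c d (N n))%:C.

Let yc_inj : injective yc.
Proof. by move=> i j [/y_inj]. Qed.

Definition rows_sol (phi : 'I_k -> {poly C}) := forall j s,
  if isb j then csol q b a d c (y j) (fun s => (phi j).[(lambda q a b c d s)%:C]) s
  else csol q a b c d (y j) (fun s => (phi j).[(lambda q a b c d s)%:C]) s.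

Section Bounds.
Hypotheses (k_lt : (k < A1)%N) (k2_lt : (k.*2 < A1 + B1)%N).

Let cA_neq0 : (0 < k)%N -> forall n : nat, cA n != 0.
Proof.
move=> k0 n; rewrite fmorph_eq0.
apply: (gaugeA_neq0 q_gt0 q_lt1 a_gt0 b_lt0 c_lt0 d_gt0 B1_gt0 adE bcE).
by move: k0 k_lt B1_gt0; clear; lia.
Qed.

Let cA_N1 : cA (-1) = 0.
Proof. by rewrite /cA gaugeA_N1. Qed.

Let cC_neq0 (n : int) : - k%:Z < n -> cC n != 0.
Proof.
move=> kn; rewrite fmorph_eq0.
apply: (gaugeC_neq0 q_gt0 q_lt1 a_gt0 b_lt0 c_lt0 adE bcE).
- by move: kn k_lt; clear; lia.
- by move: kn k2_lt k_lt B1_gt0; clear; lia.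
- by move: kn k2_lt; clear; lia.
Qed.

Let cD_neq0 (n : int) : - k%:Z < n -> cD n != 0.
Proof.
move=> kn; rewrite fmorph_eq0 mulf_neq0 ?pnatr_eq0 //.
by apply: (recD_neq0 q_gt0 q_lt1 adE bcE); move: kn k2_lt; clear; lia.
Qed.

Let sizeP n : size (P n) = n.+1.
Proof. exact: (size_cpoly q_gt0 q_lt1 a_gt0 b_lt0 c_lt0 d_gt0 A1_gt0 B1_gt0 adE bcE a1 b1 c1 d1). Qed.

Let recP n : cD n.+1 *: ('X * P n.+1) = cA n.+1 *: P n.+2 + cB n.+1 *: P n.+1 + cC n.+1 *: P n.
Proof.
rewrite /cD /cA /cB /cC -[n.+1%:~R]/(n.+1%:R) qpow_nat //.
exact: (cpoly_rec q_gt0 q_lt1 a_gt0 a1 b1 c1 d1).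
Qed.

Let recP0 : cD 0 *: ('X * P 0) = cA 0 *: P 1 + cB 0 *: P 0.
Proof. rewrite /cD /cA /cB powRr0; exact: (cpoly_rec0 q_gt0 q_lt1 a_gt0 a1 b1 c1 d1). Qed.

Let L_P n : Lfun yc T (P n.+1) = 0.
Proof. exact: (Lfun_cpolyS q_gt0 q_lt1 a_gt0 b_lt0 c_lt0 d_gt0 A1_gt0 B1_gt0 adE bcE). Qed.

Let L_P0 : Lfun yc T (P 0) != 0.
Proof. exact: (Lfun_cpoly0 q_gt0 q_lt1 a_gt0 b_lt0 c_lt0 d_gt0 A1_gt0 B1_gt0 adE bcE). Qed.

Let T_lin h f g : T (h *: f + g) = h * T f + T g.
Proof. exact: krall_cont_lin. Qed.

Section Poly.
Variable phi : 'I_k -> {poly C}.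
Hypothesis rows : rows_sol phi.
Local Notation Ph := (Phi q a b c d isb phi).

Lemma recPhi j (n : int) : - k%:Z < n ->
  cD n * yc j * Ph j n = cA n * Ph j (n + 1) + cB n * Ph j n + cC n * Ph j (n - 1).
Proof.
move=> kn; apply: (Phi_rec q_gt0 q_lt1 a_gt0 b_lt0 c_lt0 adE rows).
by move: kn k_lt; clear; lia.
Qed.

Lemma tau_dtau (n : int) : -1 <= n -> tau q a b c d isb phi n = allfac q a b c d isb n%:~R * dtau Ph n.
Proof. exact: (tauE q_gt0 q_lt1 a_gt0 b_lt0 c_lt0 d_gt0 A1_gt0 B1_gt0 adE bcE phi k_lt B1_gt1). Qed.

Lemma tau_neq0 (n : int) : -1 <= n -> (tau q a b c d isb phi n != 0) = (dtau Ph n != 0).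
Proof.
move=> n1; rewrite tau_dtau // mulf_eq0.
by rewrite (negbTE (allfac_neq0 q_gt0 q_lt1 a_gt0 b_lt0 c_lt0 d_gt0 A1_gt0 B1_gt0 adE bcE k_lt B1_gt1 n1)).
Qed.

Lemma phatE n : phat q a b c d isb phi n = allfac q a b c d isb n%:R *: dpoly P Ph n.
Proof.
rewrite /phat /dpoly scaler_sumr; apply: eq_bigr => l ln.
rewrite (QcoefE q_gt0 q_lt1 a_gt0 b_lt0 c_lt0 d_gt0 A1_gt0 B1_gt0 adE bcE phi k_lt B1_gt1 ln).
have E : solcof (sol q a b c d isb phi) n%:R l = dcoef Ph n l.
  apply: (congr1 (fun M => cofactor M ord_max l)); apply/matrixP => i j; rewrite !mxE.
  by case: (unlift ord_max i) => //= i'; rewrite /Phi rmorphB.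
have aux (f x s : C) (p : {poly C}) : (f * x * s) *: p = f *: (s *: (x *: p)).
  by rewrite !scalerA; congr (_ *: _); ring.
have E2 := cpolyE q_gt0 q_lt1 a_gt0 b_lt0 c_lt0 d_gt0 A1_gt0 B1_gt0 adE bcE (n - l).
by rewrite aux E -E2.
Qed.

Lemma krall_integralE (theta : 'I_k -> C) (p r : {poly C}) :
  krall_integral q a b c d y (fun j => theta j * bary yc j) (fun x => p.[x%:C] * r.[x%:C])
  = krall yc T theta (p * r).
Proof.
rewrite /krall_integral /krall; congr (_ + _).
  by rewrite /krall_cont; congr cintegral; apply/funext => x; rewrite hornerM.
by apply: eq_bigr => j _; rewrite hornerM.
Qed.

Hypothesis dtau0 : forall n : int, -1 <= n -> dtau Ph n != 0.

(** [phat] is [dpoly] up to the factor [allfac], nonzero at each n, so degrees and orthogonality are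
    those of [dpoly]. *)
Lemma orth_of_theta (theta : 'I_k -> C) :
  (forall j (n : nat), Ph j n =
    scaleK yc T cC cD P Ph j * (stieltjes yc T j (P n) + theta j * (P n).[yc j])) ->
  orthogonal_polys (phat q a b c d isb phi)
    (krall_integral q a b c d y (fun j => theta j * bary yc j)).
Proof.
move=> hth.
have f0 (n : nat) : allfac q a b c d isb n%:R != 0.
  have n1 : -1 <= n%:Z by [].
  exact: (allfac_neq0 q_gt0 q_lt1 a_gt0 b_lt0 c_lt0 d_gt0 A1_gt0 B1_gt0 adE bcE k_lt B1_gt1 n1).
have hE n m : krall yc T theta (phat q a b c d isb phi n * phat q a b c d isb phi m) =
    allfac q a b c d isb n%:R * allfac q a b c d isb m%:R * krall yc T theta (dpoly P Ph n * dpoly P Ph m).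
  rewrite !phatE -scalerAl -scalerAr scalerA.
  move: (_ * allfac _ _ _ _ _ _ _) (dpoly _ _ _ * _) => h f.
  rewrite /krall (TZ T_lin) mulrDr; congr (_ + _).
  by rewrite mulr_sumr; apply: eq_bigr => j _; rewrite hornerZ; ring.
split=> [n|n m nm|n].
- rewrite phatE size_scale //.
  exact: (size_dpoly cA_neq0 sizeP L_P0).
- rewrite krall_integralE hE.
  by rewrite (krall_orth yc_inj T_lin cA_neq0 cA_N1 cC_neq0 cD_neq0 sizeP recP L_P L_P0 recPhi dtau0 hth nm) mulr0.
- rewrite krall_integralE hE; apply/eqP; apply: mulf_neq0; first by apply: mulf_neq0.
  exact: (krall_norm yc_inj T_lin cA_neq0 cA_N1 cC_neq0 cD_neq0 sizeP recP L_P L_P0 recPhi dtau0 hth).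
Qed.

Lemma exists_nu : exists nu : 'I_k -> C,
  orthogonal_polys (phat q a b c d isb phi) (krall_integral q a b c d y nu).
Proof.
have N1 := Phi_N1_neq0 cA_neq0 cA_N1 cC_neq0 cD_neq0 L_P0 recPhi dtau0.
have [theta hth] : exists theta : 'I_k -> C, forall j (n : nat), Ph j n =
    scaleK yc T cC cD P Ph j * (stieltjes yc T j (P n) + theta j * (P n).[yc j]).
  apply: (@fin_all_exists _ _ (fun j x => forall n : nat, Ph j n =
    scaleK yc T cC cD P Ph j * (stieltjes yc T j (P n) + x * (P n).[yc j]))) => j.
  exact: (Phi_stieltjes T_lin cA_neq0 cC_neq0 cD_neq0 sizeP recP recP0 L_P L_P0 recPhi (N1 j)).
by exists (fun j => theta j * bary yc j); exact: orth_of_theta.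
Qed.

End Poly.
Section Converse.
Variables p1 p2 : 'I_k -> {poly C}.
Hypotheses (rows1 : rows_sol p1) (rows2 : rows_sol p2).
Local Notation lam s := ((lambda q a b c d s)%:C : C).
Hypotheses (p1_N1 : forall j, (p1 j).[lam (-1)] != 0) (p2_N1 : forall j, (p2 j).[lam (-1)] = 0).
Hypothesis p2_0 : forall j, (p2 j).[lam 0] != 0.

Lemma csol_comb a' b' c' d' Y f g (h h' : C) s :
  csol q a' b' c' d' Y f s -> csol q a' b' c' d' Y g s ->
  csol q a' b' c' d' Y (fun s => h * f s + h' * g s) s.
Proof.
rewrite /csol; set D := (2 * _ * _)%:C; set A := _%:C; set B := (gaugeB _ _ _ _ _ _)%:C; set Cc := (gaugeC _ _ _ _ _ _)%:C.
move=> h1 h2; transitivity (h * (D * f s) + h' * (D * g s)); first by ring.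
by rewrite h1 h2; ring.
Qed.

Lemma rows_comb phi (h h' : 'I_k -> C) :
  (forall j s, (phi j).[lam s] = h j * (p1 j).[lam s] + h' j * (p2 j).[lam s]) -> rows_sol phi.
Proof.
move=> e j s; have := rows1 j s; have := rows2 j s.
have -> : (fun s => (phi j).[lam s]) = (fun s => h j * (p1 j).[lam s] + h' j * (p2 j).[lam s]).
  by apply/funext => u; exact: e.
by case: (isb j) => r2 r1; exact: csol_comb.
Qed.

Lemma Phi_comb phi (h h' : 'I_k -> C) j n :
  (forall j s, (phi j).[lam s] = h j * (p1 j).[lam s] + h' j * (p2 j).[lam s]) ->
  Phi q a b c d isb phi j n = h j * Phi q a b c d isb p1 j n + h' j * Phi q a b c d isb p2 j n.
Proof. by move=> e; rewrite /Phi /sol e; ring. Qed.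

(** The exceptional sets are the zero sets of tau_n as polynomials in the masses. The given choice
    shows that they are proper: its coefficient of [p1] cannot vanish, as Phi_j(-1) would be 0, so
    after division it has the form p1 + c p2 and belongs to some masses. The condition on the ratio
    does not involve phi and is inherited. *)
Lemma generic_orthogonal :
  (exists phi (h h' : 'I_k -> C), [/\
     forall j s, (phi j).[lam s] = h j * (p1 j).[lam s] + h' j * (p2 j).[lam s],
     forall n : int, -1 <= n -> dtau (Phi q a b c d isb phi) n != 0 &
     standing q a b c d isb phi]) ->
  generically (fun nu : 'I_k -> C => exists phi : 'I_k -> {poly C},
    [/\ forall j, exists h, phi j = p1 j + h *: p2 j, standing q a b c d isb phi &
       orthogonal_polys (phat q a b c d isb phi) (krall_integral q a b c d y nu)]).
Proof.
move=> [phi0 [h [h' [e0 dt0 [_ hr]]]]].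
have rows0 := rows_comb e0.
have N1 := Phi_N1_neq0 cA_neq0 cA_N1 cC_neq0 cD_neq0 L_P0 (recPhi rows0) dt0.
set Phi1 := Phi q a b c d isb p1; set Phi2 := Phi q a b c d isb p2.
have om0 j (n : int) : isb j -> -1 <= n -> omega q a b c d n%:~R != 0.
  move=> ij n1; have kk := ltn_ord j.
  apply: (omega_int_neq0 q_gt0 q_lt1 a_gt0 b_lt0 c_lt0 d_gt0 A1_gt0 B1_gt0 adE bcE).
    by move: kk k_lt n1; clear; lia.
  by move: (B1_gt1 ij) n1; clear; lia.
have Phi1_N1 j : Phi1 j (-1) != 0.
  rewrite /Phi1 /Phi /sol; apply: mulf_neq0; last exact: p1_N1.
  by case: ifP => [ij|_]; [apply: (om0 j)|exact: oner_neq0].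
have Phi2_N1 j : Phi2 j (-1) = 0 by rewrite /Phi2 /Phi /sol p2_N1 mulr0.
have Phi2_0 j : Phi2 j 0 != 0.
  rewrite /Phi2 /Phi /sol; apply: mulf_neq0; last exact: p2_0.
  by case: ifP => [ij|_]; [apply: (om0 j)|exact: oner_neq0].
have h0 j : h j != 0.
  by apply: contraNneq (N1 j) => hj; rewrite (Phi_comb _ _ e0) hj mul0r add0r -/Phi2 Phi2_N1 mulr0.
have [u [v [u0 def]]] := deformation yc_inj T_lin cA_neq0 cC_neq0 cD_neq0 sizeP recP recP0 L_P L_P0
  (recPhi rows1) (recPhi rows2) Phi1_N1 Phi2_N1 Phi2_0.
pose phi (nu : 'I_k -> C) j := p1 j + (u j * nu j + v j) *: p2 j.
have ePhi nu j n : Phi q a b c d isb (phi nu) j n = Phi1 j n + (u j * nu j + v j) * Phi2 j n.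
  rewrite (Phi_comb (h := fun=> 1) (h' := fun j => u j * nu j + v j)) ?mul1r // => i s.
  by rewrite /phi hornerD hornerZ mul1r.
(* The shift by one lets i : nat run over all n >= -1. *)
exists (fun i => [set nu | dtau (Phi q a b c d isb (phi nu)) (i%:Z - 1) = 0]) => [i|nu hnu].
  split.
    have [p hp] : mpolyfun (fun nu : 'I_k -> C => dtau (Phi q a b c d isb (phi nu)) (i%:Z - 1)).
      apply: mpolyfun_det => r l.
      have [p hp] : mpolyfun (fun nu : 'I_k -> C => Phi1 r (i%:Z - 1 - (l : nat)%:Z)
          + (u r * nu r + v r) * Phi2 r (i%:Z - 1 - (l : nat)%:Z)).
        apply: mpolyfunD; first exact: mpolyfun_cst.
        apply: mpolyfunM; last exact: mpolyfun_cst.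
        apply: mpolyfunD; last exact: mpolyfun_cst.
        by apply: mpolyfunM; [exact: mpolyfun_cst|exact: mpolyfun_coord].
      by exists p => x; rewrite hp ePhi.
    exists [set p]; apply/seteqP; split=> [x /= hx _ ->|x /= /(_ p erefl)]; first by rewrite hp.
    by rewrite hp.
  (* The masses for which c_j = h'_j / h_j; row j of the given choice is h_j times the resulting
     row. *)
  move=> /seteqP [_ /(_ (fun j => (h' j / h j - v j) / u j) I)] /=.
  set nu0 := fun j => _; have n1 : -1 <= i%:Z - 1 by clear; lia.
  apply/eqP; move: (dt0 _ n1); apply: contraNneq => hz.
  (* Transposed, since [det_scale_col] scales columns while the h_j scale rows. *)
  pose M : 'M[C]_k := \matrix_(r, l) Phi q a b c d isb (phi nu0) l (i%:Z - 1 - (r : nat)%:Z).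
  have E : \matrix_(r, l) (M r l * h l) =
      (\matrix_(r < k, l < k) Phi q a b c d isb phi0 r (i%:Z - 1 - (l : nat)%:Z))^T.
    apply/matrixP => r l; rewrite !mxE ePhi (Phi_comb _ _ e0) -/Phi1 -/Phi2 /nu0.
    by field; rewrite h0 u0.
  have := congr1 determinant E; rewrite det_scale_col det_tr /dtau => <-.
  have -> : M = (\matrix_(r < k, l < k) Phi q a b c d isb (phi nu0) r (i%:Z - 1 - (l : nat)%:Z))^T.
    by apply/matrixP => r l; rewrite !mxE.
  by rewrite det_tr -[X in X * _]/(dtau _ _) hz mul0r.
have rows_phi : rows_sol (phi nu).
  apply: (rows_comb (h := fun=> 1) (h' := fun j => u j * nu j + v j)) => i s.
  by rewrite /phi hornerD hornerZ mul1r.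
have dt n : -1 <= n -> dtau (Phi q a b c d isb (phi nu)) n != 0.
  move=> n1; apply/eqP => hn; apply: hnu; exists (absz (n + 1)) => //=.
  by rewrite gez0_abs ?addrK //; move: n1; clear; lia.
exists (phi nu); split; first by move=> j; eexists.
  by split=> // n n1; rewrite tau_neq0 // dt.
have E : (fun j => nu j / bary yc j * bary yc j) = nu.
  by apply/funext => j; rewrite divfK // invr_eq0 conodal_neq0.
have := orth_of_theta rows_phi dt (theta := fun j => nu j / bary yc j).
rewrite E; apply=> j n; rewrite ePhi def; congr (_ * _).
rewrite /scaleK; congr (- (_ * _) / _).
exact/esym/ePhi.
Qed.

End Converse.

End Bounds.

(** Without rows of type b the ratio reduces to xi^a and bounds nothing; the inequality then comes
    from k1 <= alpha and l > 0. *)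
Hypothesis k_lt_pure : (forall j, isb j = false) -> (k < A1)%N.

Lemma standing_bounds phi : rows_sol phi -> standing q a b c d isb phi ->
  (k < A1)%N /\ (k.*2 < A1 + B1)%N.
Proof.
move=> rows [t0 hr].
have kA : (k < A1)%N.
  have [/existsP [j ij]|/existsPn nb] := boolP [exists j, isb j].
    exact: (k_lt_A1 q_gt0 q_lt1 a_gt0 b_lt0 c_lt0 d_gt0 A1_gt0 B1_gt0 adE bcE (B1_gt1 ij) ij hr).
  by apply: k_lt_pure => j; apply/negbTE/nb.
split=> //; apply: (double_k_lt q_gt0 q_lt1 a_gt0 b_lt0 c_lt0 B1_gt0 adE bcE rows kA).
by have := t0 (-1) (lexx _); rewrite (tau_neq0 kA).
Qed.

Lemma standing_dtau phi : rows_sol phi -> standing q a b c d isb phi ->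
  forall n : int, -1 <= n -> dtau (Phi q a b c d isb phi) n != 0.
Proof.
move=> rows std n n1; have [kA _] := standing_bounds rows std.
by have [t0 _] := std; rewrite -(tau_neq0 kA) // t0.
Qed.

Lemma orthogonal_exists phi : rows_sol phi -> standing q a b c d isb phi ->
  exists nu : 'I_k -> C,
  orthogonal_polys (phat q a b c d isb phi) (krall_integral q a b c d y nu).
Proof.
move=> rows std; have [kA k2] := standing_bounds rows std.
exact: (exists_nu kA k2 rows (standing_dtau rows std)).
Qed.

End Frame.

(** * Position of the nodes and verification of the hypotheses *)

Section NodeGeometry.
Variable R : realType.

(** For 0 < z < 1, z + 1/z - 2 = (1 - z)^2 / z > 0; negative z follows by symmetry. It places the
    nodes off the support of the continuous part. *)
Lemma joukowski_gt1 (z : R) : z != 0 -> `|z| < 1 -> 1 < `|(z + z^-1) / 2|.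
Proof.
move=> z0 z1; rewrite normrM [ `|2^-1|]gtr0_norm ?invr_gt0 // ltr_pdivlMr // mul1r.
wlog zp : z z0 z1 / 0 < z => [H|].
  have [zp|zn|/eqP] := ltrgtP 0 z; [exact: H| |by rewrite eq_sym (negbTE z0)].
  have := H (- z); rewrite oppr_eq0 normrN oppr_gt0 invrN -opprD normrN; exact.
have zi : 0 < z^-1 by rewrite invr_gt0.
rewrite gtr0_norm ?addr_gt0 // -subr_gt0.
have -> : z + z^-1 - 2 = (1 - z) ^+ 2 / z by field.
rewrite divr_gt0 // exprn_gt0 // subr_gt0.
by move: z1; rewrite gtr0_norm.
Qed.

(** The difference of the two sides is proportional to (z - w) (1 - z w). *)
Lemma joukowski_inj (z w : R) : z != 0 -> w != 0 -> `|z| < 1 -> `|w| < 1 ->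
  (z + z^-1) / 2 = (w + w^-1) / 2 -> z = w.
Proof.
move=> z0 w0 z1 w1 h.
have : (z - w) * (1 - z * w) = 0.
  transitivity (- (2 * (z * w)) * ((z + z^-1) / 2 - (w + w^-1) / 2)); first by field; rewrite z0 w0.
  by rewrite h subrr mulr0.
move=> /eqP; rewrite mulf_eq0 => /orP[|]; first by rewrite subr_eq0 => /eqP.
rewrite subr_eq0 => /eqP zw; have : `|z * w| < 1 by rewrite normrM mulr_ilt1.
by rewrite -zw normr1 ltxx.
Qed.

End NodeGeometry.

Section SeedRow.
Variables (R : realType) (q : R).
Hypotheses (q_gt0 : 0 < q) (q_lt1 : q < 1).
Local Notation C := (cplx R).

Lemma gauge_csol (a b c d Y : R) U (f : R -> R) : gauge_sol q a b c d Y U ->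
  (forall s, f s = U (q `^ s)) -> forall s, csol q a b c d Y (fun s => (f s)%:C) s.
Proof.
move=> h fE s; rewrite /csol !fE.
have := h (q `^ s) (qpow_neq0 q_gt0 s) => H.
rewrite qpowB // qpowD // qpow1 // [q `^ s * q]mulrC -!rmorphM -!rmorphD; congr (_%:C).
by rewrite -H; ring.
Qed.

Variables (a b c d : R) (alpha l m : nat).
Hypotheses (b0 : b != 0) (c0 : c != 0) (d0 : d != 0).
Hypotheses (aE : a = d * q ^+ alpha) (d2 : d ^+ 2 = q ^+ l).
Hypotheses (l_gt0 : (0 < l)%N) (m_lt : (m < alpha)%N).
Hypotheses (ab : a * b < 0) (ac : a * c < 0) (bd : b * d < 0) (cd : c * d < 0).
Hypothesis bc1 : `|b * c| < 1.

Let q0 : q != 0. Proof. by rewrite gt_eqF. Qed.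

Lemma u1_csol s : csol q a b c d (seed_node q d m) (fun s => (u1 q a b c d alpha m s)%:C) s.
Proof.
apply: gauge_csol => [|u]; last exact: (u1E q_gt0 b0 c0 d0 aE m_lt).
exact: (seed1_sol q0 q_gt0 q_lt1 d0 aE d2 l_gt0 m_lt ab ac).
Qed.

Lemma u2_csol s : csol q a b c d (seed_node q d m) (fun s => (u2 q a b c d alpha l m s)%:C) s.
Proof.
apply: gauge_csol => [|u]; last exact: (u2E q_gt0 _ _ _ _ _ d0 d2).
exact: (seed2_sol q0 q_gt0 q_lt1 d0 aE d2 l_gt0 m_lt bd cd).
Qed.

Let qN1 : q `^ (-1) = q^-1. Proof. by rewrite powR_inv1 // ltW. Qed.

Lemma u1_N1 : u1 q a b c d alpha m (-1) = 1.
Proof. by rewrite u1E // qN1 seed1_N1. Qed.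

Lemma u2_N1 : u2 q a b c d alpha l m (-1) = 0.
Proof. by rewrite u2E // qN1 seed2_N1. Qed.

Lemma u2_0 : u2 q a b c d alpha l m 0 != 0.
Proof. by rewrite u2E // powRr0 seed2_0. Qed.

Lemma u1_poly : exists p : {poly R}, forall s, p.[lambda q a b c d s] = u1 q a b c d alpha m s.
Proof.
have [p hp] := seed1_poly q0 m d0 aE ab ac.
by exists p => s; rewrite u1E // lambdaE // hp // qpow_neq0.
Qed.

Lemma u2_poly : exists p : {poly R}, forall s, p.[lambda q a b c d s] = u2 q a b c d alpha l m s.
Proof.
have [p hp] := seed2_poly q0 b c aE d2 m_lt.
by exists p => s; rewrite u2E // lambdaE // hp // qpow_neq0.
Qed.

End SeedRow.

Section Rows.
Variables (R : realType) (q : R) (alpha beta l t k1 k2 : nat).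
Variables (m1 : 'I_k1 -> 'I_alpha) (m2 : 'I_k2 -> 'I_beta).
Hypotheses (q_gt0 : 0 < q) (q_lt1 : q < 1) (l_gt0 : (0 < l)%N) (t_gt0 : (0 < t)%N).
Hypotheses (k1_le : (k1 <= alpha)%N) (k2_le : (k2 <= beta)%N).
Hypotheses (m1_inj : injective m1) (m2_inj : injective m2).
Local Notation C := (cplx R).

Let a := q `^ (alpha%:R + l%:R / 2).
Let b := - q `^ (beta%:R + t%:R / 2).
Let c := - q `^ (t%:R / 2).
Let d := q `^ (l%:R / 2).
Let isb := fun j : 'I_(k1 + k2) => (k1 <= j)%N.

Let a_gt0 : 0 < a. Proof. exact: powR_gt0. Qed.
Let d_gt0 : 0 < d. Proof. exact: powR_gt0. Qed.
Let b_lt0 : b < 0. Proof. by rewrite oppr_lt0 powR_gt0. Qed.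
Let c_lt0 : c < 0. Proof. by rewrite oppr_lt0 powR_gt0. Qed.
Let aE : a = d * q ^+ alpha. Proof. by rewrite /a qpowD // qpow_nat // mulrC. Qed.
Let bE : b = c * q ^+ beta. Proof. by rewrite /b qpowD // qpow_nat // /c; ring. Qed.
Let d2 : d ^+ 2 = q ^+ l.
Proof. by rewrite expr2 -qpowD // -splitr qpow_nat. Qed.
Let c2 : c ^+ 2 = q ^+ t.
Proof. by rewrite sqrrN expr2 -qpowD // -splitr qpow_nat. Qed.
Let adE : a * d = q ^+ (alpha + l).
Proof. by rewrite aE exprD -d2; ring. Qed.
Let bcE : b * c = q ^+ (beta + t).
Proof. by rewrite bE exprD -c2; ring. Qed.

Let pow_lt1 x : 0 < x -> q `^ x < 1.
Proof.
move=> x0; have := gt0_ltr_powR x0 _ _ q_lt1.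
by rewrite powR1 !nnegrE; apply; [exact: ltW|exact: ler01].
Qed.

Let half_gt0 n : (0 < n)%N -> 0 < n%:R / 2 :> R.
Proof. by move=> n0; rewrite divr_gt0 // ltr0n. Qed.

Let a1 : `|a| < 1.
Proof. by rewrite gtr0_norm // pow_lt1 // ltr_wpDl ?ler0n // half_gt0. Qed.
Let b1 : `|b| < 1.
Proof. by rewrite normrN gtr0_norm ?powR_gt0 // pow_lt1 // ltr_wpDl ?ler0n // half_gt0. Qed.
Let c1 : `|c| < 1.
Proof. by rewrite normrN gtr0_norm ?powR_gt0 // pow_lt1 // half_gt0. Qed.
Let d1 : `|d| < 1.
Proof. by rewrite gtr0_norm // pow_lt1 // half_gt0. Qed.

Let a0 : a != 0. Proof. by rewrite gt_eqF. Qed.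
Let b0 : b != 0. Proof. by rewrite lt_eqF. Qed.
Let c0 : c != 0. Proof. by rewrite lt_eqF. Qed.
Let d0 : d != 0. Proof. by rewrite gt_eqF. Qed.
Let ab : a * b < 0. Proof. by rewrite pmulr_rlt0. Qed.
Let ac : a * c < 0. Proof. by rewrite pmulr_rlt0. Qed.
Let bd : b * d < 0. Proof. by rewrite pmulr_llt0. Qed.
Let cd : c * d < 0. Proof. by rewrite pmulr_llt0. Qed.
Let ba : b * a < 0. Proof. by rewrite mulrC. Qed.
Let dc : d * c < 0. Proof. by rewrite mulrC. Qed.

(** The preimage of the node in the unit disc under z -> (z + 1/z) / 2. Its sign separates the two
    families of nodes, its modulus the nodes of one family. *)
Definition zeta (j : 'I_(k1 + k2)) : R :=
  match fintype.split j with inl i => d * q ^+ m1 i | inr i => c * q ^+ m2 i end.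

Let q0 : q != 0. Proof. by rewrite gt_eqF. Qed.
Let zeta_neq0 j : zeta j != 0.
Proof. by rewrite /zeta; case: fintype.split => i; rewrite mulf_neq0 ?expf_neq0. Qed.

Let zeta_lt1 j : `|zeta j| < 1.
Proof.
have h u (n : nat) : `|u| < 1 -> `|u * q ^+ n| < 1.
  have qn : `|q ^+ n| <= 1 by rewrite ger0_norm ?exprn_ge0 ?exprn_ile1 // ltW.
  by move=> u1; rewrite normrM (le_lt_trans _ u1) // ler_piMr.
by rewrite /zeta; case: fintype.split => i; exact: h.
Qed.

Let zeta_inj : injective zeta.
Proof.
have q1 : q != 1 by rewrite lt_eqF.
have pinj : injective (fun n : nat => q ^+ n) by exact: ieexprIn.
have neg i j : d * q ^+ m1 i != c * q ^+ m2 j.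
  rewrite gt_eqF // (lt_trans (y := 0)) //; last by rewrite mulr_gt0 ?exprn_gt0.
  by rewrite pmulr_llt0 ?exprn_gt0.
move=> i j; rewrite /zeta; case: (split_ordP i) => i' ->; case: (split_ordP j) => j' ->.
- move=> /(mulfI d0) /pinj /val_inj /m1_inj -> //.
- by move=> /eqP; rewrite (negbTE (neg _ _)).
- by move=> /esym/eqP; rewrite (negbTE (neg _ _)).
- move=> /(mulfI c0) /pinj /val_inj /m2_inj -> //.
Qed.

Lemma nodeE j : node q l t m1 m2 j = (zeta j + (zeta j)^-1) / 2.
Proof.
have E (m n : nat) : q `^ (- m%:R - n%:R / 2) = (q `^ (n%:R / 2) * q ^+ m)^-1.
  by rewrite -opprD powRN qpowD // qpow_nat // mulrC.
have E' (m n : nat) : q `^ (m%:R + n%:R / 2) = q `^ (n%:R / 2) * q ^+ m.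
  by rewrite qpowD // qpow_nat // mulrC.
rewrite /node /zeta; case: fintype.split => i; first by rewrite /xplus E E'.
by rewrite /xminus E E' /c mulNr invrN -opprD mulNr.
Qed.

Let node_inj : injective (node q l t m1 m2).
Proof. by move=> i j; rewrite !nodeE => /(joukowski_inj _ _ _ _) /zeta_inj; apply. Qed.

Let node_gt1 j : 1 < `|node q l t m1 m2 j|.
Proof. by rewrite nodeE; exact: joukowski_gt1. Qed.

(** A row of type b exists only for k2 > 0, whence beta >= 1 and t >= 1. *)
Let B1_gt1 j : isb j -> (1 < beta + t)%N.
Proof. by rewrite /isb => kj; have := ltn_ord j; move: kj k2_le t_gt0; clear; lia. Qed.

Let k_lt_pure : (forall j, isb j = false) -> (k1 + k2 < alpha + l)%N.
Proof.
move=> h; have [k20|k20] := posnP k2; first by move: k20 k1_le l_gt0; clear; lia.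
have kk : (k1 < k1 + k2)%N by rewrite -addn1 leq_add2l.
by have := h (Ordinal kk); rewrite /isb /= leqnn.
Qed.

Definition row1 (j : 'I_(k1 + k2)) (s : R) : R :=
  match fintype.split j with
  | inl i => u1 q a b c d alpha (m1 i) s
  | inr i => u1 q b a d c beta (m2 i) s
  end.

Definition row2 (j : 'I_(k1 + k2)) (s : R) : R :=
  match fintype.split j with
  | inl i => u2 q a b c d alpha l (m1 i) s
  | inr i => u2 q b a d c beta t (m2 i) s
  end.

Lemma admissibleE phi : admissible q a b c d l t m1 m2 phi <->
  forall j, exists h h' : C, forall s, (phi j).[(lambda q a b c d s)%:C]
    = h * (row1 j s)%:C + h' * (row2 j s)%:C.
Proof.
split=> [[ha hb] j|h].
  rewrite /row1 /row2; case: (split_ordP j) => i ->.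
    by case: (ha i) => h [h' e]; exists h, h' => s; rewrite -e.
  by case: (hb i) => h [h' e]; exists h, h' => s; rewrite -e.
split=> i.
  have [h1 [h2 e]] := h (lshift k2 i); exists h1, h2 => s; rewrite e /row1 /row2.
  by rewrite -[lshift k2 i]/(unsplit (inl i)) unsplitK.
have [h1 [h2 e]] := h (rshift k1 i); exists h1, h2 => s; rewrite e /row1 /row2.
by rewrite -[rshift k1 i]/(unsplit (inr i)) unsplitK.
Qed.

Let isb_lshift i : isb (lshift k2 i) = false.
Proof. by rewrite /isb /= leqNgt ltn_ord. Qed.

Let isb_rshift i : isb (rshift k1 i) = true.
Proof. by rewrite /isb /= leq_addr. Qed.

Let split_lshift i : fintype.split (lshift k2 i) = inl i :> 'I_k1 + 'I_k2.
Proof. by rewrite -[lshift k2 i]/(unsplit (inl i)) unsplitK. Qed.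

Let split_rshift i : fintype.split (rshift k1 i) = inr i :> 'I_k1 + 'I_k2.
Proof. by rewrite -[rshift k1 i]/(unsplit (inr i)) unsplitK. Qed.

Let ad1 : `|a * d| < 1. Proof. exact: mul_lt1. Qed.
Let bc1 : `|b * c| < 1. Proof. exact: mul_lt1. Qed.

Let nodeL i : node q l t m1 m2 (lshift k2 i) = seed_node q d (m1 i).
Proof. by rewrite nodeE /zeta split_lshift. Qed.

Let nodeR i : node q l t m1 m2 (rshift k1 i) = seed_node q c (m2 i).
Proof. by rewrite nodeE /zeta split_rshift. Qed.

Let lamE s : lambda q b a d c s = lambda q a b c d s.
Proof. by rewrite /lambda; congr (_ * (1 - _ * _)); ring. Qed.

Lemma row1_csol j s : if isb j then csol q b a d c (node q l t m1 m2 j) (fun s => (row1 j s)%:C) s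
  else csol q a b c d (node q l t m1 m2 j) (fun s => (row1 j s)%:C) s.
Proof.
case: (split_ordP j) => i ->.
  rewrite isb_lshift nodeL; rewrite /row1 split_lshift.
  exact: (u1_csol q_gt0 q_lt1 b0 c0 d0 aE d2 l_gt0 (ltn_ord _) ab ac).
rewrite isb_rshift nodeR /row1 split_rshift.
exact: (u1_csol q_gt0 q_lt1 a0 d0 c0 bE c2 t_gt0 (ltn_ord _) ba bd).
Qed.

Lemma row2_csol j s : if isb j then csol q b a d c (node q l t m1 m2 j) (fun s => (row2 j s)%:C) s
  else csol q a b c d (node q l t m1 m2 j) (fun s => (row2 j s)%:C) s.
Proof.
case: (split_ordP j) => i ->.
  rewrite isb_lshift nodeL; rewrite /row2 split_lshift.
  exact: (u2_csol q_gt0 q_lt1 d0 aE d2 l_gt0 (ltn_ord _) bd cd).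
rewrite isb_rshift nodeR /row2 split_rshift.
exact: (u2_csol q_gt0 q_lt1 c0 bE c2 t_gt0 (ltn_ord _) ac dc).
Qed.

Lemma row1_N1 j : row1 j (-1) = 1.
Proof.
case: (split_ordP j) => i ->; rewrite /row1 ?split_lshift ?split_rshift.
  exact: (u1_N1 q_gt0 b0 c0 d0 aE (ltn_ord _)).
exact: (u1_N1 q_gt0 a0 d0 c0 bE (ltn_ord _)).
Qed.

Lemma row2_N1 j : row2 j (-1) = 0.
Proof.
case: (split_ordP j) => i ->; rewrite /row2 ?split_lshift ?split_rshift.
  exact: (u2_N1 q_gt0 _ _ _ d0 d2 l_gt0 (ltn_ord _)).
exact: (u2_N1 q_gt0 _ _ _ c0 c2 t_gt0 (ltn_ord _)).
Qed.

Lemma row2_0 j : row2 j 0 != 0.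
Proof.
case: (split_ordP j) => i ->; rewrite /row2 ?split_lshift ?split_rshift.
  exact: (u2_0 q_gt0 q_lt1 _ _ _ d0 d2 bc1).
exact: (u2_0 q_gt0 q_lt1 _ _ _ c0 c2 ad1).
Qed.

Lemma row1_poly j : exists p : {poly R}, forall s, p.[lambda q a b c d s] = row1 j s.
Proof.
case: (split_ordP j) => i ->; rewrite /row1 ?split_lshift ?split_rshift.
  exact: (u1_poly q_gt0 b0 c0 d0 aE (ltn_ord _) ab ac).
have [p hp] := u1_poly q_gt0 a0 d0 c0 bE (ltn_ord (m2 i)) ba bd.
by exists p => s; rewrite -hp lamE.
Qed.

Lemma row2_poly j : exists p : {poly R}, forall s, p.[lambda q a b c d s] = row2 j s.
Proof.
case: (split_ordP j) => i ->; rewrite /row2 ?split_lshift ?split_rshift.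
  exact: (u2_poly q_gt0 _ _ d0 aE d2 (ltn_ord _)).
have [p hp] := u2_poly q_gt0 a d c0 bE c2 (ltn_ord (m2 i)).
by exists p => s; rewrite -hp lamE.
Qed.

Local Notation y := (node q l t m1 m2).

Lemma admissible_rows phi : admissible q a b c d l t m1 m2 phi -> rows_sol q a b c d isb y phi.
Proof.
move=> /admissibleE h j s; have [h1 [h2 e]] := h j.
have -> : (fun s => (phi j).[(lambda q a b c d s)%:C])
    = (fun s => h1 * (row1 j s)%:C + h2 * (row2 j s)%:C) by apply/funext.
have := row1_csol j s; have := row2_csol j s.
by case: (isb j) => r2 r1; exact: csol_comb.
Qed.

Lemma darboux_orthogonal phi : admissible q a b c d l t m1 m2 phi -> standing q a b c d isb phi ->
  exists nu : 'I_(k1 + k2) -> C,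
    orthogonal_polys (phat q a b c d isb phi) (krall_integral q a b c d y nu).
Proof.
have A1_gt0 : (0 < alpha + l)%N by rewrite addn_gt0 l_gt0 orbT.
have B1_gt0 : (0 < beta + t)%N by rewrite addn_gt0 t_gt0 orbT.
move=> /admissible_rows rows std.
exact: (orthogonal_exists q_gt0 q_lt1 a_gt0 b_lt0 c_lt0 d_gt0 A1_gt0 B1_gt0 adE bcE a1 b1 c1 d1
  node_inj node_gt1 B1_gt1 k_lt_pure rows std).
Qed.

Lemma darboux_generic : (exists phi : 'I_(k1 + k2) -> {poly C},
    admissible q a b c d l t m1 m2 phi /\ standing q a b c d isb phi) ->
  generically (fun nu : 'I_(k1 + k2) -> C => exists phi : 'I_(k1 + k2) -> {poly C},
    [/\ admissible q a b c d l t m1 m2 phi, standing q a b c d isb phi &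
     orthogonal_polys (phat q a b c d isb phi) (krall_integral q a b c d y nu)]).
Proof.
have A1_gt0 : (0 < alpha + l)%N by rewrite addn_gt0 l_gt0 orbT.
have B1_gt0 : (0 < beta + t)%N by rewrite addn_gt0 t_gt0 orbT.
move=> [phi0 [adm0 std0]]; have rows0 := admissible_rows adm0.
have [kA k2lt] := standing_bounds q_gt0 q_lt1 a_gt0 b_lt0 c_lt0 d_gt0 A1_gt0 B1_gt0 adE bcE
  B1_gt1 k_lt_pure rows0 std0.
have dt0 := standing_dtau q_gt0 q_lt1 a_gt0 b_lt0 c_lt0 d_gt0 A1_gt0 B1_gt0 adE bcE
  B1_gt1 k_lt_pure rows0 std0.
have [P1 hP1] := fin_all_exists row1_poly; have [P2 hP2] := fin_all_exists row2_poly.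
pose p1 j : {poly C} := map_poly (real_complex R) (P1 j).
pose p2 j : {poly C} := map_poly (real_complex R) (P2 j).
have e1 j s : (p1 j).[(lambda q a b c d s)%:C] = (row1 j s)%:C.
  by rewrite /p1 horner_map hP1.
have e2 j s : (p2 j).[(lambda q a b c d s)%:C] = (row2 j s)%:C.
  by rewrite /p2 horner_map hP2.
have rows1 : rows_sol q a b c d isb y p1.
  apply: admissible_rows; apply/admissibleE => j; exists 1, 0 => s.
  by rewrite e1 mul1r mul0r addr0.
have rows2 : rows_sol q a b c d isb y p2.
  apply: admissible_rows; apply/admissibleE => j; exists 0, 1 => s.
  by rewrite e2 mul1r mul0r add0r.
have n1 j : (p1 j).[(lambda q a b c d (-1))%:C] != 0 by rewrite e1 row1_N1 oner_neq0.
have n2 j : (p2 j).[(lambda q a b c d (-1))%:C] = 0 by rewrite e2 row2_N1.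
have n3 j : (p2 j).[(lambda q a b c d 0)%:C] != 0 by rewrite e2 fmorph_eq0 row2_0.
have [hh hhE] : exists hh : 'I_(k1 + k2) -> C * C, forall j s, (phi0 j).[(lambda q a b c d s)%:C]
    = (hh j).1 * (p1 j).[(lambda q a b c d s)%:C] + (hh j).2 * (p2 j).[(lambda q a b c d s)%:C].
  apply: (@fin_all_exists _ _ (fun j (h : C * C) => forall s, (phi0 j).[(lambda q a b c d s)%:C]
    = h.1 * (p1 j).[(lambda q a b c d s)%:C] + h.2 * (p2 j).[(lambda q a b c d s)%:C])) => j.
  have /admissibleE/(_ j) [h1 [h2 e]] := adm0.
  by exists (h1, h2) => s; rewrite e e1 e2.
have G := generic_orthogonal q_gt0 q_lt1 a_gt0 b_lt0 c_lt0 d_gt0 A1_gt0 B1_gt0 adE bcE a1 b1 c1 d1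
  node_inj node_gt1 B1_gt1 kA k2lt rows1 rows2 n1 n2 n3.
have [|V hV gV] := G.
  by exists phi0, (fun j => (hh j).1), (fun j => (hh j).2).
exists V => // nu /gV [phi [ephi std orth]]; exists phi; split=> //.
apply/admissibleE => j; have [h eh] := ephi j; exists 1, h => s.
by rewrite eh hornerD hornerZ e1 e2 mul1r.
Qed.

End Rows.

Theorem theorem6p3 (R : realType) (q : R) (alpha beta l t k1 k2 : nat)
    (m1 : 'I_k1 -> 'I_alpha) (m2 : 'I_k2 -> 'I_beta)
    (q_gt0 : 0 < q) (q_lt1 : q < 1) (l_gt0 : (0 < l)%N) (t_gt0 : (0 < t)%N)
    (k1_le : (k1 <= alpha)%N) (k2_le : (k2 <= beta)%N)
    (m1_inj : injective m1) (m2_inj : injective m2) :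
  let a := q `^ (alpha%:R + l%:R / 2) in
  let b := - q `^ (beta%:R + t%:R / 2) in
  let c := - q `^ (t%:R / 2) in
  let d := q `^ (l%:R / 2) in
  let isb := fun j : 'I_(k1 + k2) => (k1 <= j)%N in
  let adm := admissible q a b c d l t m1 m2 in
  let std := standing q a b c d isb in
  let pol := phat q a b c d isb in
  let mu := krall_integral q a b c d (node q l t m1 m2) in
  (forall phi : 'I_(k1 + k2) -> {poly cplx R},
     adm phi -> std phi ->
     exists nu : 'I_(k1 + k2) -> cplx R, orthogonal_polys (pol phi) (mu nu))
  /\
  ((exists phi : 'I_(k1 + k2) -> {poly cplx R}, adm phi /\ std phi) ->
   generically (fun nu : 'I_(k1 + k2) -> cplx R =>
     exists phi : 'I_(k1 + k2) -> {poly cplx R},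
       [/\ adm phi, std phi & orthogonal_polys (pol phi) (mu nu)])).
Proof.
move=> a b c d isb adm std pol mu; split; first by move=> phi; exact: darboux_orthogonal.
exact: darboux_generic.
Qed.
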